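(* Let $K$ be an algebraically closed field of characteristic $0$, let $m\ge 1$, $d\ge 2$, $N=\binom{m+d}{d}-1$, and let $X_{m,d}\subset\mathbb{P}^N$ be the $d$-uple Veronese variety of $\mathbb{P}^m$. Let $P\in\mathbb{P}^N$ be a point such that $$\mathrm{sbr}(P)<\mathrm{sr}(P)\quad\text{and}\quad \mathrm{sbr}(P)+\mathrm{sr}(P)\le 2d+1.$$ Let $\mathcal{S}\subset X_{m,d}$ be a $0$-dimensional reduced subscheme that realizes the symmetric rank of $P$, and let $\mathcal{Z}\subset X_{m,d}$ be a $0$-dimensional non-reduced subscheme such that $P\in\langle\mathcal{Z}\rangle$ and $\deg(\mathcal{Z})\le\mathrm{sbr}(P)$. Then there is a unique rational normal curve $C_d\subset X_{m,d}$ of degree $d$ such that $\deg(C_d\cap(\mathcal{S}\cup\mathcal{Z}))\ge d+2$, and $$\mathcal{S}=\mathcal{S}_1\sqcup\mathcal{S}_2,\qquad \mathcal{Z}=\mathcal{Z}_1\sqcup\mathcal{S}_2,$$ where $\mathcal{S}_1=\mathcal{S}\cap C_d$, $\mathcal{Z}_1=\mathcal{Z}\cap C_d$ and $\mathcal{S}_2=(\mathcal{S}\cap\mathcal{Z})\setminus\mathcal{S}_1$. Moreover, $C_d$, $\mathcal{S}_2$ and $\mathcal{Z}$ are unique (that is, they are determined by $P$), $\deg(\mathcal{Z})=\mathrm{sbr}(P)$, $\deg(\mathcal{Z}_1)+\deg(\mathcal{S}_1)=d+2$, $\mathcal{Z}_1\cap\mathcal{S}_1=\emptyset$, and $\mathcal{Z}$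 is the unique zero-dimensional subscheme $W$ of $X_{m,d}$ such that $\deg(W)\le\mathrm{sbr}(P)$ and $P\in\langle W\rangle$.
   Context: $X_{m,d}=\nu_d(\mathbb{P}^m)\subset\mathbb{P}^N$ is the image of the $d$-uple Veronese embedding $\nu_d:\mathbb{P}^m\to\mathbb{P}^N$. For a subscheme $A\subset\mathbb{P}^N$, $\langle A\rangle$ denotes its linear span, i.e. the smallest linear subspace containing $A$ scheme-theoretically. The $s$-th secant variety $\sigma_s(X_{m,d})$ is the Zariski closure in $\mathbb{P}^N$ of the union of all linear spans $\langle P_1,\dots,P_s\rangle$ with $P_1,\dots,P_s\in X_{m,d}$. The symmetric border rank $\mathrm{sbr}(P)$ of $P\in\mathbb{P}^N$ is the minimum integer $s$ such that $P\in\sigma_s(X_{m,d})$. The symmetric rank $\mathrm{sr}(P)$ is the minimum integer $r$ such that $P\in\langle P_1,\dots,P_r\rangle$ for some $P_1,\dots,P_r\in X_{m,d}$. A reduced $0$-dimensional subscheme (finite set) $\mathcal{S}\subset X_{m,d}$ realizes the symmetric rank of $P$ if $P\in\langle\mathcal{S}\rangle$ and $\deg(\mathcal{S})=\sharp(\mathcal{S})=\mathrm{sr}(P)$. The rational normal curves $C_d\subset X_{m,d}$ of degree $d$ are the curves $\nu_d(\ell)$ with $\ell\subset\mathbb{P}^m$ a line. Intersections, unions and degrees are scheme-theoretic. *)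

(* Defs.v *)
From HB Require Import structures.
From mathcomp Require Import all_boot all_order all_algebra.
From mathcomp.multinomials Require Import mpoly.

Set Implicit Arguments.
Unset Strict Implicit.
Unset Printing Implicit Defensive.

Import GRing.Theory.

Local Open Scope ring_scope.

(* A point of P^n is given by a nonzero vector of homogeneous coordinates in
   'rV[K]_n.+1; every notion below is invariant under rescaling it. *)

(* Closed subschemes of P^n correspond bijectively to the saturated homogeneous
   ideals of K[x_0..x_n]; a subscheme is represented by that ideal.  The empty
   subscheme is the unit ideal. *)
Record subscheme (K : fieldType) (n : nat) := Subscheme {
  ideal_of :> {mpoly K[n.+1]} -> Prop;
  ideal_zero : ideal_of 0;
  ideal_add : forall p q, ideal_of p -> ideal_of q -> ideal_of (p + q);
  ideal_mul : forall f p, ideal_of p -> ideal_of (f * p);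
  ideal_homog : forall e p, ideal_of p -> ideal_of (pihomog mdeg e p);
  ideal_sat : forall p, (forall i, ideal_of ('X_i * p)) -> ideal_of p
}.

Section Homogeneous.
Variables (K : fieldType) (n : nat).
Implicit Types p q : {mpoly K[n.+1]}.

Lemma mpoly_sum_homog p k : (msize p <= k)%N ->
  p = \sum_(j < k) pihomog mdeg j p.
Proof. by move=> hk; apply: pihomog_partitionE; rewrite -?msizeE. Qed.

Lemma pihomogM i e q p : q \is i.-homog ->
  pihomog mdeg e (q * p) =
  if (i <= e)%N then q * pihomog mdeg (e - i) p else 0.
Proof.
move=> hq; set k := maxn (msize p) e.+1.
have hpk : (msize p <= k)%N by exact: leq_maxl.
rewrite {1}(mpoly_sum_homog hpk) mulr_sumr linear_sum /=.
have E (j : 'I_k) : pihomog mdeg e (q * pihomog mdeg j p) =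
    if (i + j == e)%N then q * pihomog mdeg j p else 0.
  have hh := dhomogM hq (pihomogP mdeg j p).
  by case: eqP => [<-|/eqP ne]; [rewrite pihomog_dE | exact: pihomog_ne0 ne hh].
under eq_bigr => j _ do rewrite E.
case: leqP => hie; last first.
  rewrite big1 // => j _; case: eqP => // hj.
  by move: hie; rewrite -hj ltnNge leq_addr.
have hlt : (e - i < k)%N.
  by apply: leq_ltn_trans (leq_subr _ _) _; exact: leq_maxr.
rewrite (bigD1 (Ordinal hlt)) //= subnKC // eqxx big1 ?addr0 // => j hj.
case: eqP => // hj'; case/eqP: hj; apply: val_inj => /=.
by rewrite -hj' addKn.
Qed.

Lemma pihomog_mull i e q p : q \is i.-homog ->
  pihomog mdeg (i + e) (q * p) = q * pihomog mdeg e p.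
Proof. by move=> hq; rewrite (pihomogM _ _ hq) leq_addr addKn. Qed.

Lemma homog_mpolyX (mu : 'X_{1..n.+1}) :
  ('X_[mu] : {mpoly K[n.+1]}) \is (mdeg mu).-homog.
Proof. by rewrite dhomogX. Qed.

Lemma homog_mpolyU (i : 'I_n.+1) : ('X_i : {mpoly K[n.+1]}) \is 1.-homog.
Proof. by rewrite dhomogX /= mdeg1. Qed.

Lemma fin_bound (Q : 'I_n.+1 -> nat -> Prop) :
  (forall i, exists k, Q i k) ->
  (forall i k l, (k <= l)%N -> Q i k -> Q i l) ->
  exists k, forall i, Q i k.
Proof.
move=> exQ mono.
have H (s : seq 'I_n.+1) : exists k, forall i, i \in s -> Q i k.
  elim: s => [|a s [k hk]]; first by exists 0%N.
  have [l hl] := exQ a; exists (maxn k l) => i.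
  rewrite inE => /orP[/eqP->|hi]; first exact: mono (leq_maxr _ _) hl.
  exact: mono (leq_maxl _ _) (hk _ hi).
by have [k hk] := H (enum 'I_n.+1); exists k => i; apply: hk; rewrite mem_enum.
Qed.

End Homogeneous.

Section Operations.
Variables (K : fieldType) (n : nat).
Implicit Types (A B C : subscheme K n) (T : 'rV[K]_n.+1 -> Prop).
Implicit Types (p q f : {mpoly K[n.+1]}).

Definition subscheme_le A B := forall p, B p -> A p.

Definition subscheme_eq A B := forall p, A p <-> B p.

Definition is_empty A := A 1.

Definition reduced A := forall p k, A (p ^+ k) -> A p.

Definition point_on A (x : 'rV[K]_n.+1) := forall p, A p -> p.@[x 0] = 0.

Definition union_ideal A B p := A p /\ B p.

Fact union_zero A B : union_ideal A B 0.
Proof. by split; exact: ideal_zero. Qed.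

Fact union_add A B p q :
  union_ideal A B p -> union_ideal A B q -> union_ideal A B (p + q).
Proof. by move=> [? ?] [? ?]; split; exact: ideal_add. Qed.

Fact union_mul A B f p : union_ideal A B p -> union_ideal A B (f * p).
Proof. by move=> [? ?]; split; exact: ideal_mul. Qed.

Fact union_homog A B e p :
  union_ideal A B p -> union_ideal A B (pihomog mdeg e p).
Proof. by move=> [? ?]; split; exact: ideal_homog. Qed.

Fact union_sat A B p :
  (forall i, union_ideal A B ('X_i * p)) -> union_ideal A B p.
Proof. by move=> h; split; apply: ideal_sat => i; case: (h i). Qed.

Definition union A B : subscheme K n :=
  Subscheme (union_zero A B) (@union_add A B) (@union_mul A B)
    (@union_homog A B) (@union_sat A B).

(* The saturation of the sum of the two ideals. *)
Definition inter_ideal A B p := exists k, forall mu : 'X_{1..n.+1},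
  (k <= mdeg mu)%N -> exists a b, [/\ A a, B b & 'X_[mu] * p = a + b].

Fact inter_zero A B : inter_ideal A B 0.
Proof.
exists 0%N => mu _; exists 0, 0; split; try exact: ideal_zero.
by rewrite mulr0 addr0.
Qed.

Fact inter_add A B p q :
  inter_ideal A B p -> inter_ideal A B q -> inter_ideal A B (p + q).
Proof.
move=> [k hk] [l hl]; exists (maxn k l) => mu; rewrite geq_max => /andP[h1 h2].
have [a [b [ha hb e1]]] := hk _ h1; have [a' [b' [ha' hb' e2]]] := hl _ h2.
exists (a + a'), (b + b'); split; try exact: ideal_add.
by rewrite mulrDr e1 e2 addrACA.
Qed.

Fact inter_mul A B f p : inter_ideal A B p -> inter_ideal A B (f * p).
Proof.
move=> [k hk]; exists k => mu h; have [a [b [ha hb e]]] := hk _ h.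
exists (f * a), (f * b); split; try exact: ideal_mul.
by rewrite mulrCA e mulrDr.
Qed.

Fact inter_homog A B e p :
  inter_ideal A B p -> inter_ideal A B (pihomog mdeg e p).
Proof.
move=> [k hk]; exists k => mu h; have [a [b [ha hb E]]] := hk _ h.
exists (pihomog mdeg (mdeg mu + e) a), (pihomog mdeg (mdeg mu + e) b).
split; try exact: ideal_homog.
by rewrite -(pihomog_mull _ _ (homog_mpolyX K mu)) E linearD.
Qed.

Fact inter_sat A B p :
  (forall i, inter_ideal A B ('X_i * p)) -> inter_ideal A B p.
Proof.
move=> h.
have [|i k l kl hi mu hl|k hk] := @fin_bound n (fun i k =>
    forall mu : 'X_{1..n.+1}, (k <= mdeg mu)%N ->
    exists a b, [/\ A a, B b & 'X_[mu] * ('X_i * p) = a + b]).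
- by move=> i; case: (h i) => k hk; exists k.
- exact/hi/(leq_trans kl).
exists k.+1 => mu hmu.
have [i hi] : exists i, mu i != 0%N.
  apply/existsP; apply: contraLR hmu; rewrite negb_exists => /forallP h0.
  have -> : mdeg mu = 0%N by
    rewrite mdegE big1 // => i _; apply/eqP; have := h0 i; rewrite negbK.
  by [].
have lemu : (U_(i) <= mu)%MM by rewrite lep1mP.
have := hk i (mu - U_(i))%MM.
rewrite mulrA -mpolyXD submK //; apply.
move: hmu; rewrite -{1}(submK lemu) mdegD mdeg1 addn1 ltnS.
by [].
Qed.

Definition inter A B : subscheme K n :=
  Subscheme (inter_zero A B) (@inter_add A B) (@inter_mul A B)
    (@inter_homog A B) (@inter_sat A B).

(* The scheme-theoretic closure of the open subscheme A \ B of A: a form lies in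
   its ideal iff it vanishes on A /\ D(q) for every form q of the ideal of B,
   i.e. the ideal is (I_A : I_B^oo).  When A is finite, A \ B is also closed, so
   this is A \ B itself. *)
Definition diff_ideal A B p :=
  forall e q, q \is e.-homog -> B q -> exists k, A (q ^+ k * p).

Lemma diff_mono A q p k l : (k <= l)%N -> A (q ^+ k * p) -> A (q ^+ l * p).
Proof.
by move=> kl h; rewrite -(subnK kl) exprD -mulrA; exact: ideal_mul.
Qed.

Fact diff_zero A B : diff_ideal A B 0.
Proof. by move=> e q _ _; exists 0%N; rewrite mulr0; exact: ideal_zero. Qed.

Fact diff_add A B p q :
  diff_ideal A B p -> diff_ideal A B q -> diff_ideal A B (p + q).
Proof.
move=> hp hq e g hg Bg; have [k hk] := hp e g hg Bg; have [l hl] := hq e g hg Bg.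
exists (maxn k l); rewrite mulrDr; apply: ideal_add.
  exact: diff_mono (leq_maxl _ _) hk.
exact: diff_mono (leq_maxr _ _) hl.
Qed.

Fact diff_mul A B f p : diff_ideal A B p -> diff_ideal A B (f * p).
Proof.
move=> hp e g hg Bg; have [k hk] := hp e g hg Bg; exists k.
by rewrite mulrCA; exact: ideal_mul.
Qed.

Fact diff_homog A B e p :
  diff_ideal A B p -> diff_ideal A B (pihomog mdeg e p).
Proof.
move=> hp i g hg Bg; have [k hk] := hp i g hg Bg; exists k.
by rewrite -(pihomog_mull _ _ (dhomogMn k hg)); exact: ideal_homog.
Qed.

Fact diff_sat A B p :
  (forall i, diff_ideal A B ('X_i * p)) -> diff_ideal A B p.
Proof.
move=> h e g hg Bg.
have [|i k l|k hk] := @fin_bound n (fun i k => A (g ^+ k * ('X_i * p))).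
- by move=> i; exact: h i e g hg Bg.
- exact: diff_mono.
by exists k; apply: ideal_sat => i; rewrite mulrCA.
Qed.

Definition diff A B : subscheme K n :=
  Subscheme (@diff_zero A B) (@diff_add A B) (@diff_mul A B)
    (@diff_homog A B) (@diff_sat A B).

(* The Zariski closure, with its reduced structure, of the set of points having
   a representative in T. *)
Definition zclosure_ideal T p :=
  forall e x, x != 0 -> T x -> (pihomog mdeg e p).@[x 0] = 0.

Fact zclosure_zero T : zclosure_ideal T 0.
Proof. by move=> e x _ _; rewrite linear0 meval0. Qed.

Fact zclosure_add T p q :
  zclosure_ideal T p -> zclosure_ideal T q -> zclosure_ideal T (p + q).
Proof.
by move=> hp hq e x x0 Tx; rewrite linearD mevalD hp // hq // addr0.
Qed.

Fact zclosure_mul T f p : zclosure_ideal T p -> zclosure_ideal T (f * p).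
Proof.
move=> hp e x x0 Tx; rewrite (mpoly_sum_homog (leqnn (msize f))).
rewrite mulr_suml (linear_sum (pihomog mdeg e)).
rewrite (big_morph (meval (x 0)) (mevalD (x 0)) (meval0 (x 0))).
rewrite big1 // => j _.
rewrite -[LHS]/((pihomog mdeg e (pihomog mdeg j f * p)).@[x 0]).
rewrite (pihomogM _ _ (pihomogP _ _ _)); case: ifP => _; last by rewrite meval0.
by rewrite mevalM hp // mulr0.
Qed.

Fact zclosure_homog T e p :
  zclosure_ideal T p -> zclosure_ideal T (pihomog mdeg e p).
Proof.
move=> hp i x x0 Tx; case: (eqVneq e i) => [<-|ne].
  by rewrite pihomog_id hp.
by rewrite (pihomog_ne0 ne (pihomogP _ _ _)) meval0.
Qed.

Fact zclosure_sat T p :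
  (forall i, zclosure_ideal T ('X_i * p)) -> zclosure_ideal T p.
Proof.
move=> h e x x0 Tx; have [i xi] : exists i, x 0 i != 0 by exact/rV0Pn.
have := h i (1 + e)%N x x0 Tx; rewrite (pihomog_mull _ _ (homog_mpolyU K i)).
by rewrite mevalM mevalXU => /eqP; rewrite mulf_eq0 (negPf xi) => /eqP.
Qed.

Definition zariski_closure T : subscheme K n :=
  Subscheme (@zclosure_zero T) (@zclosure_add T) (@zclosure_mul T)
    (@zclosure_homog T) (@zclosure_sat T).

Definition linear_subspace (L : {vspace 'rV[K]_n.+1}) : subscheme K n :=
  zariski_closure (fun x => x \in L).

(* P lies in the smallest linear subspace containing A. *)
Definition in_span A (P : 'rV[K]_n.+1) :=
  forall L : {vspace 'rV[K]_n.+1},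
    subscheme_le A (linear_subspace L) -> P \in L.

(* e is the value at t of the Hilbert function of A, that is the codimension of
   the degree t part of the ideal in the space of all forms of degree t. *)
Definition hilbert_value A t e :=
  exists U : {vspace dhomog n.+1 K t},
    (forall f : dhomog n.+1 K t, f \in U <-> A f) /\
    (\dim U + e)%N = \dim {:dhomog n.+1 K t}.

(* A is finite (possibly empty) of degree e: its Hilbert polynomial is the
   constant e. *)
Definition degree A e := exists t0, forall t, (t0 <= t)%N -> hilbert_value A t e.

Definition zero_dimensional A := exists2 e, (0 < e)%N & degree A e.

Definition degree_le A k := exists2 e, degree A e & (e <= k)%N.

Definition degree_ge A k := exists2 e, degree A e & (k <= e)%N.

(* A has exactly k (closed) points. *)
Definition card_points A k := exists X : 'I_k -> 'rV[K]_n.+1,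
  [/\ forall i, X i != 0,
      forall i j c, X j = c *: X i -> i = j
    & forall x, x != 0 -> point_on A x <-> exists i c, x = c *: X i].

Definition is_disjoint_union A B C :=
  subscheme_eq A (union B C) /\ is_empty (inter B C).

End Operations.

Section Veronese.
Variables (K : fieldType) (m d : nat).

Definition veronese_dim := 'C(m + d, d).-1.

Local Notation N := veronese_dim.

Fact size_veronese_mnm :
  size [seq s2m (val t) | t <- enum (basis m.+1 d)] = N.+1.
Proof.
by rewrite size_basis addnC /veronese_dim prednK // bin_gt0 leq_addl.
Qed.

Definition veronese_mnm (i : 'I_N.+1) : 'X_{1..m.+1} :=
  nth 0%MM [seq s2m (val t) | t <- enum (basis m.+1 d)] i.

Definition veronese (x : 'rV[K]_m.+1) : 'rV[K]_N.+1 :=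
  \row_i ('X_[veronese_mnm i] : {mpoly K[m.+1]}).@[x 0].

Definition veronese_image (T : 'rV[K]_m.+1 -> Prop) : subscheme K N :=
  zariski_closure (fun y => exists x, [/\ x != 0, T x & y = veronese x]).

Definition veronese_variety : subscheme K N := veronese_image (fun _ => True).

(* The images of the lines of P^m. *)
Definition rational_normal_curve (C : subscheme K N) :=
  exists2 L : {vspace 'rV[K]_m.+1},
    \dim L = 2 & subscheme_eq C (veronese_image (fun x => x \in L)).

(* P lies in the span of s (not necessarily distinct) points of the Veronese
   variety. *)
Definition in_span_of_points (s : nat) (P : 'rV[K]_N.+1) :=
  exists2 x : s.-tuple 'rV[K]_m.+1,
    all (fun y => y != 0) x & P \in <<[seq veronese y | y <- x]>>%VS.

Definition secant_variety (s : nat) : subscheme K N :=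
  zariski_closure (in_span_of_points s).

Definition is_min (Q : nat -> Prop) s := Q s /\ forall t, Q t -> (s <= t)%N.

(* [symmetric_border_rank P s] means sbr(P) = s, and [symmetric_rank P r] means
   sr(P) = r. *)
Definition symmetric_border_rank (P : 'rV[K]_N.+1) :=
  is_min (fun s => point_on (secant_variety s) P).

Definition symmetric_rank (P : 'rV[K]_N.+1) :=
  is_min (fun r => in_span_of_points r P).

Definition realizes_symmetric_rank (P : 'rV[K]_N.+1) (S : subscheme K N) :=
  [/\ zero_dimensional S, reduced S, subscheme_le S veronese_variety,
      in_span S P
    & exists r, [/\ symmetric_rank P r, degree S r & card_points S r]].

Definition nonreduced_border_scheme (P : 'rV[K]_N.+1) (Z : subscheme K N) :=
  [/\ zero_dimensional Z, ~ reduced Z, subscheme_le Z veronese_variety,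
      in_span Z P
    & exists2 b, symmetric_border_rank P b & degree_le Z b].

End Veronese.

Arguments veronese_variety K m d : clear implicits.

(* Main.v *)
(* Let phi be the functional on forms of degree d given by the coordinates of P, so that P lies
   in the span of nu_d(A) iff phi kills the forms of degree d in the ideal of A.  Let Z be a
   scheme of degree at most b and S a set of r points, both spanning P.  A minimal such Z is
   distinct from S, so that the union of Z and S, of degree at most 2d + 1, fails to impose
   independent conditions on forms of degree d; by Castelnuovo's argument (cut by a hyperplane
   of largest trace) a line L then carries a subscheme of degree at least d + 2 of that union.
   For a hyperplane h containing L, the residuals Z : h and S : h are both minimal for
   phi(h .) and their union imposes independent conditions in degree d - 1, hence they agree.
   So Z and S coincide off L, and Z splits as (Z on L) + (S off L).

   A scheme on a line is defined on it by one polynomial; perturbing its roots (smoothing)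
   exhibits P as a limit of points spanned by deg Z points, so deg Z = b, which makes every
   admissible Z minimal.  Apolarity for binary forms bounds r from above, giving
   deg (Z on L) + #(S on L) = d + 2.  Counting then shows that the line is the same for all Z,
   that Z is unique, and, Z not being reduced, that the line does not depend on S either. *)

Require Import Defs.
From HB Require Import structures.
From mathcomp Require Import all_boot all_order all_algebra.
From mathcomp Require Import separable zify ring.
From mathcomp.multinomials Require Import mpoly.
From Stdlib Require Import ClassicalEpsilon FunctionalExtensionality
  PropExtensionality ProofIrrelevance.

Set Implicit Arguments.
Unset Strict Implicit.
Unset Printing Implicit Defensive.

Import GRing.Theory.

Local Open Scope ring_scope.

(** The argument takes place in P^m; only the last sections pass through the Veronese embedding.
    Cohomology is replaced by dimension counts in single degrees. Ideals are bare predicates, with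
    no generators at hand, so a scheme counts as finite when its Hilbert function is bounded, and
    that bound is the measure for the descents.

    The numbers that shape the uniqueness: let z and s be the degrees of Z and S on the line and o
    the number of common points off it, so b = z + o and r = s + o. The rank bound r <= d + 2 - z +
    o gives z + s <= d + 2, while the choice of the line gives z + s >= d + 2 + deg (Z1 meet S1);
    hence equality and disjointness at once. With b < r this yields 2z <= d + 1, so two candidates
    for Z on one line still have a union of degree at most d + 1 there, which imposes independent
    conditions. With b + r <= 2d + 1 it yields 2o <= d - 1, so there are too few points of S off the
    line to fill a second one. *)

Lemma subscheme_ext (K : fieldType) (n : nat) (A B : subscheme K n) :
  subscheme_eq A B -> A = B.
Proof.
case: A B => [a a1 a2 a3 a4 a5] [b b1 b2 b3 b4 b5] /= h.
have e : a = b by apply: functional_extensionality => p;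
  apply: propositional_extensionality; exact: h.
by subst b; congr Subscheme; exact: proof_irrelevance.
Qed.

(** * Predicates as subspaces, and one dimension formula *)

Section LinearPredicates.
Variables (K : fieldType) (vT : vectType K).

Definition linear_pred (Q : vT -> Prop) :=
  Q 0 /\ forall a u v, Q u -> Q v -> Q (a *: u + v).

(** Grow a subspace inside [Q] by vectors of [Q] outside it until none is left; the codimension
    bounds the number of enlargements. The graded pieces of an ideal become vector spaces in this
    way. *)
Lemma linear_pred_vspace (Q : vT -> Prop) : linear_pred Q ->
  exists U : {vspace vT}, forall v, v \in U <-> Q v.
Proof.
move=> [Q0 QL].
have H k (U : {vspace vT}) : (forall v, v \in U -> Q v) ->
    (\dim {:vT} - \dim U <= k)%N ->
    exists U : {vspace vT}, forall v, v \in U <-> Q v.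
  elim: k U => [|k IH] U UQ hk.
    have UT : U = fullv.
      by apply/eqP; rewrite eqEdim subvf /= -subn_eq0 -leqn0.
    by exists U => v; split=> [|_]; [exact: UQ | rewrite UT memvf].
  have [[v Qv vU]|h] := excluded_middle_informative (exists2 v, Q v & v \notin U).
    apply: (IH (<[v]> + U)%VS).
      move=> w /memv_addP[x /vlineP[c ->] [u uU ->]]; apply: QL => //.
      exact: UQ.
    have lt : (\dim U < \dim (<[v]> + U))%N.
      rewrite (ltn_leqif (dimv_leqif_sup (addvSr _ _))) subv_add subvv andbT.
      by rewrite -memvE.
    by rewrite -ltnS (leq_trans _ hk) // ltn_sub2l // (leq_trans lt) // dimvS ?subvf.
  exists U => v; split=> [|Qv]; first exact: UQ.
  by apply: contra_notT h => vU; exists v.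
apply: (H _ 0%VS _ (leqnn _)) => v; rewrite memv0 => /eqP ->; exact: Q0.
Qed.

(** The kernel of [f] lies in [f @^-1: U], hence in [W], so it cancels from the two rank formulas.
    This is the count behind the residual sequences below. *)
Lemma dim_sum_img (wT : vectType K) (f : 'Hom(vT, wT)) (U : {vspace wT})
  (W : {vspace vT}) : (f @^-1: U <= W)%VS ->
  (\dim (U + f @: W) + \dim (f @^-1: U) = \dim U + \dim W)%N.
Proof.
move=> sUW.
have E : (U :&: f @: W = f @: (f @^-1: U))%VS.
  apply/vspaceP => w; apply/memv_capP/memv_imgP.
    by move=> [wU /memv_imgP[v vW e]]; exists v; rewrite // -memv_preim -e.
  move=> [v]; rewrite -memv_preim => vU ->; split=> //.
  by apply/memv_img/(subvP sUW); rewrite -memv_preim.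
have kU : (f @^-1: U :&: lker f = lker f)%VS.
  by apply/capv_idPr; rewrite -lpreim0; apply: lpreimS; exact: sub0v.
have kW : (W :&: lker f = lker f)%VS.
  by apply/capv_idPr; apply: subv_trans sUW; rewrite -kU capvSl.
have := dimv_sum_cap U (f @: W); have := limg_ker_dim f W.
have := limg_ker_dim f (f @^-1: U); rewrite kU kW E; lia.
Qed.

End LinearPredicates.

(** * Hilbert functions *)

Section HomogeneousIdeals.
Variables (K : fieldType) (n : nat).
Local Notation R := {mpoly K[n.+1]}.
Implicit Types (J : R -> Prop) (A : subscheme K n).

Record homog_submod J : Prop := HomogSubmod {
  hs_zero : J 0;
  hs_add : forall p q, J p -> J q -> J (p + q);
  hs_scale : forall a p, J p -> J (a *: p);
  hs_homog : forall e p, J p -> J (pihomog mdeg e p) }.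

Record homog_ideal J : Prop := HomogIdeal {
  hi_submod :> homog_submod J;
  hi_mul : forall f p, J p -> J (f * p) }.

Lemma homog_idealP J : J 0 -> (forall p q, J p -> J q -> J (p + q)) ->
  (forall f p, J p -> J (f * p)) ->
  (forall e p, J p -> J (pihomog mdeg e p)) -> homog_ideal J.
Proof.
by move=> h0 hD hM hh; split=> //; split=> // a p; rewrite -mul_mpolyC; exact: hM.
Qed.

Lemma subscheme_ideal A : homog_ideal A.
Proof.
by apply: homog_idealP => *;
  [exact: ideal_zero | exact: ideal_add | exact: ideal_mul | exact: ideal_homog].
Qed.

Lemma subscheme_submod A : homog_submod A.
Proof. exact: subscheme_ideal. Qed.

End HomogeneousIdeals.

#[local] Arguments ideal_of : simpl never.
#[local] Hint Extern 0 (homog_ideal (ideal_of _)) => exact: subscheme_ideal : core.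
#[local] Hint Extern 0 (homog_submod (ideal_of _)) => exact: subscheme_submod : core.
#[local] Hint Extern 0 (homog_submod _) => (by apply: hi_submod) : core.

Section HilbertFunction.
Variables (K : fieldType) (n : nat).
Local Notation R := {mpoly K[n.+1]}.
Local Notation dh t := (dhomog n.+1 K t).
Implicit Types (I J W : R -> Prop) (A B : subscheme K n) (f g p q : R).

Lemma ideal_opp A p : A p -> A (- p).
Proof. by move=> Ap; rewrite -mulN1r; exact: ideal_mul. Qed.

Lemma ideal_sub A p q : A p -> A q -> A (p - q).
Proof. by move=> Ap Aq; apply: ideal_add => //; exact: ideal_opp. Qed.

Lemma ideal_mulr A p q : A p -> A (p * q).
Proof. by move=> Ap; rewrite mulrC; exact: ideal_mul. Qed.

Lemma ideal_scale A a p : A p -> A (a *: p).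
Proof. by move=> Ap; rewrite -mul_mpolyC; exact: ideal_mul. Qed.

Lemma hs_sum J (T : Type) (r : seq T) (Q : pred T) (F : T -> R) :
  homog_submod J -> (forall i, Q i -> J (F i)) -> J (\sum_(i <- r | Q i) F i).
Proof.
move=> hJ h; elim/big_ind: _ => //; first exact: hs_zero.
by move=> *; exact: hs_add.
Qed.

Lemma ideal_sum A (T : Type) (r : seq T) (Q : pred T) (F : T -> R) :
  (forall i, Q i -> A (F i)) -> A (\sum_(i <- r | Q i) F i).
Proof. exact: hs_sum. Qed.

Lemma homog_submod_comp J p : homog_submod J ->
  J p <-> forall e, J (pihomog mdeg e p).
Proof.
move=> hJ; split=> [Jp e|h]; first exact: hs_homog.
rewrite (mpoly_sum_homog (leqnn (msize p))); exact: hs_sum.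
Qed.

Lemma ideal_comp A p : A p <-> forall e, A (pihomog mdeg e p).
Proof. exact: homog_submod_comp. Qed.

Lemma homog_split (t : nat) p : p \is t.-homog ->
  forall e, pihomog mdeg e p = if (t == e)%N then p else 0.
Proof.
by move=> hp e; case: eqP => [<-|/eqP ne]; [exact: pihomog_dE | exact: pihomog_ne0 ne hp].
Qed.

Lemma submod_sub_homog J J' : homog_submod J -> homog_submod J' ->
  (forall t f, f \is t.-homog -> J f -> J' f) -> forall f, J f -> J' f.
Proof.
move=> hJ hJ' h f Jf; apply/homog_submod_comp => // e.
by apply: (h e); [exact: pihomogP | exact: hs_homog].
Qed.

Lemma le_homog A B : (forall t f, f \is t.-homog -> A f -> B f) ->
  forall f, A f -> B f.
Proof. exact: submod_sub_homog. Qed.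

Lemma X_split (mu : 'X_{1..n.+1}) k : mdeg mu = k.+1 ->
  exists i nu, mdeg nu = k /\ mu = (U_(i) + nu)%MM.
Proof.
move=> hmu; have [i hi] : exists i, mu i != 0%N.
  case: (pickP (fun i => mu i != 0%N)) => [i hi|h0]; first by exists i.
  move: hmu; rewrite mdegE big1 // => i _; apply/eqP.
  by have := h0 i; case: eqP.
have lemu : (U_(i) <= mu)%MM by rewrite lep1mP.
exists i, (mu - U_(i))%MM; split; last by rewrite addmC submK.
by apply/eqP; rewrite -eqSS -hmu -[in mdeg mu](submK lemu) mdegD mdeg1 addn1.
Qed.

Lemma sat_mono A k p :
  (forall mu : 'X_{1..n.+1}, mdeg mu = k -> A ('X_[mu] * p)) -> A p.
Proof.
elim: k p => [|k IH] p h.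
  by have := h 0%MM mdeg0; rewrite mpolyX0 mul1r.
apply: ideal_sat => i; apply: IH => mu hmu.
rewrite mulrA -mpolyXD; apply: h; by rewrite mdegD mdeg1 hmu addn1.
Qed.

Lemma sat_homog A k p : (forall g, g \is k.-homog -> A (g * p)) -> A p.
Proof.
by move=> h; apply: (@sat_mono A k) => mu hmu; apply: h; rewrite dhomogX; exact/eqP.
Qed.

Lemma homog_ind_gen J k g p : homog_ideal J -> g \is k.-homog ->
  (forall mu : 'X_{1..n.+1}, mdeg mu = k -> J ('X_[mu] * p)) -> J (g * p).
Proof.
move=> hJ /dhomog_mf hs h; rewrite (mpolyE g)
  mulr_suml big_seq; apply: hs_sum => // mu mu_supp.
have hmu := hs _ mu_supp; rewrite -scalerAl; apply: hs_scale => //; exact: h.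
Qed.

Definition deg_part J t : {vspace dh t} :=
  epsilon (inhabits 0%VS) (fun U : {vspace dh t} => forall f : dh t, f \in U <-> J f).

Lemma deg_partP J t : homog_submod J -> forall f : dh t, f \in deg_part J t <-> J f.
Proof.
move=> hJ; rewrite /deg_part.
set Q := fun U : {vspace dh t} => _.
suff : exists U, Q U by exact: (epsilon_spec (inhabits 0%VS) Q).
apply: (linear_pred_vspace (Q := fun f : dh t => J f)).
split=> [|a u v Ju Jv]; first by rewrite linear0; exact: hs_zero.
by rewrite linearD linearZ; apply: hs_add => //; exact: hs_scale.
Qed.

(* The Hilbert function of the quotient by J. *)
Definition hf J t : nat := (\dim {:dh t} - \dim (deg_part J t))%N.

Lemma hf_dim J t : (hf J t + \dim (deg_part J t) = \dim {:dh t})%N.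
Proof. by rewrite /hf subnK // dimvS // subvf. Qed.

Lemma hilbert_valueP A t e : hilbert_value A t e <-> hf A t = e.
Proof.
split=> [[U [hU hd]]|<-].
  rewrite /hf -hd; suff -> : deg_part A t = U by rewrite addKn.
  apply/vspaceP => f; apply/idP/idP => h; first exact/hU/deg_partP.
  by apply/deg_partP => //; exact/hU.
exists (deg_part A t); split; first exact: deg_partP.
by rewrite addnC hf_dim.
Qed.

Definition le_in_degree t J J' := forall f, f \is t.-homog -> J f -> J' f.

Lemma deg_part_sub J J' t : homog_submod J -> homog_submod J' ->
  le_in_degree t J J' <-> (deg_part J t <= deg_part J' t)%VS.
Proof.
move=> hJ hJ'; split=> [h|/subvP h f hf Jf].
  apply/subvP => f /(deg_partP hJ) Jf; apply/deg_partP => //.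
  by apply: h => //; exact: valP.
have /deg_partP : DHomog hf \in deg_part J' t by apply/h/deg_partP.
exact.
Qed.

Lemma hf_le J J' t : homog_submod J -> homog_submod J' ->
  le_in_degree t J J' -> (hf J' t <= hf J t)%N.
Proof. by move=> hJ hJ' h; rewrite leq_sub2l // dimvS // -deg_part_sub. Qed.

Lemma hf_eq J J' t : homog_submod J -> homog_submod J' ->
  le_in_degree t J J' -> le_in_degree t J' J -> hf J' t = hf J t.
Proof. by move=> hJ hJ' h h'; apply/eqP; rewrite eqn_leq !hf_le. Qed.

(** Turns numbers into statements about forms: each time a form must be written as a sum of elements
    of two ideals, the equality of Hilbert functions is proved and this lemma produces the
    decomposition. *)
Lemma hf_le_eq J J' t : homog_submod J -> homog_submod J' ->
  le_in_degree t J J' -> (hf J t <= hf J' t)%N -> le_in_degree t J' J.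
Proof.
move=> hJ hJ' /deg_part_sub hs hle; apply/deg_part_sub => //.
rewrite -(geq_leqif (dimv_leqif_sup (hs _ _))) //.
have := hf_dim J t; have := hf_dim J' t; lia.
Qed.

Lemma hf0P J t : homog_submod J ->
  hf J t = 0%N <-> (forall f, f \is t.-homog -> J f).
Proof.
move=> hJ; split=> h.
  have T : homog_submod (fun _ : R => True) by split.
  move=> f hf_; apply: (@hf_le_eq J (fun _ => True) t) => //.
  by rewrite h.
apply/eqP; rewrite subn_eq0 dimvS //; apply/subvP => f _.
by apply/deg_partP => //; apply: h; exact: valP.
Qed.

Definition add_pred I J p := exists a b, [/\ I a, J b & p = a + b].
Definition cap_pred I J p := I p /\ J p.

Lemma add_submod I J : homog_submod I -> homog_submod J -> homog_submod (add_pred I J).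
Proof.
move=> hI hJ; split.
- by exists 0, 0; split; rewrite ?addr0 //; exact: hs_zero.
- move=> _ _ [a [b [Ia Jb ->]]] [c [d [Ic Jd ->]]].
  by exists (a + c), (b + d); rewrite addrACA; split=> //; exact: hs_add.
- move=> k _ [a [b [Ia Jb ->]]]; exists (k *: a), (k *: b).
  by rewrite scalerDr; split=> //; exact: hs_scale.
- move=> e _ [a [b [Ia Jb ->]]]; exists (pihomog mdeg e a), (pihomog mdeg e b).
  by rewrite linearD; split=> //; exact: hs_homog.
Qed.

Lemma cap_submod I J : homog_submod I -> homog_submod J -> homog_submod (cap_pred I J).
Proof.
move=> hI hJ; split.
- by split; exact: hs_zero.
- by move=> p q [? ?] [? ?]; split; exact: hs_add.
- by move=> a p [? ?]; split; exact: hs_scale.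
- by move=> e p [? ?]; split; exact: hs_homog.
Qed.

Lemma add_ideal I J : homog_ideal I -> homog_ideal J -> homog_ideal (add_pred I J).
Proof.
move=> hI hJ; split; first exact: add_submod.
move=> f _ [a [b [Ia Jb ->]]]; exists (f * a), (f * b).
by rewrite mulrDr; split=> //; exact: hi_mul.
Qed.

(** The count of the Mayer-Vietoris sequence R/(I meet J) -> R/I + R/J -> R/(I + J). *)
Lemma hf_add_cap I J t : homog_submod I -> homog_submod J ->
  (hf (add_pred I J) t + hf (cap_pred I J) t = hf I t + hf J t)%N.
Proof.
move=> hI hJ.
have hA := add_submod hI hJ; have hC := cap_submod hI hJ.
have EA : deg_part (add_pred I J) t = (deg_part I t + deg_part J t)%VS.
  apply/vspaceP => f; apply/idP/memv_addP.
    move/(deg_partP hA) => [a [b [Ia Jb e]]].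
    have ha := pihomogP mdeg t a; have hb := pihomogP mdeg t b.
    exists (DHomog ha); first by apply/deg_partP => //; exact: hs_homog.
    exists (DHomog hb); first by apply/deg_partP => //; exact: hs_homog.
    apply: val_inj; rewrite -[LHS](pihomog_dE (valP f)) /=.
    by rewrite e pihomogD.
  move=> [a /(deg_partP hI) Ia [b /(deg_partP hJ) Jb ->]].
  by apply/deg_partP => //; exists a, b; split=> //; rewrite linearD.
have EC : deg_part (cap_pred I J) t = (deg_part I t :&: deg_part J t)%VS.
  apply/vspaceP => f; apply/idP/memv_capP.
    by move/(deg_partP hC) => [Ia Ib]; split; apply/deg_partP.
  by move=> [/(deg_partP hI) ? /(deg_partP hJ) ?]; apply/deg_partP.
have := dimv_sum_cap (deg_part I t) (deg_part J t); rewrite -EA -EC.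
have := hf_dim (add_pred I J) t; have := hf_dim (cap_pred I J) t.
have := hf_dim I t; have := hf_dim J t; lia.
Qed.

Definition mul_pred f W p := exists2 b, W b & p = f * b.
Definition colon_pred I f p := I (f * p).

Lemma mul_submod k f W : f \is k.-homog -> homog_submod W ->
  homog_submod (mul_pred f W).
Proof.
move=> hf_ hW; split.
- by exists 0; rewrite ?mulr0 //; exact: hs_zero.
- by move=> _ _ [a Wa ->] [b Wb ->]; exists (a + b); rewrite ?mulrDr //; exact: hs_add.
- by move=> c _ [a Wa ->]; exists (c *: a); rewrite ?scalerAr //; exact: hs_scale.
- move=> e _ [a Wa ->]; rewrite (pihomogM _ _ hf_); case: ifP => _.
    by exists (pihomog mdeg (e - k) a) => //; exact: hs_homog.
  by exists 0; rewrite ?mulr0 //; exact: hs_zero.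
Qed.

Lemma mul_ideal k f W : f \is k.-homog -> homog_ideal W -> homog_ideal (mul_pred f W).
Proof.
move=> hf_ hW; split; first exact: (mul_submod hf_).
by move=> g _ [a Wa ->]; exists (g * a); rewrite 1?mulrCA //; exact: hi_mul.
Qed.

Lemma colon_ideal k f I : f \is k.-homog -> homog_ideal I -> homog_ideal (colon_pred I f).
Proof.
move=> hf_ hI; apply: homog_idealP; rewrite /colon_pred.
- by rewrite mulr0; exact: hs_zero.
- by move=> p q; rewrite mulrDr; exact: hs_add.
- by move=> g p Ip; rewrite mulrCA; exact: hi_mul.
- by move=> e p Ip; rewrite -(pihomog_mull _ _ hf_); exact: hs_homog.
Qed.

(** With [W] the whole ring this is the residual sequence of the hypersurface [f]. A general [W]
    containing I : f allows the residual to be replaced by a smaller scheme, as [minimal_colon]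
    requires. *)
Lemma hf_add_mul k t f I W : f \is k.-homog -> homog_ideal I -> homog_submod W ->
  le_in_degree t (colon_pred I f) W ->
  (hf (add_pred I (mul_pred f W)) (k + t) + hf (colon_pred I f) t
   = hf I (k + t) + hf W t)%N.
Proof.
move=> hf_ hI hW sIW.
have hM := mul_submod hf_ hW; have hA := add_submod hI hM.
have hC := colon_ideal hf_ hI.
pose mu0 (g : dh t) : dh (k + t)%N := DHomog (dhomogM hf_ (valP g)).
have mu_lin : linear mu0.
  move=> a u v; apply: val_inj; by rewrite /= mulrDr scalerAr.
pose mu1 := GRing.isLinear.Build _ _ _ _ mu0 mu_lin.
pose mu2 : {linear dh t -> dh (k + t)%N} := HB.pack mu0 mu1.
pose mu := linfun mu2.
have muE (g : dh t) : (mu g : R) = f * g by rewrite lfunE.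
have EP : deg_part (colon_pred I f) t = (mu @^-1: deg_part I (k + t)%N)%VS.
  apply/vspaceP => g; rewrite -memv_preim.
  apply/idP/idP; first by move/(deg_partP hC) => h; apply/deg_partP; rewrite ?muE.
  by move/(deg_partP hI); rewrite muE => h; apply/deg_partP.
have sub : (mu @^-1: deg_part I (k + t)%N <= deg_part W t)%VS.
  by rewrite -EP; apply/deg_part_sub.
have EA : deg_part (add_pred I (mul_pred f W)) (k + t)%N
    = (deg_part I (k + t)%N + mu @: deg_part W t)%VS.
  apply/vspaceP => g; apply/idP/memv_addP.
    move/(deg_partP hA) => [a [_ [Ia [b Wb ->] e]]].
    have ha := pihomogP mdeg (k + t)%N a; have hb := pihomogP mdeg t b.
    exists (DHomog ha); first by apply/deg_partP => //; exact: hs_homog.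
    exists (mu (DHomog hb)).
      by apply/memv_img/deg_partP => //; exact: hs_homog.
    apply: val_inj; rewrite -[LHS](pihomog_dE (valP g)) /= muE /=.
    by rewrite e pihomogD (pihomog_mull _ _ hf_).
  move=> [a /(deg_partP hI) Ia [_ /memv_imgP[b /(deg_partP hW) Wb ->] ->]].
  apply/deg_partP => //; exists a, (mu b : R); rewrite linearD; split=> //.
  by exists b; rewrite ?muE.
have := dim_sum_img sub; rewrite -EA -EP.
have := hf_dim (add_pred I (mul_pred f W)) (k + t)%N; have := hf_dim I (k + t)%N.
have := hf_dim (colon_pred I f) t; have := hf_dim W t;
  rewrite /reverse_coercion; lia.
Qed.

Lemma whole_submod : homog_ideal (fun _ : R => True).
Proof. by apply: homog_idealP. Qed.

Lemma hf_whole t : hf (fun _ : R => True) t = 0%N.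
Proof. by apply/(hf0P t (hi_submod whole_submod)). Qed.

End HilbertFunction.

(** * Polynomials as functions over an algebraically closed field *)

Lemma poly_nonroot (K : closedFieldType) (p : {poly K}) :
  p != 0 -> exists c, p.[c] != 0.
Proof.
(* A root c of p X + 1 satisfies c p(c) = -1. *)
move=> p0; have [|c] := closed_rootP (p * 'X + 1) _.
  by rewrite size_polyDl ?size_mulX ?size_poly1 ?eqSS ?size_poly_eq0 // ltnS size_poly_gt0.
rewrite rootE !hornerE => /eqP h; exists c; apply: contra_eq_neq h => ->.
by rewrite mul0r add0r oner_neq0.
Qed.

Lemma poly_fun0 (K : closedFieldType) (p : {poly K}) :
  (forall c, p.[c] = 0) -> p = 0.
Proof.
by move=> h; apply/eqP; apply: contraT => /poly_nonroot[c]; rewrite h eqxx.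
Qed.

(** One variable at a time: [H k] says that the terms of f whose first k exponents are those of [nu]
    sum to zero as a function of the remaining variables. At k = n a single coefficient is left. *)
Lemma mpoly_fun0 (K : closedFieldType) (n : nat) (f : {mpoly K[n]}) :
  (forall v, f.@[v] = 0) -> f = 0.
Proof.
move=> h.
pose agree (k : nat) (nu mu : 'X_{1..n}) :=
  [forall i : 'I_n, (i < k)%N ==> (mu i == nu i)].
have H k : (k <= n)%N -> forall (v : 'I_n -> K) (nu : 'X_{1..n}),
    \sum_(mu <- msupp f | agree k nu mu)
      f@_mu * \prod_(i < n | (k <= i)%N) v i ^+ mu i = 0.
  elim: k => [_ v nu|k IH hk v nu].
    rewrite -[RHS](h v) mevalE; apply: eq_bigl => mu.
    by apply/forallP => i.
  pose c (mu : 'X_{1..n}) := f@_mu * \prod_(i < n | (k < i)%N) v i ^+ mu i.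
  pose j := Ordinal hk.
  pose g : {poly K} := \sum_(mu <- msupp f | agree k nu mu) c mu *: 'X^(mu j).
  have g0 : g = 0.
    apply: poly_fun0 => s; rewrite horner_sum.
    rewrite -[RHS](IH (ltnW hk) (fun i => if i == j then s else v i) nu).
    apply: eq_bigr => mu _; rewrite hornerZ hornerXn /c -mulrA; congr (_ * _).
    rewrite [RHS](bigD1 j) //= eqxx mulrC; congr (_ * _).
    apply: eq_big => [i|i hi]; first by rewrite ltn_neqAle eq_sym andbC.
    by rewrite -(inj_eq val_inj) /= gtn_eqF.
  have e0 : g`_(nu j) = 0 by rewrite g0 coef0.
  rewrite -[RHS]e0 /g coef_sum [RHS]big_mkcond [LHS]big_mkcond /=.
  apply: eq_bigr => mu _.
  have -> : agree k.+1 nu mu = agree k nu mu && (nu j == mu j).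
    apply/forallP/andP => [a|[/forallP a /eqP e] i].
      split; first by apply/forallP => i; apply/implyP => hi; apply: (implyP (a i)); exact: ltnW.
      by rewrite eq_sym; apply: (implyP (a j)).
    apply/implyP; rewrite ltnS leq_eqVlt => /orP[/eqP ei|]; last exact: implyP (a i).
    by have -> : i = j by [exact: val_inj]; rewrite e.
  by case: (agree k nu mu) => //=; rewrite coefZ coefXn; case: eqP; rewrite ?mulr1 ?mulr0.
apply/mpolyP => nu; rewrite mcoeff0; have [hnu|] := boolP (nu \in msupp f); last first.
  by rewrite mcoeff_msupp negbK => /eqP.
have agr : agree n nu nu by apply/forallP => i; rewrite eqxx implybT.
rewrite -[RHS](H n (leqnn n) (fun _ => 0) nu) big_mkcond.
rewrite (bigD1_seq nu) ?msupp_uniq //= agr big_pred0 ?mulr1 => [|i]; last first.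
  by rewrite leqNgt ltn_ord.
rewrite big1 ?addr0 // => mu /eqP ne; case: ifP => // /forallP a; case: ne.
by apply/mnmP => i; apply/eqP; apply: (implyP (a i)).
Qed.

(** * Points and linear subspaces *)

Section Evaluation.
Variables (K : closedFieldType) (n : nat).
Local Notation R := {mpoly K[n.+1]}.
Local Notation V := 'rV[K]_n.+1.
Implicit Types (J : R -> Prop) (A B : subscheme K n) (f g p q : R) (u x y : V).
Implicit Types (L : {vspace V}) (xs ys : seq V).

Lemma eval_scale t f c x : f \is t.-homog -> f.@[(c *: x) 0] = c ^+ t * f.@[x 0].
Proof.
move=> hf_; rewrite !mevalE mulr_sumr big_seq [RHS]big_seq; apply: eq_bigr => mu hmu.
rewrite mulrCA; congr (_ * _).
rewrite -(dhomog_mf hf_ hmu) /= mdegE -prodrXr -big_split /=.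
by apply: eq_bigr => i _; rewrite !mxE exprMn.
Qed.

Lemma zclosure_homogP (T : V -> Prop) t f : f \is t.-homog ->
  zariski_closure T f <-> forall x, x != 0 -> T x -> f.@[x 0] = 0.
Proof.
move=> hf_; split=> [h x x0 Tx|h e x x0 Tx].
  by rewrite -(h t x x0 Tx) pihomog_dE.
rewrite (homog_split hf_); case: eqP => _; last exact: meval0.
exact: h.
Qed.

Definition pt x : subscheme K n := linear_subspace <[x]>%VS.

Lemma ptP t f x : x != 0 -> f \is t.-homog -> pt x f <-> f.@[x 0] = 0.
Proof.
move=> x0 hf_; split.
  by move/(zclosure_homogP _ hf_)/(_ x x0); apply; exact: memv_line.
move=> h; apply/(zclosure_homogP _ hf_) => _ _ /vlineP[c ->].
by rewrite (eval_scale _ _ hf_) h mulr0.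
Qed.

Lemma point_onP A x : x != 0 -> point_on A x <-> subscheme_le (pt x) A.
Proof.
move=> x0; split=> [h|h p /h hp].
  apply: le_homog => t f hf_ Af; apply/(ptP x0 hf_); exact: h.
rewrite (mpoly_sum_homog (leqnn (msize p))) raddf_sum big1 //= => i _.
by apply/(ptP x0 (pihomogP _ _ _)); exact: ideal_homog.
Qed.

Definition dot u x : K := \sum_i u 0 i * x 0 i.
Definition lform u : R := \sum_i u 0 i *: 'X_i.

Lemma dotC u x : dot u x = dot x u.
Proof. by apply: eq_bigr => i _; rewrite mulrC. Qed.

Lemma lform_homog u : lform u \is 1.-homog.
Proof. by apply: rpred_sum => i _; apply: rpredZ; exact: homog_mpolyU. Qed.

Lemma lform_eval u x : (lform u).@[x 0] = dot u x.
Proof. by rewrite raddf_sum; apply: eq_bigr => i _ /=; rewrite mevalZ mevalXU. Qed.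

Lemma lformP f : f \is 1.-homog -> exists u, f = lform u.
Proof.
move=> hf_; exists (\row_i f@_(U_(i))); apply/mpolyP => mu.
rewrite raddf_sum /=; under eq_bigr => i _ do rewrite mxE mcoeffZ mcoeffX.
have [/mdeg1P[i /eqP ->]|hmu] := boolP (mdeg mu == 1%N).
  rewrite (bigD1 i) //= eqxx mulr1 big1 ?addr0 // => j /negPf ji.
  by rewrite eq_mnm1 ji mulr0.
rewrite (dhomog_nemf_coeff hf_ hmu) big1 // => i _.
case: eqP => [e|]; last by rewrite mulr0.
by rewrite -e mdeg1 in hmu.
Qed.

Lemma dotDr u x y : dot u (x + y) = dot u x + dot u y.
Proof. by rewrite -big_split; apply: eq_bigr => i _; rewrite mxE mulrDr. Qed.

Lemma dotZr u c x : dot u (c *: x) = c * dot u x.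
Proof. by rewrite mulr_sumr; apply: eq_bigr => i _; rewrite mxE mulrCA. Qed.

Lemma dotDl u x y : dot (x + y) u = dot x u + dot y u.
Proof. by rewrite !(dotC _ u) dotDr. Qed.

Lemma dotZl u c x : dot (c *: x) u = c * dot x u.
Proof. by rewrite !(dotC _ u) dotZr. Qed.

Lemma lformD u x : lform (u + x) = lform u + lform x.
Proof. by rewrite -big_split; apply: eq_bigr => i _; rewrite mxE scalerDl. Qed.

Lemma lformZ c u : lform (c *: u) = c *: lform u.
Proof. by rewrite scaler_sumr; apply: eq_bigr => i _; rewrite mxE scalerA. Qed.

(* The i-th coordinate of the projection along L onto a complement. *)
Definition cocoord L (i : 'I_n.+1) : V := \row_j (delta_mx 0 j - projv L (delta_mx 0 j)) 0 i.

Lemma cocoordE L i x : dot (cocoord L i) x = (x - projv L x) 0 i.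
Proof.
have -> : x - projv L x = \sum_j x 0 j *: (delta_mx 0 j - projv L (delta_mx 0 j)).
  under eq_bigr => j _ do rewrite scalerBr -linearZ.
  by rewrite sumrB -linear_sum -row_sum_delta.
by rewrite summxE; apply: eq_bigr => j _; rewrite !mxE mulrC.
Qed.

Lemma cocoord_mem L i x : x \in L -> dot (cocoord L i) x = 0.
Proof. by move=> xL; rewrite cocoordE projv_id // subrr mxE. Qed.

Lemma cocoord_notin L x : x \notin L -> exists i, dot (cocoord L i) x != 0.
Proof.
move=> xL; have /rV0Pn[i hi] : x - projv L x != 0.
  by apply: contra xL; rewrite subr_eq0 => /eqP ->; exact: memv_proj.
by exists i; rewrite cocoordE.
Qed.

Lemma lin_lform L u : (forall x, x \in L -> dot u x = 0) -> linear_subspace L (lform u).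
Proof.
by move=> h; apply/(zclosure_homogP _ (lform_homog u)) => x _ xL; rewrite lform_eval h.
Qed.

Lemma lin_lformE L u : linear_subspace L (lform u) -> forall x, x \in L -> dot u x = 0.
Proof.
move=> /(zclosure_homogP _ (lform_homog u)) h x xL; have [->|x0] := eqVneq x 0.
  by rewrite /dot big1 // => i _; rewrite mxE mulr0.
by rewrite -lform_eval; exact: h.
Qed.

Lemma comp_congr J f (a b : (n.+1).-tuple R) : homog_ideal J ->
  (forall i, J (tnth a i - tnth b i)) -> J ((f \mPo a) - (f \mPo b)).
Proof.
move=> hJ h; pose eqJ p q := J (p - q).
have JM p q p' q' : eqJ p q -> eqJ p' q' -> eqJ (p * p') (q * q').
  move=> h1 h2; rewrite /eqJ.
  have -> : p * p' - q * q' = p' * (p - q) + q * (p' - q').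
    by rewrite !mulrBr (mulrC p' p) (mulrC p' q) addrA subrK.
  by apply: hs_add => //; exact: hi_mul.
have J1 p : eqJ p p by rewrite /eqJ subrr; exact: hs_zero.
rewrite !comp_mpolyEX -sumrB; apply: hs_sum => // mu _.
rewrite -scalerBr; apply: hs_scale => //.
rewrite !comp_mpolyX; elim/big_ind2: _ => [|????|i _]; [exact: J1 | exact: JM |].
by elim: (mu i) => [|k IH]; [exact: J1 | rewrite !exprS; apply: JM].
Qed.

(** Substituting for the variables the coordinates of the projection onto L changes a form only
    modulo J, and turns a form vanishing on L into 0. For L = 0 the ideal is the unit ideal, which
    linear forms do not generate. *)
Lemma lin_gen J L p : homog_ideal J -> L != 0%VS ->
  (forall u, (forall x, x \in L -> dot u x = 0) -> J (lform u)) ->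
  linear_subspace L p -> J p.
Proof.
move=> hJ L0 hJL; apply: submod_sub_homog => // t f hf_ Lf.
pose b : (n.+1).-tuple R := [tuple 'X_i - lform (cocoord L i) | i < n.+1].
have fb0 : f \mPo b = 0.
  apply: mpoly_fun0 => v; rewrite comp_mpoly_meval.
  pose x : V := \row_i v i.
  have -> : f.@[fun i => (tnth b i).@[v]] = f.@[projv L x 0].
    apply: meval_eq => i; rewrite tnth_mktuple mevalB mevalXU.
    have -> : (lform (cocoord L i)).@[v] = (lform (cocoord L i)).@[x 0].
      by apply: meval_eq => j; rewrite mxE.
    by rewrite lform_eval cocoordE !mxE opprB addrCA subrr addr0.
  (* If the projection of x is 0, homogeneity gives f(0) = 0^t f(v) for a nonzero v in L, and f(v) =
     0; this covers t = 0 as well. *)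
  have [e|y0] := eqVneq (projv L x) 0; last first.
    by move/(zclosure_homogP _ hf_): Lf; apply => //; exact: memv_proj.
  move/(zclosure_homogP _ hf_): Lf => Lf.
  have := Lf (vpick L); rewrite vpick0 => /(_ L0 (memv_pick L)) => f0.
  rewrite e -(scale0r (vpick L)) (eval_scale _ _ hf_) f0; exact: mulr0.
have := @comp_congr J f [tuple 'X_i | i < n.+1] b hJ.
rewrite comp_mpoly_id fb0 subr0; apply => i; rewrite !tnth_mktuple subKr.
by apply: hJL => x; exact: cocoord_mem.
Qed.

Lemma lin_gen1 J L p : homog_ideal J -> L != 0%VS ->
  (forall h, h \is 1.-homog -> linear_subspace L h -> J h) ->
  linear_subspace L p -> J p.
Proof.
move=> hJ L0 h; apply: lin_gen => // u hu; apply: h; first exact: lform_homog.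
exact: lin_lform.
Qed.

Lemma pt_le_lin L x : x != 0 -> subscheme_le (pt x) (linear_subspace L) <-> x \in L.
Proof.
move=> x0; split=> [h|xL].
  apply: contraT => /cocoord_notin[i /negP[]].
  rewrite -lform_eval; apply/eqP/(ptP x0 (lform_homog _))/h.
  by apply: lin_lform => y; exact: cocoord_mem.
apply: le_homog => t f hf_ /(zclosure_homogP _ hf_) h.
by apply/(ptP x0 hf_)/h.
Qed.

Lemma pt_le_pt x y : x != 0 -> subscheme_le (pt x) (pt y) <-> x \in <[y]>%VS.
Proof. exact: pt_le_lin. Qed.

Lemma line_sym x y : x != 0 -> x \in <[y]>%VS -> y \in <[x]>%VS.
Proof.
move=> x0 /vlineP[c e]; have c0 : c != 0 by apply: contraNneq x0 => c0; rewrite e c0 scale0r.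
by apply/vlineP; exists c^-1; rewrite e scalerA mulVf // scale1r.
Qed.

Lemma lform_nz x : x != 0 -> exists u, dot u x != 0.
Proof.
move=> x0; have [] := @cocoord_notin 0%VS x; first by rewrite memv0.
by move=> i hi; exists (cocoord 0%VS i).
Qed.

Lemma separate t x ys : x != 0 -> (forall y, y \in ys -> x \notin <[y]>%VS) ->
  (size ys <= t)%N ->
  exists f, [/\ f \is t.-homog, f.@[x 0] != 0 & forall y, y \in ys -> f.@[y 0] = 0].
Proof.
move=> x0; elim: ys t => [|y ys IH] [|t] //= h hs.
- by exists 1; rewrite dhomog1 meval1 oner_neq0.
- have [u hu] := lform_nz x0; exists (lform u ^+ t.+1); split=> //.
    by have := dhomogMn t.+1 (lform_homog u); rewrite mul1n.
  by rewrite rmorphXn /= lform_eval expf_neq0.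
have [f [hf_ fx fys]] := IH t (fun z hz => h z (mem_behead (s := y :: ys) hz)) hs.
have [i hi] := cocoord_notin (h y (mem_head _ _)).
exists (lform (cocoord <[y]> i) * f); split.
- by have := dhomogM (lform_homog (cocoord <[y]> i)) hf_.
- by rewrite mevalM lform_eval mulf_neq0.
move=> z; rewrite inE mevalM lform_eval => /orP[/eqP ->|/fys ->]; last by rewrite mulr0.
by rewrite cocoord_mem ?mul0r // memv_line.
Qed.

Lemma lform_avoid xs : (forall x, x \in xs -> x != 0) ->
  exists u, forall x, x \in xs -> dot u x != 0.
Proof.
elim: xs => [|x xs IH] h; first by exists 0.
have [u hu] := IH (fun z hz => h z (mem_behead (s := x :: xs) hz)).
have [w hw] := lform_nz (h x (mem_head _ _)).
(* The factors are the values of u + c w at the points, as polynomials in c; each has a nonzero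
   coefficient, coming from w at the new point and from u at the old ones. *)
have [|c hc] := @poly_nonroot K (((dot u x)%:P + dot w x *: 'X) *
   \prod_(z <- xs) ((dot u z)%:P + dot w z *: 'X)).
  rewrite mulf_neq0 //.
    apply: contraNneq hw => /(congr1 (fun p : {poly K} => p`_1)).
    by rewrite !coefE mulr1 add0r => ->.
  rewrite prodf_seq_neq0; apply/allP => z hz /=.
  apply: contraNneq (hu z hz) => /(congr1 (fun p : {poly K} => p`_0)).
  by rewrite !coefE mulr0 addr0 => ->.
exists (u + c *: w) => z; rewrite dotDl dotZl mulrC.
move: hc; rewrite hornerM horner_prod mulf_eq0 negb_or prodf_seq_neq0.
move=> /andP[h1 /allP h2]; rewrite inE => /orP[/eqP ->|/h2 /=].
  by move: h1; rewrite !hornerE.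
by rewrite !hornerE.
Qed.

Lemma dim_rowv k : \dim {:'rV[K]_k} = k.
Proof. rewrite dimvf; exact: etrans (dim_matrix _ _ _) (mul1n _). Qed.

Lemma hf_ker_le (k t : nat) J (E : {linear R -> 'rV[K]_k}) : homog_submod J ->
  (forall f, f \is t.-homog -> E f = 0 -> J f) -> (hf J t <= k)%N.
Proof.
move=> hJ h.
pose E0 (f : dhomog n.+1 K t) : 'rV[K]_k := E f.
have E_lin : linear E0 by move=> a u v; rewrite /E0 !linearP.
pose E1 := GRing.isLinear.Build _ _ _ _ E0 E_lin.
pose E2 : {linear dhomog n.+1 K t -> 'rV[K]_k} := HB.pack E0 E1.
have sub : (lker (linfun E2) <= deg_part J t)%VS.
  apply/subvP => f; rewrite memv_ker lfunE => /eqP e.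
  by apply/deg_partP => //; apply: h => //; exact: valP.
have := limg_ker_dim (linfun E2) fullv; rewrite capfv.
have := dimvS sub; have := hf_dim J t.
have := dimvS (subvf (limg (linfun E2))); rewrite dim_rowv.
rewrite /reverse_coercion; lia.
Qed.

Lemma hf_surj_ge (k t : nat) J (E : {linear R -> 'rV[K]_k}) : homog_submod J ->
  (forall f, f \is t.-homog -> J f -> E f = 0) ->
  (forall v, exists2 f, f \is t.-homog & E f = v) -> (k <= hf J t)%N.
Proof.
move=> hJ h hs.
pose E0 (f : dhomog n.+1 K t) : 'rV[K]_k := E f.
have E_lin : linear E0 by move=> a u v; rewrite /E0 !linearP.
pose E1 := GRing.isLinear.Build _ _ _ _ E0 E_lin.
pose E2 : {linear dhomog n.+1 K t -> 'rV[K]_k} := HB.pack E0 E1.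
have sub : (deg_part J t <= lker (linfun E2))%VS.
  apply/subvP => f /(deg_partP hJ) Jf; rewrite memv_ker lfunE; apply/eqP.
  by apply: h => //; exact: valP.
have full : limg (linfun E2) = fullv.
  apply/vspaceP => v; rewrite memvf; have [f hf_ <-] := hs v.
  by apply/memv_imgP; exists (DHomog hf_); rewrite ?memvf // lfunE.
have := limg_ker_dim (linfun E2) fullv; rewrite capfv full.
have := dimvS sub; have := hf_dim J t.
rewrite dim_rowv /reverse_coercion; lia.
Qed.

Definition pts xs : subscheme K n := zariski_closure (fun x => x \in xs).

Lemma ptsP t f xs : f \is t.-homog ->
  pts xs f <-> forall x, x \in xs -> x != 0 -> f.@[x 0] = 0.
Proof. by move=> hf_; rewrite (zclosure_homogP _ hf_); split=> h x ? ?; exact: h. Qed.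

(** Only pairwise distinct points of projective space are meant, with no further condition of
    general position. *)
Definition gen_pos xs :=
  [/\ uniq xs, forall x, x \in xs -> x != 0
    & forall x y, x \in xs -> y \in xs -> x \in <[y]>%VS -> x = y].

Definition eval_row xs f : 'rV[K]_(size xs) := \row_i f.@[xs`_i 0].

Lemma eval_row_linear xs : linear (eval_row xs).
Proof. by move=> a f g; apply/rowP => i; rewrite !mxE mevalD mevalZ. Qed.

Definition eval_lin xs : {linear R -> 'rV[K]_(size xs)} :=
  HB.pack (eval_row xs)
    (GRing.isLinear.Build _ _ _ _ (eval_row xs) (@eval_row_linear xs)).

Lemma hf_pts_le xs t : (hf (pts xs) t <= size xs)%N.
Proof.
apply: (@hf_ker_le _ _ _ (eval_lin xs)) => // f hf_ /rowP h.
apply/(ptsP _ hf_) => x hx _; move: (hx); rewrite -index_mem => hi.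
by have := h (Ordinal hi); rewrite !mxE /= nth_index.
Qed.

Lemma separate_gen xs x t : gen_pos xs -> x \in xs -> (size xs <= t.+1)%N ->
  exists f, [/\ f \is t.-homog, f.@[x 0] = 1
              & forall y, y \in xs -> y != x -> f.@[y 0] = 0].
Proof.
move=> [us nz gp] hx hs.
have [||f [hf_ fx fy]] := @separate t x (rem x xs) (nz x hx).
- move=> y; rewrite mem_rem_uniq // inE => /andP[ne hy].
  by apply/negP => /(gp _ _ hx hy) e; rewrite e eqxx in ne.
- by rewrite size_rem // -subn1 leq_subLR add1n.
exists ((f.@[x 0])^-1 *: f); split; first by rewrite rpredZ.
  by rewrite mevalZ mulVf.
move=> y hy ne; have y0 : f.@[y 0] = 0.
  by apply: fy; rewrite mem_rem_uniq // inE ne.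
by rewrite mevalZ y0 mulr0.
Qed.

Lemma hf_pts xs t : gen_pos xs -> (size xs <= t.+1)%N -> hf (pts xs) t = size xs.
Proof.
move=> hg hs; apply/eqP; rewrite eqn_leq hf_pts_le /=.
apply: (@hf_surj_ge (size xs) t (pts xs) (eval_lin xs) (subscheme_submod _)).
  move=> f hf_ /(ptsP _ hf_) h.
  apply/rowP => i; rewrite !mxE; apply: h; first exact: mem_nth.
  by case: hg => _ nz _; apply/nz/mem_nth.
move=> v.
have /fin_all_exists[F hF] : forall i : 'I_(size xs), exists f, [/\ f \is t.-homog,
    f.@[xs`_i 0] = 1 & forall j : 'I_(size xs), j != i -> f.@[xs`_j 0] = 0].
  move=> i.
  have [f [hf_ f1 f0]] := separate_gen hg (mem_nth 0 (ltn_ord i)) hs.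
  exists f; split=> // j ji; apply: f0; first exact: mem_nth.
  by case: hg => us _ _; rewrite nth_uniq.
exists (\sum_i v 0 i *: F i).
  by apply: rpred_sum => i _; apply: rpredZ; case: (hF i).
apply/rowP => j; rewrite mxE raddf_sum (bigD1 j) //= mevalZ.
case: (hF j) => _ -> _; rewrite mulr1 big1 ?addr0 // => i ij.
by rewrite mevalZ; case: (hF i) => _ _ ->; rewrite ?mulr0 // eq_sym.
Qed.

Lemma hf_lin1 L : hf (linear_subspace L) 1 = \dim L.
Proof.
have bL := vbasisP L; have sz := size_tuple (vbasis L).
apply/eqP; rewrite eqn_leq; apply/andP; split.
  rewrite -[X in (_ <= X)%N]sz; apply: (@hf_ker_le _ 1 (linear_subspace L)
    (eval_lin (vbasis L)) (subscheme_submod _)) => _ /lformP[u ->] /rowP h.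
  apply: lin_lform => x; rewrite -(span_basis bL) => xL.
  rewrite (coord_span xL) /dot; under eq_bigr => i _ do rewrite summxE mulr_sumr.
  rewrite exchange_big big1 //= => i _.
  have hi : (i < size (vbasis L))%N by rewrite sz.
  have := h (Ordinal hi); rewrite !mxE lform_eval => e.
  transitivity (coord (vbasis L) i x * dot u (vbasis L)`_i); last by rewrite e mulr0.
  by rewrite mulr_sumr; apply: eq_bigr => j _; rewrite mxE mulrCA.
rewrite -[X in (X <= _)%N]sz.
apply: (@hf_surj_ge _ 1 (linear_subspace L) (eval_lin (vbasis L)) (subscheme_submod _)).
  move=> _ /lformP[u ->] h.
  apply/rowP => i; rewrite !mxE lform_eval; apply: (lin_lformE h).
  by apply: vbasis_mem; exact: mem_nth.
move=> v.
pose w (i : 'I_(\dim L)) : K := v 0 (cast_ord (esym sz) i).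
pose u : V := \row_j \sum_i w i * coord (vbasis L) i (delta_mx 0 j).
exists (lform u); first exact: lform_homog.
apply/rowP => k; rewrite mxE lform_eval.
have -> : dot u (vbasis L)`_k = \sum_i w i * coord (vbasis L) i (vbasis L)`_k.
  rewrite /dot; under eq_bigr => i _ do rewrite mxE mulr_suml.
  rewrite exchange_big /=; apply: eq_bigr => i _.
  rewrite {2}(row_sum_delta (vbasis L)`_k) linear_sum mulr_sumr.
  by apply: eq_bigr => j _; rewrite linearZ /= -mulrA [_ * coord _ _ _]mulrC.
pose k' := cast_ord sz k.
rewrite (bigD1 k') //= (_ : nat_of_ord k = k') // coord_free ?(basis_free bL) // eqxx mulr1.
rewrite big1 ?addr0 => [|i ik]; last first.
  by rewrite coord_free ?(basis_free bL) // eq_sym (negPf ik) mulr0.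
by rewrite /w cast_ordK.
Qed.

(** [L] is the linear span of [A], obtained as the common zeros of its linear forms; biduality
    recovers these forms from [L]. *)
Lemma lin_of_forms A : exists L, \dim L = hf A 1 /\
  forall h, h \is 1.-homog -> linear_subspace L h <-> A h.
Proof.
have [U hU] : exists U : {vspace V}, forall u, u \in U <-> A (lform u).
  apply: linear_pred_vspace; split.
    by rewrite /lform big1; [exact: ideal_zero | move=> i _; rewrite mxE scale0r].
  by move=> a u v hu hv; rewrite lformD lformZ; apply: ideal_add => //; exact: ideal_scale.
have [L hL] : exists L : {vspace V}, forall x, x \in L <-> forall u, u \in U -> dot u x = 0.
  apply: linear_pred_vspace; split.
    by move=> u _; rewrite /dot big1 // => i _; rewrite mxE mulr0.
  by move=> a x y hx hy u hu; rewrite dotDr dotZr hx // hy // mulr0 addr0.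
have H h : h \is 1.-homog -> linear_subspace L h <-> A h.
  move=> /lformP[u ->]; split=> [h1|/hU h1]; last first.
    by apply: lin_lform => x /hL; exact.
  apply/hU; apply: contraT => /cocoord_notin[i /negP[]]; apply/eqP.
  rewrite dotC; apply: (lin_lformE h1); apply/hL => w wU.
  by rewrite dotC cocoord_mem.
exists L; split=> //; rewrite -hf_lin1; apply/eqP; rewrite eqn_leq.
by rewrite !hf_le // => h h1 /(H h h1).
Qed.

End Evaluation.

(** * Zero-dimensional subschemes *)

Section ZeroDimensional.
Variables (K : closedFieldType) (n : nat).
Local Notation R := {mpoly K[n.+1]}.
Local Notation V := 'rV[K]_n.+1.
Implicit Types (I J : R -> Prop) (A B C W : subscheme K n) (f g p q : R) (u x y : V).
Implicit Types (L : {vspace V}) (xs ys : seq V).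

Definition ideal_scheme J (hJ : homog_ideal J)
    (hs : forall p, (forall i, J ('X_i * p)) -> J p) : subscheme K n :=
  Subscheme (hs_zero hJ) (@hs_add _ _ _ hJ) (@hi_mul _ _ _ hJ) (@hs_homog _ _ _ hJ) hs.

Fact colon_sat A f p : (forall i, colon_pred A f ('X_i * p)) -> colon_pred A f p.
Proof. by move=> h; apply: ideal_sat => i; rewrite mulrCA; exact: h. Qed.

(** The residual scheme of [A] with respect to the hypersurface [f]. *)
Definition colon A k f (hf_ : f \is k.-homog) : subscheme K n :=
  ideal_scheme (colon_ideal hf_ (subscheme_ideal A)) (@colon_sat A f).

Lemma colonE A k f (hf_ : f \is k.-homog) p : colon A hf_ p = A (f * p).
Proof. by []. Qed.

Definition sat_pred J p :=
  exists k, forall mu : 'X_{1..n.+1}, (k <= mdeg mu)%N -> J ('X_[mu] * p).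

Lemma sat_pred_ideal J : homog_ideal J -> homog_ideal (sat_pred J).
Proof.
move=> hJ; apply: homog_idealP.
- by exists 0%N => mu _; rewrite mulr0; exact: hs_zero.
- move=> p q [k hk] [l hl]; exists (maxn k l) => mu; rewrite geq_max => /andP[h1 h2].
  by rewrite mulrDr; apply: hs_add; [exact: hi_submod | exact: hk | exact: hl].
- by move=> f p [k hk]; exists k => mu h; rewrite mulrCA; apply: hi_mul => //; exact: hk.
move=> e p [k hk]; exists k => mu h.
by rewrite -(pihomog_mull _ _ (homog_mpolyX K mu)); apply: hs_homog; [exact: hi_submod | exact: hk].
Qed.

Lemma sat_pred_sat J p : (forall i, sat_pred J ('X_i * p)) -> sat_pred J p.
Proof.
move=> h.
have [|i k l kl hi mu hl|k hk] := @fin_bound n (fun i k =>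
    forall mu : 'X_{1..n.+1}, (k <= mdeg mu)%N -> J ('X_[mu] * ('X_i * p))).
- by move=> i; exact: h i.
- exact/hi/(leq_trans kl).
exists k.+1 => mu hmu; case E : (mdeg mu) hmu => [|l] // hl.
have [i [nu [hnu ->]]] := X_split E.
rewrite addmC mpolyXD -mulrA; apply: hk; by rewrite hnu.
Qed.

Definition sat_scheme J (hJ : homog_ideal J) : subscheme K n :=
  ideal_scheme (sat_pred_ideal hJ) (@sat_pred_sat J).

Lemma sat_incl J (hJ : homog_ideal J) p : J p -> sat_scheme hJ p.
Proof. by move=> Jp; exists 0%N => mu _; exact: hi_mul. Qed.

Lemma sat_min J (hJ : homog_ideal J) A p : (forall q, J q -> A q) -> sat_scheme hJ p -> A p.
Proof. by move=> h [k hk]; apply: (@sat_mono _ _ A k) => mu hmu; apply/h/hk; rewrite hmu. Qed.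

Lemma inter_satE A B : inter A B = sat_scheme (add_ideal (subscheme_ideal A) (subscheme_ideal B)).
Proof. exact: subscheme_ext. Qed.

Lemma interl A B p : A p -> inter A B p.
Proof.
by move=> Ap; rewrite inter_satE; apply: sat_incl; exists p, 0; split;
  rewrite ?addr0 //; exact: ideal_zero.
Qed.

Lemma interr A B p : B p -> inter A B p.
Proof.
by move=> Ap; rewrite inter_satE; apply: sat_incl; exists 0, p; split;
  rewrite ?add0r //; exact: ideal_zero.
Qed.

Lemma inter_min A B C p : subscheme_le C A -> subscheme_le C B -> inter A B p -> C p.
Proof.
move=> hA hB; rewrite inter_satE; apply: sat_min => _ [a [b [Aa Bb ->]]].
by apply: ideal_add; [exact: hA | exact: hB].
Qed.

(** Boundedness passes to subschemes at once, unlike the existence of a degree; [hf_stable] shows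
    later that the Hilbert function is then eventually constant. *)
Definition bounded A N := exists t0, forall t, (t0 <= t)%N -> (hf A t <= N)%N.
Definition fin A := exists N, bounded A N.

Lemma fin_sub A B : subscheme_le B A -> fin A -> fin B.
Proof.
move=> h [N [t0 ht]]; exists N, t0 => t /ht; apply: leq_trans; apply: hf_le => //.
by move=> f _; exact: h.
Qed.

(** Takes the place of noetherian induction. A component of [p] outside [A] has, by saturation, a
    multiple outside [A] in every larger degree, so the Hilbert function drops in all those
    degrees. *)
Lemma bounded_strict A B p N : subscheme_le B A -> B p -> ~ A p -> bounded A N ->
  exists2 M, (M < N)%N & bounded B M.
Proof.
move=> h Bp nAp [t0 ht].
have [e nAe] : exists e, ~ A (pihomog mdeg e p).
  by apply: not_all_ex_not => hA; apply: nAp; exact/ideal_comp.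
have lt t : (maxn t0 e <= t)%N -> (hf B t < N)%N.
  rewrite geq_max => /andP[h0 he]; apply: leq_trans (ht t h0).
  rewrite ltnNge; apply/negP => hle; apply: nAe.
  apply: (@sat_homog _ _ A (t - e)) => g hg.
  have hgp : g * pihomog mdeg e p \is t.-homog.
    by rewrite -[t](subnK he); apply: dhomogM => //; exact: pihomogP.
  apply: (hf_le_eq (J := A) (J' := B) _ _ _ hle) => //; first by move=> f _; exact: h.
  by apply: ideal_mul; exact: ideal_homog.
exists N.-1; first by have := lt _ (leqnn _); case: (N).
by exists (maxn t0 e) => t /lt; case: (N).
Qed.

Lemma small_relation A t k (F : 'I_k -> R) : (forall i, F i \is t.-homog) ->
  (hf A t < k)%N -> exists2 v : 'rV[K]_k, v != 0 & A (\sum_i v 0 i *: F i).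
Proof.
move=> hF hk.
have hE (v : 'rV[K]_k) : \sum_i v 0 i *: F i \is t.-homog.
  by apply: rpred_sum => i _; exact: rpredZ.
pose E0 (v : 'rV[K]_k) : dhomog n.+1 K t := DHomog (hE v).
have E_lin : linear E0.
  move=> a u v; apply: val_inj => /=; rewrite scaler_sumr -big_split /=.
  by apply: eq_bigr => i _; rewrite !mxE scalerDl scalerA.
pose E1 := GRing.isLinear.Build _ _ _ _ E0 E_lin.
pose E2 : {linear 'rV[K]_k -> dhomog n.+1 K t} := HB.pack E0 E1.
have := @dim_sum_img _ _ _ (linfun E2) (deg_part A t) fullv (subvf _).
rewrite dim_rowv; set U := lfun_preim _ _ => hd.
have U0 : U != 0%VS.
  rewrite -dimv_eq0; have := hf_dim A t.
  have := dimvS (subvf (deg_part A t + linfun E2 @: fullv)%VS).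
  rewrite /reverse_coercion in hd *; lia.
exists (vpick U); first by rewrite vpick0.
by have := memv_pick U; rewrite -memv_preim lfunE => /(deg_partP (subscheme_submod A)).
Qed.

Lemma homog_Xn i t : ('X_i ^+ t : R) \is t.-homog.
Proof. by have := dhomogMn t (homog_mpolyU K i); rewrite mul1n. Qed.

(* A relation of large degree between two coordinates factors into linear forms, one of which
   lies in the prime ideal. *)
Lemma prime_point A N : bounded A N -> ~ A 1 ->
  (forall k f g, f \is k.-homog -> A (f * g) -> A f \/ A g) ->
  exists2 x, x != 0 & A = pt x.
Proof.
move=> [t0 ht] A1 prime.
have [i Ai] : exists i, ~ A 'X_i.
  by apply: not_all_ex_not => h; apply/A1/ideal_sat => i; rewrite mulr1.
have AX s : ~ A ('X_i ^+ s).
  elim: s => [|s IH]; first by rewrite expr0.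
  by rewrite exprS => /(prime 1%N) [|//|//]; exact: homog_mpolyU.
(* The homogenization of p to degree s in the two variables X_j and X_i; [HS] transports a linear
   factor of p. *)
pose H j s (p : {poly K}) : R := \sum_(k < s.+1) p`_k *: ('X_j ^+ k * 'X_i ^+ (s - k)).
have HS j s (p : {poly K}) c : (size p <= s.+1)%N ->
    H j s.+1 (p * ('X - c%:P)) = ('X_j - c *: 'X_i) * H j s p.
  move=> sp; rewrite mulrBl mulrBr.
  have -> : H j s.+1 (p * 'X - p * c%:P) = H j s.+1 (p * 'X) - H j s.+1 (p * c%:P).
    by rewrite /H -sumrB; apply: eq_bigr => k _; rewrite coefB scalerBl.
  congr (_ - _).
    rewrite /H big_ord_recl coefMX scale0r add0r mulr_sumr; apply: eq_bigr => k _.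
    by rewrite lift0 coefMX /= subSS -scalerAr exprS mulrA.
  rewrite /H big_ord_recr /= coefMC nth_default // mul0r scale0r addr0 mulr_sumr.
  apply: eq_bigr => k _; rewrite coefMC subSn -1?ltnS //.
  by rewrite exprS mulrCA -scalerAl -scalerAr scalerA [c * _]mulrC.
have fact j s (p : {poly K}) : p != 0 -> (size p <= s.+1)%N -> A (H j s p) ->
    exists c, A ('X_j - c *: 'X_i).
  elim: s p => [|s IH] p p0 sp Ap.
    case: (AX 0%N); move: Ap; rewrite /H big_ord1 subn0 !expr0 mulr1.
    move=> /(ideal_scale (p`_0)^-1); rewrite scalerA mulVf ?scale1r //.
    by move: p0 sp; rewrite -lead_coef_eq0 lead_coefE; case: (size p) => [|[|]].
  have [sp1|sp1] := eqVneq (size p) 1%N.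
    have [c c0 pc] : exists2 c, c != 0 & p = c%:P.
      by have /size_poly1P[c c0 ->] := introT eqP sp1; exists c.
    case: (AX s.+1); move: Ap; rewrite pc /H big_ord_recl big1 ?addr0 => [|k _].
      rewrite coefC eqxx expr0 mul1r => /(ideal_scale c^-1).
      by rewrite scalerA mulVf // scale1r.
    by rewrite coefC /= scale0r.
  have [c rc] := closed_rootP p sp1; have [q pq] := factor_theorem p c rc.
  have q0 : q != 0 by apply: contraNneq p0 => q0; rewrite pq q0 mul0r.
  have sq : (size q <= s.+1)%N.
    by move: sp; rewrite pq size_Mmonic ?monicXsubC // size_XsubC addn2.
  move: Ap; rewrite pq HS // => /(prime 1%N); case; last exact: IH.
    apply: rpredB; [exact: homog_mpolyU | apply: rpredZ; exact: homog_mpolyU].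
  by exists c.
have /fin_all_exists[c hc] : forall j, exists c, A ('X_j - c *: 'X_i).
  (* In degree s there are s + 1 > N monomials in X_j and X_i, while the Hilbert function is at most
     N. *)
  move=> j; pose s := maxn t0 N.
  have hF (k : 'I_s.+1) : ('X_j ^+ k * 'X_i ^+ (s - k) : R) \is s.-homog.
    have := dhomogM (dhomogMn k (homog_mpolyU K j)) (dhomogMn (s - k) (homog_mpolyU K i)).
    have ks : (k <= s)%N by rewrite -ltnS.
    by rewrite !mul1n subnKC.
  have [|v v0] := @small_relation A s s.+1 _ hF.
    by rewrite ltnS (leq_trans (ht s (leq_maxl _ _))) // leq_maxr.
  move=> Av; apply: (fact j s (rVpoly v)).
  - by apply: contraNneq v0 => e; rewrite -[v]rVpolyK e linear0.
  - exact: size_poly.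
  by rewrite /H; under eq_bigr => k _ do rewrite coef_rVpoly_ord.
have ci : c i = 1.
  apply: NNPP => ne; apply: Ai.
  have ne' : 1 - c i != 0 by rewrite subr_eq0 eq_sym; apply/eqP.
  have := ideal_scale (1 - c i)^-1 (hc i).
  by rewrite -{1}['X_i]scale1r -scalerBl scalerA mulVf // scale1r.
pose x : V := \row_j c j.
have x0 : x != 0.
  apply/negP => /eqP/rowP/(_ i); rewrite !mxE ci => /eqP; by rewrite oner_eq0.
have ptA p : pt x p -> A p.
  apply: lin_gen => //; first by rewrite -dimv_eq0 dim_vline x0.
  move=> u /(_ x (memv_line x)) ux.
  have -> : lform u = \sum_j u 0 j *: ('X_j - c j *: 'X_i).
    under [RHS]eq_bigr => j _ do rewrite scalerBr scalerA.
    rewrite sumrB -scaler_suml (_ : \sum_j _ = 0) ?scale0r ?subr0 //.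
    by rewrite -[RHS]ux; apply: eq_bigr => j _; rewrite mxE.
  by apply: ideal_sum => j _; exact: ideal_scale.
exists x => //; apply: subscheme_ext => p; split; last exact: ptA.
apply: le_homog => t f hf_ Af; apply/(ptP x0 hf_); apply: NNPP => fx.
have h1 : pt x (f - f.@[x 0] *: 'X_i ^+ t).
  apply/(ptP x0 (_ : _ \is t.-homog)).
    by rewrite rpredB // rpredZ // homog_Xn.
  by rewrite mevalB mevalZ rmorphXn /= mevalXU mxE ci expr1n mulr1 subrr.
apply: (AX t); have := ideal_sub Af (ptA _ h1); rewrite subKr.
by move=> /(ideal_scale (f.@[x 0])^-1); rewrite scalerA mulVf ?scale1r //; apply/eqP.
Qed.

(** If [A] is not prime, some product f g lies in it with f and g outside, and the residual by f
    contains g, so it is strictly smaller. The descent stops at a prime, which is a point. *)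
Lemma assoc_point A N : bounded A N -> ~ A 1 ->
  exists k f x (hf_ : f \is k.-homog), x != 0 /\ colon A hf_ = pt x.
Proof.
elim/ltn_ind: N A => N IH A hN A1.
have [[k [f [g [hf_ [Af [Afg nAg]]]]]]|h] := excluded_middle_informative
    (exists k f g, f \is k.-homog /\ ~ A f /\ A (f * g) /\ ~ A g).
  have [||M ltM hM] := @bounded_strict A (colon A hf_) g N _ _ nAg hN.
  - by move=> p Ap; exact: ideal_mul.
  - exact: Afg.
  have [|k' [f' [x [hf' [x0 e]]]]] := IH M ltM _ hM.
    by rewrite colonE mulr1.
  exists (k + k')%N, (f * f'), x, (dhomogM hf_ hf'); split=> //.
  rewrite -e; apply: subscheme_ext => p.
  by rewrite !colonE mulrA.
have [|x x0 ->] := prime_point hN A1.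
  move=> k f g hf_ Afg; have [|nf] := excluded_middle_informative (A f); first by left.
  have [|ng] := excluded_middle_informative (A g); first by right.
  by case: h; exists k, f, g.
exists 0%N, 1, x, (dhomog1 _ _); split=> //.
by apply: subscheme_ext => p; rewrite colonE mul1r.
Qed.

Lemma gen_pos_cons x xs : gen_pos xs -> x != 0 ->
  (forall y, y \in xs -> x \notin <[y]>%VS) -> gen_pos (x :: xs).
Proof.
move=> [us nz gp] x0 nx; split.
- by rewrite /= us andbT; apply/negP => /nx; rewrite memv_line.
- by move=> y; rewrite inE => /orP[/eqP ->|/nz].
move=> y z; rewrite !inE => /orP[/eqP ->|hy] /orP[/eqP ->|hz] //; last exact: gp.
  by rewrite (negPf (nx _ hz)).
by move=> /(line_sym (nz _ hy)); rewrite (negPf (nx _ hy)).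
Qed.

(** Distinct points impose independent conditions in large degree, so the bound on the Hilbert
    function limits their number; a list that cannot be extended is the support. *)
Lemma finite_support A : fin A -> exists xs, [/\ gen_pos xs,
   forall x, x \in xs -> subscheme_le (pt x) A
 & forall x, x != 0 -> subscheme_le (pt x) A -> exists2 y, y \in xs & x \in <[y]>%VS].
Proof.
move=> [N [t0 ht]].
have sz xs : gen_pos xs -> (forall x, x \in xs -> subscheme_le (pt x) A) ->
    (size xs <= N)%N.
  move=> gp h; pose t := maxn t0 (size xs).
  rewrite -(hf_pts gp (leqW (leq_maxr t0 _))).
  apply: leq_trans (ht t (leq_maxl _ _)); apply: hf_le => // f hf_ Af.
  apply/(ptsP _ hf_) => x hx x0; apply/(ptP x0 hf_); exact: (h x hx).
have dich xs : (forall x, x != 0 -> subscheme_le (pt x) A -> exists2 y, y \in xs & x \in <[y]>%VS)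
    \/ exists x, [/\ x != 0, subscheme_le (pt x) A & forall y, y \in xs -> x \notin <[y]>%VS].
  apply: NNPP => h; apply: (h); left=> x x0 hx; apply: NNPP => nx.
  case: h; right; exists x; split=> // y hy; apply/negP => xy; apply: nx; by exists y.
suff H k xs : gen_pos xs -> (forall x, x \in xs -> subscheme_le (pt x) A) ->
    (N - size xs <= k)%N -> exists xs, [/\ gen_pos xs,
   forall x, x \in xs -> subscheme_le (pt x) A
 & forall x, x != 0 -> subscheme_le (pt x) A -> exists2 y, y \in xs & x \in <[y]>%VS].
  by apply: (H N [::]) => //; rewrite subn0.
elim: k xs => [|k IH] xs gp h hk;
  (case: (dich xs) => [hc|[x [x0 hx nx]]]; first by exists xs);
  have gp' := gen_pos_cons gp x0 nx;
  have h' y : y \in x :: xs -> subscheme_le (pt y) A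
    by [rewrite inE => /orP[/eqP ->|/h]]; have /= := sz _ gp' h'.
  by move: hk; lia.
by move=> hN; apply: (IH (x :: xs) gp' h') => /=; move: hk; lia.
Qed.

(** If u p lies in the ideal and p does not, the residual of [A] by a component of p is nonempty and
    has an associated point. That point is in the support of [A], yet u vanishes there. *)
Lemma nonzerodivisor A : fin A -> exists2 xs : seq V, (forall x, x \in xs -> x != 0)
  & forall u, (forall x, x \in xs -> dot u x != 0) -> forall p, A (lform u * p) -> A p.
Proof.
move=> fA; have [xs [[_ nz _] _ hc]] := finite_support fA; exists xs => // u hu p Aup.
apply: NNPP => nAp.
have [e nAe] : exists e, ~ A (pihomog mdeg e p).
  by apply: not_all_ex_not => hA; apply: nAp; exact/ideal_comp.
have Aue : A (lform u * pihomog mdeg e p).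
  by rewrite -(pihomog_mull _ _ (lform_homog u)); exact: ideal_homog.
pose C := colon A (pihomogP mdeg e p).
have leC : subscheme_le C A by move=> q Aq; exact: ideal_mul.
have [N hN] := fin_sub leC fA.
have [|k [f [x [hf_ [x0 ex]]]]] := assoc_point hN.
  by rewrite colonE mulr1.
have lex : subscheme_le (pt x) A.
  by move=> q Aq; rewrite -ex; apply: ideal_mul; exact: leC.
have [y yxs /vlineP[c xy]] := hc x x0 lex.
have : pt x (lform u).
  by rewrite -ex colonE; apply: ideal_mul; rewrite colonE mulrC.
move=> /(ptP x0 (lform_homog u)); rewrite lform_eval xy dotZr => /eqP.
rewrite mulf_eq0 (negPf (hu y yxs)) orbF => /eqP c0.
by move: x0; rewrite xy c0 scale0r eqxx.
Qed.

Lemma nonzerodivisor2 A B : fin A -> fin B -> exists u,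
  (forall p, A (lform u * p) -> A p) /\ (forall p, B (lform u * p) -> B p).
Proof.
move=> /nonzerodivisor[xs nx hA] /nonzerodivisor[ys ny hB].
have [|u hu] := @lform_avoid _ _ (xs ++ ys).
  by move=> x; rewrite mem_cat => /orP[/nx|/ny].
exists u; split; [apply: hA|apply: hB] => x hx; apply: hu; rewrite mem_cat hx ?orbT //.
Qed.

End ZeroDimensional.

(** * Degree and residuals *)

Section Degree.
Variables (K : closedFieldType) (n : nat).
Local Notation R := {mpoly K[n.+1]}.
Local Notation V := 'rV[K]_n.+1.
Implicit Types (I J : R -> Prop) (A B C W : subscheme K n) (f g p q : R) (u x y : V).
Implicit Types (L : {vspace V}) (xs ys : seq V).

Lemma homogS_sum t f : f \is t.+1.-homog ->
  exists g : 'I_n.+1 -> R, (forall i, g i \is t.-homog) /\ f = \sum_i 'X_i * g i.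
Proof.
move=> hf_; have hs := dhomog_mf hf_; rewrite (mpolyE f).
pose c (mu : 'X_{1..n.+1}) := f@_mu.
rewrite -[\sum_(m <- _) _]/(\sum_(m <- msupp f) c m *: 'X_[m]).
have : forall mu, mu \in msupp f -> mdeg mu = t.+1 by exact: hs.
elim: (msupp f) => [|mu s IH] h.
  exists (fun _ => 0); split=> [i|]; first exact: rpred0.
  by rewrite big_nil big1 // => i _; rewrite mulr0.
have [g [hg eg]] := IH (fun nu hnu => h nu (mem_behead (s := mu :: s) hnu)).
have [i [nu [hnu e]]] := X_split (h mu (mem_head _ _)).
exists (fun j => g j + if j == i then c mu *: 'X_[nu] else 0); split=> [j|].
  apply: rpredD => //; case: eqP => _; last exact: rpred0.
  by apply: rpredZ; rewrite dhomogX; apply/eqP.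
rewrite big_cons; under [RHS]eq_bigr => j _ do rewrite mulrDr.
rewrite big_split /= eg addrC; congr (_ + _).
rewrite (bigD1 i) //= eqxx big1 ?addr0 => [|j /negPf ->]; last exact: mulr0.
by rewrite -scalerAr -mpolyXD -e.
Qed.

Lemma hf_zeroS J t : homog_ideal J -> hf J t = 0%N -> hf J t.+1 = 0%N.
Proof.
move=> hJ /(hf0P _ (hi_submod hJ)) h; apply/(hf0P _ (hi_submod hJ)) => f.
move=> /homogS_sum[g [hg ->]]; apply: hs_sum => // i _.
by apply: hi_mul => //; exact: h.
Qed.

(** Left unsaturated on purpose: for a nonzerodivisor its Hilbert function is exactly the first
    difference of that of [A]. *)
Definition hyper_pred A u := add_pred A (mul_pred (lform u) (fun _ => True)).

Lemma hyper_ideal A u : homog_ideal (hyper_pred A u).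
Proof.
apply: add_ideal; first exact: subscheme_ideal.
apply: (mul_ideal (lform_homog u)); exact: whole_submod.
Qed.

Lemma hf_hyper A u t : (forall p, A (lform u * p) -> A p) ->
  hf A t.+1 = (hf A t + hf (hyper_pred A u) t.+1)%N.
Proof.
move=> hu; have := @hf_add_mul _ _ 1 t (lform u) A (fun _ => True)
  (lform_homog u) (subscheme_ideal A) (hi_submod (whole_submod _ _)) _.
rewrite hf_whole add1n addn0 -/(hyper_pred A u).
have -> : hf (colon_pred A (lform u)) t = hf A t.
  have hC := colon_ideal (lform_homog u) (subscheme_ideal A).
  apply: hf_eq => // f _; first exact: ideal_mul.
  exact: hu.
by move=> <- //; rewrite addnC.
Qed.

(** The first difference belongs to a quotient ring generated by its degree 0 part, so once it
    vanishes it stays zero. Hence the Hilbert function of a nonempty scheme starts positive, rises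
    strictly, and is constant from then on; this gives all three estimates. *)
Lemma hf_stable A : fin A -> exists e, [/\ forall t, (hf A t <= e)%N,
  forall t, (e <= t.+1)%N -> hf A t = e & forall t, (minn t.+1 e <= hf A t)%N].
Proof.
move=> fA; have [u [hu _]] := nonzerodivisor2 fA fA.
have [N [t0 ht]] := fA.
pose Q t := hf (hyper_pred A u) t.+1.
have hS t : hf A t.+1 = (hf A t + Q t)%N by exact: hf_hyper.
have [A1|A1] := excluded_middle_informative (A 1).
  have h0 t : hf A t = 0%N.
    by apply/hf0P => // f _; rewrite -[f]mulr1; exact: ideal_mul.
  by exists 0%N; split=> t; rewrite ?h0 ?minn0.
have h00 : (0 < hf A 0)%N.
  rewrite lt0n; apply/eqP => /(hf0P _ (subscheme_submod A)) h.
  by apply/A1/h; exact: dhomog1.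
have ex : exists t, Q t == 0%N.
  apply: NNPP => h.
  have hge t : (t <= hf A t)%N.
    elim: t => // t IH; rewrite hS.
    have : Q t != 0%N by apply/eqP => e; apply: h; exists t; rewrite e.
    lia.
  have := ht (maxn t0 N.+1) (leq_maxl _ _).
  have := hge (maxn t0 N.+1); have := leq_maxr t0 N.+1; lia.
pose t1 := ex_minn ex.
have [Q1 min1] : Q t1 = 0%N /\ forall t, (t < t1)%N -> Q t != 0%N.
  rewrite /t1; case: ex_minnP => m /eqP h hm; split=> // t; rewrite ltnNge.
  by apply: contra => /hm.
have Q0 t : (t1 <= t)%N -> Q t = 0%N.
  move=> /subnKC <-; elim: (t - t1)%N => [|k IH]; first by rewrite addn0.
  by rewrite addnS; apply: hf_zeroS (hyper_ideal A u) IH.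
have cst t : (t1 <= t)%N -> hf A t = hf A t1.
  move=> /subnKC <-; elim: (t - t1)%N => [|k IH]; first by rewrite addn0.
  by rewrite addnS hS IH Q0 ?addn0 // leq_addr.
have low t : (t <= t1)%N -> (t < hf A t)%N.
  elim: t => // t IH lt; rewrite hS; have := IH (ltnW lt); have := min1 t lt; lia.
have mono s t : (s <= t)%N -> (hf A s <= hf A t)%N.
  by move=> /subnKC <-; elim: (t - s)%N => [|k IH]; rewrite ?addn0 // addnS hS; lia.
exists (hf A t1); split=> t.
- by have [/cst ->|/ltnW/mono] := leqP t1 t.
- by move=> h; apply: cst; have := low t1 (leqnn _); lia.
have [/cst ->|/ltnW/low h] := leqP t1 t; first exact: geq_minr.
by rewrite geq_min h.
Qed.

Lemma degreeP A e : degree A e <-> exists t0, forall t, (t0 <= t)%N -> hf A t = e.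
Proof. by split=> -[t0 h]; exists t0 => t /h /hilbert_valueP. Qed.

Lemma degree_fin A e : degree A e -> fin A.
Proof. by move=> /degreeP[t0 h]; exists e, t0 => t /h ->. Qed.

Lemma degree_uniq A d e : degree A d -> degree A e -> d = e.
Proof.
move=> /degreeP[s hs] /degreeP[t ht].
by rewrite -(hs (maxn s t)) ?leq_maxl // (ht (maxn s t)) // leq_maxr.
Qed.

Definition dg A : nat := epsilon (inhabits 0%N) (degree A).

Lemma dg_hf A : fin A -> [/\ forall t, (hf A t <= dg A)%N,
  forall t, (dg A <= t.+1)%N -> hf A t = dg A & forall t, (minn t.+1 (dg A) <= hf A t)%N].
Proof.
move=> fA; have [e [h1 h2 h3]] := hf_stable fA.
have de : degree A e by apply/degreeP; exists e => t h; apply: h2; exact: leqW.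
have := epsilon_spec (inhabits 0%N) (degree A) (ex_intro _ e de).
by move=> /degree_uniq/(_ de); rewrite -/(dg A) => ->.
Qed.

Lemma hf_le_dg A t : fin A -> (hf A t <= dg A)%N.
Proof. by move=> /dg_hf[]. Qed.

Lemma hf_dg A t : fin A -> (dg A <= t.+1)%N -> hf A t = dg A.
Proof. by move=> /dg_hf[_ h _]; exact: h. Qed.

Lemma hf_ge A t : fin A -> (minn t.+1 (dg A) <= hf A t)%N.
Proof. by move=> /dg_hf[]. Qed.

Lemma dgP A : fin A -> degree A (dg A).
Proof. by move=> fA; apply/degreeP; exists (dg A) => t h; apply: hf_dg => //; exact: leqW. Qed.

Lemma degree_dg A e : degree A e -> dg A = e.
Proof. by move=> h; apply: degree_uniq (h); apply/dgP/(degree_fin h). Qed.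

Lemma dg_le A B : subscheme_le B A -> fin A -> (dg B <= dg A)%N.
Proof.
move=> h fA; have fB := fin_sub h fA.
have := @hf_le _ _ A B (maxn (dg A) (dg B)) (subscheme_submod A) (subscheme_submod B)
  (fun f _ => @h f).
by rewrite !hf_dg // leqW // (leq_maxl, leq_maxr).
Qed.

Lemma eq_in_large A B t0 : (forall t, (t0 <= t)%N -> le_in_degree t B A) ->
  forall p, B p -> A p.
Proof.
move=> h; apply: le_homog => t f hf_ Bf.
apply: (@sat_homog _ _ A t0) => g hg.
by apply: (h (t0 + t)%N (leq_addr _ _)); [exact: dhomogM | exact: ideal_mul].
Qed.

Lemma dg_eq A B : subscheme_le B A -> fin A -> (dg A <= dg B)%N -> A = B.
Proof.
move=> h fA hd; have fB := fin_sub h fA.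
apply: subscheme_ext => p; split; first exact: h.
apply: (@eq_in_large _ _ (maxn (dg A) (dg B))) => t; rewrite geq_max => /andP[h1 h2].
apply: hf_le_eq => //; first by move=> f _; exact: h.
by rewrite !hf_dg ?(leqW h1) ?(leqW h2).
Qed.

Lemma dg0P A : fin A -> dg A = 0%N <-> A 1.
Proof.
move=> fA; split=> h.
  have := hf_dg fA (t := 0); rewrite h => /(_ isT)/(hf0P _ (subscheme_submod A)); apply.
  exact: dhomog1.
rewrite -(hf_dg fA (leqnSn _)); apply/hf0P => // f _.
by rewrite -[f]mulr1; exact: ideal_mul.
Qed.

(* A imposes independent conditions on the forms of degree t. *)
Definition indep A t := hf A t = dg A.

Lemma indepS A t : fin A -> (dg A <= t.+1)%N -> indep A t.
Proof. exact: hf_dg. Qed.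

(** With a common nonzerodivisor the two first differences are Hilbert functions of hyperplane
    sections, one contained in the other. *)
Lemma hf_diff_mono A B t : fin A -> subscheme_le B A ->
  (hf A t + hf B t.+1 <= hf A t.+1 + hf B t)%N.
Proof.
move=> fA h; have fB := fin_sub h fA.
have [u [hA hB]] := nonzerodivisor2 fA fB.
rewrite (hf_hyper t hA) (hf_hyper t hB).
have : (hf (hyper_pred B u) t.+1 <= hf (hyper_pred A u) t.+1)%N.
  have sA := hi_submod (hyper_ideal A u); have sB := hi_submod (hyper_ideal B u).
  apply: hf_le => // f _ [a [b [Aa hb ->]]]; exists a, b; split=> //; exact: h.
lia.
Qed.

(** Summing [hf_diff_mono] up to a degree where both functions have reached the degree shows that
    the defect dg - hf does not increase on a subscheme. *)
Lemma indep_sub A B t : fin A -> subscheme_le B A -> indep A t -> indep B t.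
Proof.
move=> fA h hA; have fB := fin_sub h fA.
have H k : (hf A t + hf B (t + k) <= hf A (t + k) + hf B t)%N.
  elim: k => [|k IH]; first by rewrite addn0.
  by have := hf_diff_mono (t + k) fA h; rewrite addnS; lia.
have := H (dg A + dg B)%N; rewrite hA.
have -> : hf A (t + (dg A + dg B)) = dg A by apply: hf_dg => //; lia.
have -> : hf B (t + (dg A + dg B)) = dg B by apply: hf_dg => //; lia.
by have := hf_le_dg t fB; rewrite /indep; lia.
Qed.

Lemma hyper_zero A u t : fin A -> (forall p, A (lform u * p) -> A p) ->
  (dg A <= t)%N -> hf (hyper_pred A u) t = 0%N.
Proof.
move=> fA hu; case: t => [|t] ht.
  have h0 : hf A 0 = 0%N by have := hf_le_dg 0 fA; lia.
  have : (hf (hyper_pred A u) 0 <= hf A 0)%N.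
    apply: hf_le (hi_submod (hyper_ideal A u)) _ => // f _ Af.
    by exists f, 0; split; rewrite ?addr0 //; exists 0; rewrite ?mulr0.
  by rewrite h0 leqn0 => /eqP.
have := hf_hyper t hu; rewrite !hf_dg //; [lia | exact: leqW].
Qed.

(** Write f as the sum of X_i g_i. The hyperplane section is empty in degree t, so g_i = a_i + u c_i
    with a_i in the ideal. Then u c' lies in the ideal for c' the sum of X_i c_i, hence so does c',
    and u c' is the sum of X_i (u_i c'). *)
Lemma regularity A t f : fin A -> (dg A <= t)%N -> f \is t.+1.-homog -> A f ->
  exists a : 'I_n.+1 -> R, (forall i, a i \is t.-homog /\ A (a i)) /\ f = \sum_i 'X_i * a i.
Proof.
move=> fA ht hf_ Af; have [u [hu _]] := nonzerodivisor2 fA fA.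
have [g [hg ef]] := homogS_sum hf_.
have /(hf0P _ (hi_submod (hyper_ideal A u))) h0 := hyper_zero fA hu ht.
have /fin_all_exists[a ha] : forall i, exists a, A a /\ exists c, g i = a + lform u * c.
  by move=> i; have [a [_ [Aa [c _ ->] e]]] := h0 _ (hg i); exists a; split=> //; exists c.
have /fin_all_exists[c hc] : forall i, exists c, g i = a i + lform u * c.
  by move=> i; case: (ha i).
pose c' := \sum_i 'X_i * c i.
have Ac : A c'.
  apply: hu; have -> : lform u * c' = f - \sum_i 'X_i * a i.
    rewrite ef -sumrB mulr_sumr; apply: eq_bigr => i _.
    by rewrite hc mulrDr addrAC subrr add0r mulrCA.
  by apply: ideal_sub => //; apply: ideal_sum => i _; apply: ideal_mul; case: (ha i).
exists (fun i => pihomog mdeg t (a i + u 0 i *: c')); split=> [i|].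
  split; first exact: pihomogP.
  apply: ideal_homog; apply: ideal_add; last exact: ideal_scale.
  by case: (ha i).
rewrite -[LHS](pihomog_dE hf_) ef.
have -> : \sum_i 'X_i * g i = \sum_i 'X_i * (a i + u 0 i *: c').
  under eq_bigr => i _ do rewrite hc mulrDr; rewrite big_split /=.
  under [RHS]eq_bigr => i _ do rewrite mulrDr; rewrite big_split /=; congr (_ + _).
  under eq_bigr => i _ do rewrite mulrCA; rewrite -mulr_sumr -/c' mulr_suml.
  by apply: eq_bigr => i _; rewrite -scalerAl -scalerAr.
rewrite linear_sum; apply: eq_bigr => i _.
exact: (pihomog_mull _ _ (homog_mpolyU K i)).
Qed.

Lemma generated A e s f (J : R -> Prop) : fin A -> (dg A <= e)%N ->
  f \is (e + s).-homog -> A f -> J 0 -> (forall p q, J p -> J q -> J (p + q)) ->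
  (forall mu a, mdeg mu = s -> a \is e.-homog -> A a -> J ('X_[mu] * a)) -> J f.
Proof.
move=> fA he; elim: s f J => [|s IH] f J hf_ Af J0 JD hJ.
  by rewrite -[f]mul1r -mpolyX0; apply: hJ => //; [exact: mdeg0 | rewrite addn0 in hf_].
have [||a [ha ->]] := @regularity A (e + s) f fA _ _ Af.
- exact: leq_trans (leq_addr _ _).
- by rewrite -addnS.
elim/big_ind: _ => // i _; have [hai Aai] := ha i.
apply: (IH (a i) (fun p => J ('X_i * p))) => //.
- by rewrite mulr0.
- by move=> p q hp hq; rewrite mulrDr; exact: JD.
move=> mu b hmu hb Ab; rewrite mulrA -mpolyXD; apply: hJ => //.
by rewrite mdegD mdeg1 hmu.
Qed.

(** By [generated], a basis of the single degree [dg] generates the saturation from there on, and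
    finitely many elements need only one exponent to be multiplied into [J]. Degrees of
    intersections can thus be read off from sums of ideals. *)
Lemma sat_large J (hJ : homog_ideal J) : fin (sat_scheme hJ) ->
  exists t0, forall t, (t0 <= t)%N -> le_in_degree t (sat_scheme hJ) J.
Proof.
set A := sat_scheme hJ => fA; pose e := dg A.
pose U := deg_part A e.
have [k hk] : exists k, forall a, a \is e.-homog -> A a ->
    forall mu : 'X_{1..n.+1}, (k <= mdeg mu)%N -> J ('X_[mu] * a).
  have H (s : seq (dhomog n.+1 K e)) : (forall a, a \in s -> A a) ->
     exists k, forall a, a \in s ->
       forall mu : 'X_{1..n.+1}, (k <= mdeg mu)%N -> J ('X_[mu] * a).
    elim: s => [|a s IH] h; first by exists 0%N.
    have [k hk] := IH (fun b hb => h b (mem_behead (s := a :: s) hb)).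
    have [l hl] := h a (mem_head _ _).
    exists (maxn k l) => b; rewrite inE => /orP[/eqP ->|hb] mu;
      rewrite geq_max => /andP[h1 h2]; [exact: hl | exact: hk].
  have [a ha|k hk] := H (vbasis U).
    by apply/(deg_partP (subscheme_submod A)); exact: vbasis_mem.
  exists k => a ha Aa mu hmu.
  have aU : DHomog ha \in U by apply/deg_partP.
  have := coord_vbasis aU => /(congr1 (@mpoly_of_dhomog _ _ _)) /= ->.
  rewrite linear_sum mulr_sumr; apply: hs_sum => // i _.
  rewrite linearZ /= -scalerAr; apply: hs_scale => //; apply: hk => //.
  by apply: mem_nth; rewrite size_tuple.
exists (e + k)%N => t ht f hf_ Af.
have et : t = (e + (t - e))%N by rewrite subnKC // (leq_trans (leq_addr _ _) ht).
rewrite et in hf_.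
apply: (generated fA (leqnn _) hf_ Af); first exact: hs_zero.
  by move=> p q; apply: hs_add.
by move=> mu a hmu ha Aa; apply: hk => //; rewrite hmu; clear -ht; lia.
Qed.

Lemma dg_sat J (hJ : homog_ideal J) : fin (sat_scheme hJ) ->
  exists t0, forall t, (t0 <= t)%N -> hf J t = dg (sat_scheme hJ).
Proof.
move=> fA; have [t0 ht] := sat_large fA.
exists (maxn t0 (dg (sat_scheme hJ))) => t; rewrite geq_max => /andP[h0 h1].
rewrite -(hf_dg fA (leqW h1)); apply: hf_eq => //; first exact: ht.
by move=> f _; exact: sat_incl.
Qed.

Lemma fin_union A B : fin A -> fin B -> fin (union A B).
Proof.
move=> [M [s hs]] [N [t ht]]; exists (M + N)%N, (maxn s t) => k.
rewrite geq_max => /andP[/hs h1 /ht h2]; apply: leq_trans (leq_add h1 h2).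
have := hf_add_cap k (subscheme_submod A) (subscheme_submod B).
rewrite -[hf (cap_pred A B) k]/(hf (union A B) k); lia.
Qed.

Lemma inter_lel A B : subscheme_le (inter A B) A.
Proof. exact: interl. Qed.

Lemma inter_ler A B : subscheme_le (inter A B) B.
Proof. exact: interr. Qed.

Lemma dg_inter_sum A B : fin A -> fin B ->
  (dg (union A B) + dg (inter A B) = dg A + dg B)%N.
Proof.
move=> fA fB; have fU := fin_union fA fB; have fI := fin_sub (@inter_lel A B) fA.
have [t0 ht] : exists t0, forall t, (t0 <= t)%N -> hf (add_pred A B) t = dg (inter A B).
  by move: fI; rewrite inter_satE; exact: dg_sat.
pose t := maxn t0 (dg A + dg B + dg (union A B)).
have h1 : (dg A + dg B + dg (union A B) <= t)%N by exact: leq_maxr.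
have := hf_add_cap t (subscheme_submod A) (subscheme_submod B).
rewrite ht ?leq_maxl // -[hf (cap_pred A B) t]/(hf (union A B) t) !hf_dg //; lia.
Qed.

(** For [W] inside the residual A : f, this is [A] with that residual shrunk to [W]; by [dg_sat_mul]
    the degree falls by exactly as much. *)
Definition sat_mul A k f (hf_ : f \is k.-homog) W : subscheme K n :=
  sat_scheme (add_ideal (subscheme_ideal A) (mul_ideal hf_ (subscheme_ideal W))).

Lemma sat_mul_le A k f (hf_ : f \is k.-homog) W : subscheme_le (sat_mul A hf_ W) A.
Proof.
by move=> p Ap; apply: sat_incl; exists p, 0; split; rewrite ?addr0 //; exists 0;
  rewrite ?mulr0 //; exact: ideal_zero.
Qed.

Lemma hf_sat_mul A k f (hf_ : f \is k.-homog) W t : subscheme_le W (colon A hf_) ->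
  (hf (add_pred A (mul_pred f W)) (k + t) + hf (colon A hf_) t = hf A (k + t) + hf W t)%N.
Proof. by move=> h; apply: hf_add_mul => // p _; exact: h. Qed.

Lemma colon_le A k f (hf_ : f \is k.-homog) : subscheme_le (colon A hf_) A.
Proof. by move=> p; exact: ideal_mul. Qed.

Lemma dg_sat_mul A k f (hf_ : f \is k.-homog) W : fin A -> subscheme_le W (colon A hf_) ->
  (dg (sat_mul A hf_ W) + dg (colon A hf_) = dg A + dg W)%N.
Proof.
move=> fA h; have fC := fin_sub (@colon_le A k f hf_) fA; have fW := fin_sub h fC.
have fS := fin_sub (@sat_mul_le A k f hf_ W) fA.
have [t0 ht] := dg_sat fS.
pose t := maxn t0 (dg A + dg W + dg (colon A hf_)).
have h1 : (dg A + dg W + dg (colon A hf_) <= t)%N by exact: leq_maxr.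
have := hf_sat_mul t h.
rewrite (ht (k + t)%N); last exact: leq_trans (leq_maxl _ _) (leq_addl _ _).
by rewrite !hf_dg //; lia.
Qed.

Fact empty_sat p : (forall i, (fun _ : R => True) ('X_i * p)) -> True.
Proof. by []. Qed.

Definition empty_scheme : subscheme K n := ideal_scheme (whole_submod K n) empty_sat.

(* The scheme cut out on A by the form f. *)
Definition trace A k f (hf_ : f \is k.-homog) := sat_mul A hf_ empty_scheme.

Lemma dg_empty : dg empty_scheme = 0%N.
Proof. by apply/dg0P => //; exists 0%N, 0%N => t _; rewrite hf_whole. Qed.

Lemma dg_trace A k f (hf_ : f \is k.-homog) : fin A ->
  (dg (trace A hf_) + dg (colon A hf_) = dg A)%N.
Proof. by move=> fA; rewrite dg_sat_mul // dg_empty addn0. Qed.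

Lemma trace_le A k f (hf_ : f \is k.-homog) : subscheme_le (trace A hf_) A.
Proof. exact: sat_mul_le. Qed.

(** Castelnuovo's inequality; equality may fail because saturating the trace can enlarge its ideal
    in low degrees. *)
Lemma hf_trace A k f (hf_ : f \is k.-homog) t :
  (hf (trace A hf_) (k + t) + hf (colon A hf_) t <= hf A (k + t))%N.
Proof.
have := @hf_sat_mul A k f hf_ empty_scheme t (fun _ _ => I).
rewrite [hf empty_scheme t]hf_whole addn0 => <-; rewrite leq_add2r.
have hJ := add_ideal (subscheme_ideal A) (mul_ideal hf_ (subscheme_ideal empty_scheme)).
by apply: hf_le => // p _; exact: sat_incl.
Qed.

Lemma trace_min A k f (hf_ : f \is k.-homog) B : subscheme_le B A -> B f ->
  subscheme_le B (trace A hf_).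
Proof.
move=> h Bf p; apply: sat_min => _ [a [_ [Aa [b _ ->] ->]]].
by apply: ideal_add; [exact: h | exact: ideal_mulr].
Qed.

End Degree.

Lemma nat_min (Q : nat -> Prop) : (exists k, Q k) ->
  exists2 k, Q k & forall l, Q l -> (k <= l)%N.
Proof.
move=> [k Qk]; elim/ltn_ind: k Qk => k IH Qk.
have [[l ltl Ql]|h] := excluded_middle_informative (exists2 l, (l < k)%N & Q l).
  exact: IH Ql.
exists k => // l Ql; rewrite leqNgt; apply/negP => lt; by apply: h; exists l.
Qed.

(** * Schemes that do not impose independent conditions *)

Section Lines.
Variables (K : closedFieldType) (n : nat).
Local Notation R := {mpoly K[n.+1]}.
Local Notation V := 'rV[K]_n.+1.
Implicit Types (I J : R -> Prop) (A B C W Y : subscheme K n) (f g h p q : R) (u x y : V).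
Implicit Types (L : {vspace V}) (xs ys : seq V).

Lemma pt_pts x : pt x = pts [:: x].
Proof.
have [->|x0] := eqVneq x 0.
  apply: subscheme_ext => p; split; apply: le_homog => t f hf_ _;
    apply/(zclosure_homogP _ hf_) => y y0.
    by rewrite inE => /eqP e; rewrite e eqxx in y0.
  by move=> /vlineP[c e]; rewrite e scaler0 eqxx in y0.
apply: subscheme_ext => p; split; apply: le_homog => t f hf_.
  by move=> /(ptP x0 hf_) h; apply/(ptsP _ hf_) => y; rewrite inE => /eqP ->.
by move=> /(ptsP _ hf_) h; apply/(ptP x0 hf_)/h; rewrite ?mem_head.
Qed.

Lemma fin_pts xs : fin (pts xs).
Proof. by exists (size xs), 0%N => t _; exact: hf_pts_le. Qed.

Lemma dg_pts xs : gen_pos xs -> dg (pts xs) = size xs.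
Proof.
move=> gp; have := hf_dg (fin_pts xs) (leqW (leq_maxl _ (size xs))).
by rewrite hf_pts // leqW // leq_maxr.
Qed.

Lemma dg_pt x : x != 0 -> dg (pt x) = 1%N.
Proof.
move=> x0; rewrite pt_pts dg_pts //; split=> //.
  by move=> y; rewrite inE => /eqP ->.
by move=> y z; rewrite !inE => /eqP -> /eqP ->.
Qed.

Lemma hf_lt_witness A B t : (hf B t < hf A t)%N ->
  exists f, [/\ f \is t.-homog, B f & ~ A f].
Proof.
move=> lt; apply: NNPP => h; move: lt; rewrite ltnNge => /negP; apply.
apply: hf_le => // f hf_ Bf; apply: NNPP => nA; by apply: h; exists f.
Qed.

(** Cutting by a form whose residual is a single point lowers the degree by exactly one. *)
Lemma degree2_subscheme A : fin A -> (2 <= dg A)%N ->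
  exists2 B, subscheme_le B A & dg B = 2%N.
Proof.
move=> fA h2; have [e he] : exists e, (dg A <= e)%N by exists (dg A).
elim: e A he fA h2 => [|e IH] A he fA h2; first by lia.
have [e2|ne2] := eqVneq (dg A) 2%N; first by exists A.
have [N hN] := fA.
have [|k [f [x [hf_ [x0 ex]]]]] := assoc_point hN; first by move/(dg0P fA); lia.
have := dg_trace hf_ fA; rewrite ex dg_pt // => dT.
have fT := fin_sub (@trace_le _ _ A _ _ hf_) fA.
have [||B hB dB] := IH (trace A hf_) _ fT; [lia|lia|].
by exists B => // p Ap; apply/hB/trace_le.
Qed.

Lemma inter_mono A B C : subscheme_le A B -> subscheme_le (inter A C) (inter B C).
Proof.
move=> h p; apply: inter_min; last exact: inter_ler.
by move=> q Bq; apply/interl/h.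
Qed.

Lemma fin_interl A B : fin A -> fin (inter A B).
Proof. exact/fin_sub/inter_lel. Qed.

(* Castelnuovo's argument: cut Y by a hyperplane of largest possible trace. *)
Lemma line_of_dependence d Y : fin Y -> (dg Y <= 2 * d + 1)%N -> (hf Y d < dg Y)%N ->
  exists2 L, \dim L = 2%N & (d + 2 <= dg (inter Y (linear_subspace L)))%N.
Proof.
elim: d Y => [|d IHd] Y fY.
  by have := hf_ge 0 fY; rewrite /minn; case: ifP; lia.
move=> dY hY; have [e he] : exists e, (dg Y <= e)%N by exists (dg Y).
elim: e Y fY he dY hY => [|e IHe] Y fY he dY hY; first by lia.
have hlow t := hf_ge t fY.
have big : (d.+1 + 2 <= dg Y)%N by have := hlow d.+1; rewrite /minn; case: ifP; lia.
have h1 : (2 <= hf Y 1)%N by have := hlow 1%N; rewrite /minn; case: ifP; lia.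
(* With only two linear conditions the span of Y is itself a line. *)
have [h2|h2] := leqP (hf Y 1) 2.
  have [L [dL hL]] := lin_of_forms Y.
  have d2 : \dim L = 2%N by lia.
  exists L => //; suff -> : inter Y (linear_subspace L) = Y by [].
  apply: subscheme_ext => p; split; last exact: interl.
  apply: inter_min => // q; apply: lin_gen1 => [|//|h hh /(hL h hh)] //.
  by rewrite -dimv_eq0 d2.
(* A scheme of degree 2 imposes at most two linear conditions, so some hyperplane contains it but
   not Y. The largest trace therefore has degree at least 2, which is what the residual must lose to
   meet the bound in degree d. *)
have [B leB dB] : exists2 B, subscheme_le B Y & dg B = 2%N.
  by apply: degree2_subscheme => //; lia.
have fB := fin_sub leB fY.
have [h [hh [nYh min_h]]] : exists h (hh : h \is 1.-homog), ~ Y h /\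
    forall h' (hh' : h' \is 1.-homog), ~ Y h' -> (dg (colon Y hh) <= dg (colon Y hh'))%N.
  have [|k [h [hh [nYh <-]]] hk] := @nat_min (fun k => exists h (hh : h \is 1.-homog),
      ~ Y h /\ dg (colon Y hh) = k).
    have [|h [hh _ nYh]] := @hf_lt_witness Y B 1.
      by have := hf_le_dg 1 fB; lia.
    by exists (dg (colon Y hh)), h, hh.
  exists h, hh; split=> // h' hh' nYh'; apply: hk; by exists h', hh'.
have dTC := dg_trace hh fY.
have fT := fin_sub (@trace_le _ _ Y _ _ hh) fY.
have fC := fin_sub (@colon_le _ _ Y _ _ hh) fY.
have dC0 : (0 < dg (colon Y hh))%N.
  by rewrite lt0n; apply/eqP => /(dg0P fC); rewrite colonE mulr1.
have dT2 : (2 <= dg (trace Y hh))%N.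
  have [|h' [hh' Bh' nYh']] := @hf_lt_witness Y B 1.
    by have := hf_le_dg 1 fB; lia.
  have := min_h h' hh' nYh'; have := dg_trace hh' fY.
  have := dg_le (trace_min (hf_ := hh') leB Bh') (fin_sub (@trace_le _ _ Y _ _ hh') fY).
  lia.
have hT := @hf_trace _ _ Y 1 h hh d; rewrite add1n in hT.
(* By Castelnuovo's inequality either the trace is dependent in degree d + 1 or the residual is
   dependent in degree d. *)
have [lt|ge] := ltnP (hf (trace Y hh) d.+1) (dg (trace Y hh)).
  have [||L dL hL] := IHe (trace Y hh) fT _ _ lt; [lia|lia|].
  exists L => //; apply: leq_trans hL _; apply: dg_le; last exact: fin_interl.
  exact/inter_mono/trace_le.
have [||L dL hL] := IHd (colon Y hh) fC; [lia|lia|].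
(* The second case with Y off every line is contradictory: a hyperplane through L not containing Y
   has trace of degree at least d + 2, so by the choice of h the residual has degree at most (2d +
   3) - (d + 2) = d + 1, yet it carries d + 2 on L. *)
have [|h' [hh' Lh' nYh']] := @hf_lt_witness Y (linear_subspace L) 1.
  by rewrite hf_lin1 dL.
have := min_h h' hh' nYh'; have := dg_trace hh' fY.
have fT' := fin_sub (@trace_le _ _ Y _ _ hh') fY.
have leI : subscheme_le (inter Y (linear_subspace L)) (trace Y hh').
  by apply: trace_min; [exact: inter_lel | exact: inter_ler].
have := dg_le leI fT'.
have := dg_le (inter_mono (C := linear_subspace L) (@colon_le _ _ Y _ _ hh)) (fin_interl _ fY).
have := dg_le (@inter_lel _ _ (colon Y hh) (linear_subspace L)) fC.
lia.
Qed.

Definition perp (phi : R -> K) t A := forall f, f \is t.-homog -> A f -> phi f = 0.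
Definition minimal (phi : R -> K) t A := forall W, subscheme_le W A -> perp phi t W -> W = A.

Section Functional.
Variable phi : R -> K.
Hypothesis phiD : {morph phi : p q / p + q}.

(** The two schemes, their union and their intersection all impose independent conditions, so the
    count of degrees makes the sum of the two ideals fill the ideal of the intersection in degree
    t. *)
Lemma perp_inter t A B : fin A -> fin B -> indep (union A B) t ->
  perp phi t A -> perp phi t B -> perp phi t (inter A B).
Proof.
move=> fA fB iU pA pB f hf_ If.
have fU := fin_union fA fB.
have iA : indep A t by apply: indep_sub iU => // p [].
have iB : indep B t by apply: indep_sub iU => // p [].
have iI : indep (inter A B) t by apply: indep_sub iA => //; exact: inter_lel.
have hS := add_submod (subscheme_submod A) (subscheme_submod B).
have [a [b [Aa Bb e]]] : add_pred A B f.
  apply: (@hf_le_eq _ _ (add_pred A B) (inter A B) t) If => //.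
    by rewrite inter_satE => g _; exact: sat_incl.
  have := hf_add_cap t (subscheme_submod A) (subscheme_submod B).
  rewrite -[hf (cap_pred A B) t]/(hf (union A B) t) iU iA iB iI.
  by have := dg_inter_sum fA fB; lia.
have := pihomog_dE hf_; rewrite e pihomogD => <-; rewrite phiD.
by rewrite pA ?pB ?addr0 //; try exact: pihomogP; exact: ideal_homog.
Qed.

Lemma minimal_unique t A B : fin A -> fin B -> indep (union A B) t ->
  perp phi t A -> perp phi t B -> minimal phi t A -> minimal phi t B -> A = B.
Proof.
move=> fA fB iU pA pB mA mB; have pI := perp_inter fA fB iU pA pB.
by rewrite -(mA _ (@inter_lel _ _ A B) pI) -{2}(mB _ (@inter_ler _ _ A B) pI).
Qed.

(** If [W] in the residual is orthogonal to phi(h .), then phi kills I_A + h I_W. By independence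
    this is, in degree d + 1, the full ideal of the subscheme [Z] of [A] with residual shrunk to
    [W], so Z = A by minimality and the degrees give W = A : h. *)
Lemma minimal_colon d A h (hh : h \is 1.-homog) : fin A -> indep A d.+1 ->
  indep (colon A hh) d -> perp phi d.+1 A -> minimal phi d.+1 A ->
  minimal (fun p => phi (h * p)) d (colon A hh).
Proof.
move=> fA iA iC pA mA W leW pW.
have fC := fin_sub (@colon_le _ _ A _ _ hh) fA; have fW := fin_sub leW fC.
have iW := indep_sub fC leW iC.
set Z := sat_mul A hh W; have leZ : subscheme_le Z A := @sat_mul_le _ _ A _ _ hh W.
have fZ := fin_sub leZ fA; have iZ := indep_sub fA leZ iA.
have hJ : homog_ideal (add_pred A (mul_pred h W)).
  by apply: add_ideal; [exact: subscheme_ideal | exact: (mul_ideal hh (subscheme_ideal W))].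
have := dg_sat_mul fA leW; rewrite -/Z => dZ.
have hJZ : le_in_degree d.+1 Z (add_pred A (mul_pred h W)).
  apply: (@hf_le_eq _ _ (add_pred A (mul_pred h W)) Z d.+1) => //.
    by move=> f _; exact: sat_incl.
  by have := hf_sat_mul d leW; rewrite add1n iA iC iW iZ; lia.
have ZA : Z = A.
  apply: mA => // f hf_ /(hJZ f hf_)[a [_ [Aa [b Wb ->] e]]].
  have := pihomog_dE hf_; rewrite e pihomogD [pihomog _ _ (h * b)](pihomog_mull d b hh) => <-.
  rewrite phiD pA ?add0r; [apply: pW | |]; try exact: pihomogP; exact: ideal_homog.
by apply/esym/dg_eq => //; move: dZ; rewrite ZA; lia.
Qed.

End Functional.

Lemma colon_union A B k f (hf_ : f \is k.-homog) :
  colon (union A B) hf_ = union (colon A hf_) (colon B hf_).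
Proof. exact: subscheme_ext. Qed.

Lemma residual_eq (phi : R -> K) d A B h (hh : h \is 1.-homog) :
  {morph phi : p q / p + q} -> fin A -> fin B ->
  indep A d.+1 -> indep B d.+1 -> perp phi d.+1 A -> perp phi d.+1 B ->
  minimal phi d.+1 A -> minimal phi d.+1 B ->
  indep (colon (union A B) hh) d -> colon A hh = colon B hh.
Proof.
move=> phiD fA fB iA iB pA pB mA mB; rewrite colon_union => iU.
have fCA := fin_sub (@colon_le _ _ A _ _ hh) fA.
have fCB := fin_sub (@colon_le _ _ B _ _ hh) fB.
have fU := fin_union fCA fCB.
have iCA : indep (colon A hh) d by apply: indep_sub iU => // p [].
have iCB : indep (colon B hh) d by apply: indep_sub iU => // p [].
have psiD : {morph (fun p => phi (h * p)) : p q / p + q}.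
  by move=> p q; rewrite mulrDr phiD.
apply: (minimal_unique psiD fCA fCB iU); try exact: minimal_colon.
- by move=> f hf_ Cf; apply: pA => //; have := dhomogM hh hf_; rewrite add1n.
- by move=> f hf_ Cf; apply: pB => //; have := dhomogM hh hf_; rewrite add1n.
Qed.

Lemma line_residual (phi : R -> K) d A B L :
  {morph phi : p q / p + q} -> fin A -> fin B ->
  indep A d.+1 -> indep B d.+1 -> perp phi d.+1 A -> perp phi d.+1 B ->
  minimal phi d.+1 A -> minimal phi d.+1 B -> (dg (union A B) <= 2 * d.+1 + 1)%N ->
  (d.+1 + 2 <= dg (inter (union A B) (linear_subspace L)))%N ->
  forall h, h \is 1.-homog -> linear_subspace L h -> forall p, A (h * p) <-> B (h * p).
Proof.
move=> phiD fA fB iA iB pA pB mA mB dU dL h hh Lh p.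
have fU := fin_union fA fB.
suff e : colon A hh = colon B hh by rewrite -!(colonE _ hh) e.
(* The residual of the union has degree at most (2d + 3) - (d + 3) = d. *)
apply: (@residual_eq phi d A B h hh phiD) => //; apply: indepS.
  exact: fin_sub (@colon_le _ _ _ _ _ hh) fU.
have := dg_trace hh fU.
have leI : subscheme_le (inter (union A B) (linear_subspace L)) (trace (union A B) hh).
  by apply: trace_min; [exact: inter_lel | exact: inter_ler].
have := dg_le leI (fin_sub (@trace_le _ _ _ _ _ hh) fU); lia.
Qed.

Lemma pt_in_pts x xs : x != 0 -> subscheme_le (pt x) (pts xs) ->
  exists2 y, y \in xs & x \in <[y]>%VS.
Proof.
move=> x0 h; apply: NNPP => nx.
have [|F [hF Fx Fy]] := @separate _ _ (size xs) x xs x0 _ (leqnn _).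
  by move=> y hy; apply/negP => xy; apply: nx; exists y.
have : pt x F by apply/h/(ptsP _ hF) => y hy _; exact: Fy.
by move=> /(ptP x0 hF) e; rewrite e eqxx in Fx.
Qed.

(** If f vanishes at the points of [W] without lying in its ideal, the residual W : f has an
    associated point y of [xs]. A form F nonzero at y and zero at the other points makes f F vanish
    on all of [xs], so F lies in the ideal of W : f, although F(y) is not 0. *)
Lemma pts_sub xs W : gen_pos xs -> subscheme_le W (pts xs) ->
  exists2 ys, subseq ys xs & W = pts ys.
Proof.
move=> gp leW.
pose inW x : bool := if excluded_middle_informative (subscheme_le (pt x) W) then true else false.
have inWP x : inW x <-> subscheme_le (pt x) W.
  by rewrite /inW; case: excluded_middle_informative.
exists (filter inW xs); first exact: filter_subseq.
have [us nz gpx] := gp.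
have fW := fin_sub leW (fin_pts xs).
apply: subscheme_ext => p; split; apply: le_homog => t f hf_.
  move=> Wf; apply/(ptsP _ hf_) => x; rewrite mem_filter => /andP[/inWP h _] x0.
  exact/(ptP x0 hf_)/h.
move=> /(ptsP _ hf_) f0; apply: NNPP => nWf.
have fC := fin_sub (@colon_le _ _ W _ _ hf_) fW.
have [N hN] := fC.
have [|k [g [x [hg [x0 ex]]]]] := assoc_point hN; first by rewrite colonE mulr1.
have lex : subscheme_le (pt x) W.
  by move=> q Wq; rewrite -ex; apply: ideal_mul; exact: colon_le.
have [|y yxs xy] := @pt_in_pts x xs x0; first by move=> q /leW; exact: lex.
have y0 := nz y yxs.
have [F [hF Fy Fz]] := separate_gen gp yxs (leqW (leqnn _)).
have eyx : pt y = pt x.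
  apply: subscheme_ext => q; split.
    exact: (iffRL (@pt_le_pt _ _ x y x0) xy).
  exact: (iffRL (@pt_le_pt _ _ y x y0) (line_sym x0 xy)).
have : pt x F.
  rewrite -ex colonE; apply: ideal_mul; rewrite colonE; apply: leW.
  apply/(ptsP _ (dhomogM hf_ hF)) => z hz z0; rewrite mevalM.
  have [ezy|zy] := eqVneq z y; last by rewrite Fz // mulr0.
  rewrite ezy f0 ?mul0r // mem_filter yxs andbT; apply/inWP; by rewrite eyx.
by rewrite -eyx => /(ptP y0 hF)/eqP; rewrite Fy oner_eq0.
Qed.

Lemma pts_minimal (phi : R -> K) t xs : gen_pos xs ->
  (forall ys, subseq ys xs -> perp phi t (pts ys) -> (size xs <= size ys)%N) ->
  minimal phi t (pts xs).
Proof.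
move=> gp h W leW pW; have [ys sub e] := pts_sub gp leW; rewrite e in pW *.
congr pts; apply/eqP; rewrite -(geq_leqif (size_subseq_leqif sub)); exact: h.
Qed.

Lemma empty_if_no_point A : fin A -> (forall x, x != 0 -> ~ subscheme_le (pt x) A) -> A 1.
Proof.
move=> fA h; have [xs [[_ nz _] hx _]] := finite_support fA.
apply: NNPP => nA; have [N hN] := fA.
have [k [f [x [hf_ [x0 ex]]]]] := assoc_point hN nA.
by apply: (h x x0) => q Aq; rewrite -ex; exact: colon_le.
Qed.

Lemma pts_disjoint_lin xs L : (forall x, x \in xs -> x \notin L) ->
  inter (pts xs) (linear_subspace L) 1.
Proof.
move=> h; apply: empty_if_no_point; first exact/fin_interl/fin_pts.
move=> x x0 lex.
have [|y /h yL /(line_sym x0)/vlineP[c e]] := @pt_in_pts x xs x0.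
  by move=> q /(@interl _ _ _ (linear_subspace L)); exact: lex.
have xL : x \in L by apply/pt_le_lin => // q /(@interr _ _ (pts xs)); exact: lex.
by rewrite e memvZ in yL.
Qed.

Lemma sat_unit J (hJ : homog_ideal J) A p : sat_scheme hJ 1 ->
  (forall q, J q -> A (q * p)) -> A p.
Proof.
move=> [k hk] h; apply: (@sat_mono _ _ A k) => mu hmu; apply: h.
by rewrite -['X_[mu]]mulr1; apply: hk; rewrite hmu.
Qed.

(** Chinese remainders: as [T] and [B] are disjoint, high multiples of p are sums t p + b p. The
    term b p is in the ideal because p is in that of [T]; for t p one uses that p is, up to
    saturation, in I_A + I_B. *)
Lemma split_along A B T : subscheme_le T A ->
  (forall f g, T f -> B g -> A (g * f)) -> inter T B 1 -> A = union (inter A B) T.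
Proof.
move=> leT hTB; rewrite inter_satE => h1; apply: subscheme_ext => p; split.
  by move=> Ap; split; [exact: interl | exact: leT].
move=> [Ip Tp]; apply: sat_unit h1 _ => _ [t [b [Tt Bb ->]]].
rewrite mulrDl; apply: ideal_add; last exact: hTB.
move: Ip => [k hk]; apply: (@sat_mono _ _ A k) => mu hmu.
have [|a [c [Aa Bc e]]] := hk mu; first by rewrite hmu.
by rewrite mulrCA e mulrDr; apply: ideal_add; [exact: ideal_mul | rewrite mulrC; exact: hTB].
Qed.

Lemma inter_union_disjoint A B T : subscheme_le A B -> inter T B 1 ->
  inter (union A T) B = A.
Proof.
move=> leA; rewrite inter_satE => h1; apply: subscheme_ext => p; split.
  apply: inter_min => // q [] //.
move=> Ap; apply: sat_unit h1 _ => _ [t [b [Tt Bb ->]]].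
rewrite mulrDl; apply: ideal_add; last by apply: interr; exact: ideal_mulr.
by apply: interl; split; [exact: ideal_mul | exact: ideal_mulr].
Qed.

End Lines.

(** * The functional on forms dual to a point of P^N *)

Section Functional.
Variables (K : closedFieldType) (m d : nat).
Local Notation R := {mpoly K[m.+1]}.
Local Notation V := 'rV[K]_m.+1.
Local Notation N := (veronese_dim m d).
Local Notation vm := (@veronese_mnm m d).
Implicit Types (A B C W Y : subscheme K m) (f g h p q : R) (u x y : V).
Implicit Types (L : {vspace V}) (xs ys : seq V) (P : 'rV[K]_N.+1).

Lemma veronese_mnm_deg i : mdeg (vm i) = d.
Proof.
by apply/eqP; rewrite basis_cover; apply: mem_nth; rewrite size_veronese_mnm.
Qed.

Lemma veronese_mnm_inj : injective vm.
Proof.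
move=> i j /eqP; rewrite nth_uniq ?size_veronese_mnm ?uniq_basis // => /eqP; exact: val_inj.
Qed.

Lemma veronese_mnm_surj mu : mdeg mu = d -> exists i, vm i = mu.
Proof.
move/eqP; rewrite basis_cover => h; move: (h); rewrite -index_mem size_veronese_mnm => hi.
by exists (Ordinal hi); exact: nth_index.
Qed.

(* P lies in the span of the Veronese image of A iff [phi P] vanishes on degree d of I_A. *)
Definition phi P f : K := \sum_i P 0 i * f@_(vm i).

Lemma phiD P : {morph phi P : p q / p + q}.
Proof. by move=> p q; rewrite -big_split; apply: eq_bigr => i _; rewrite mcoeffD mulrDr. Qed.

Lemma phiZ P c f : phi P (c *: f) = c * phi P f.
Proof. by rewrite mulr_sumr; apply: eq_bigr => i _; rewrite mcoeffZ mulrCA. Qed.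

Lemma phiB P p q : phi P (p - q) = phi P p - phi P q.
Proof. by rewrite phiD -scaleN1r phiZ mulN1r. Qed.

Lemma phi_sum P (I : Type) (r : seq I) (F : I -> R) :
  phi P (\sum_(i <- r) F i) = \sum_(i <- r) phi P (F i).
Proof.
elim: r => [|i r IH]; last by rewrite !big_cons phiD IH.
by rewrite !big_nil -(scale0r 0) phiZ mul0r.
Qed.

Lemma phi_addl P P' f : phi (P + P') f = phi P f + phi P' f.
Proof. by rewrite -big_split; apply: eq_bigr => i _; rewrite mxE mulrDl. Qed.

Lemma phi_scalel c P f : phi (c *: P) f = c * phi P f.
Proof. by rewrite mulr_sumr; apply: eq_bigr => i _; rewrite mxE mulrA. Qed.

Lemma phiX P i : phi P 'X_[vm i] = P 0 i.
Proof.
rewrite /phi (bigD1 i) //= mcoeffX eqxx mulr1 big1 ?addr0 // => j ji.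
by rewrite mcoeffX (inj_eq veronese_mnm_inj) eq_sym (negPf ji) mulr0.
Qed.

Lemma homog_veronese f : f \is d.-homog -> f = \sum_i f@_(vm i) *: 'X_[vm i].
Proof.
move=> hf_; apply/mpolyP => mu; rewrite raddf_sum /=.
have [hmu|hmu] := eqVneq (mdeg mu) d.
  have [i <-] := veronese_mnm_surj hmu.
  rewrite (bigD1 i) //= mcoeffZ mcoeffX eqxx mulr1 big1 ?addr0 // => j ji.
  by rewrite mcoeffZ mcoeffX (inj_eq veronese_mnm_inj) (negPf ji) mulr0.
rewrite (dhomog_nemf_coeff hf_ hmu) big1 // => i _.
rewrite mcoeffZ mcoeffX; case: eqP => [e|]; last by rewrite mulr0.
by rewrite -e veronese_mnm_deg eqxx in hmu.
Qed.

Lemma phi_veronese x f : f \is d.-homog -> phi (veronese d x) f = f.@[x 0].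
Proof.
move=> hf_; rewrite [in RHS](homog_veronese hf_) raddf_sum; apply: eq_bigr => i _ /=.
by rewrite mevalZ mxE mulrC.
Qed.

Definition form_of (u : 'rV[K]_N.+1) : R := \sum_i u 0 i *: 'X_[vm i].

Lemma form_of_homog (u : 'rV[K]_N.+1) : form_of u \is d.-homog.
Proof.
apply: rpred_sum => i _; apply: rpredZ; rewrite dhomogX; exact/eqP/veronese_mnm_deg.
Qed.

Lemma phi_form_of P (u : 'rV[K]_N.+1) : phi P (form_of u) = dot u P.
Proof. by rewrite phi_sum; apply: eq_bigr => i _; rewrite phiZ phiX. Qed.

Lemma span_veroneseP P xs : all (fun x => x != 0) xs ->
  P \in <<[seq veronese d x | x <- xs]>>%VS <-> perp (phi P) d (pts xs).
Proof.
move=> /allP nz; split=> [h f hf_ /(ptsP _ hf_) f0|h].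
  have [U hU] : exists U : {vspace 'rV[K]_N.+1}, forall v, v \in U <-> phi v f = 0.
    apply: linear_pred_vspace; split=> [|c v w hv hw].
      by rewrite -(scale0r 0) phi_scalel mul0r.
    by rewrite phi_addl phi_scalel hv hw mulr0 addr0.
  apply/hU; apply: (subvP (U := <<[seq veronese d x | x <- xs]>>%VS)) h.
  apply/span_subvP => _ /mapP[x hx ->]; apply/hU.
  by rewrite phi_veronese // f0 // nz.
apply: contraT => /cocoord_notin[i /negP[]]; set u := cocoord _ _.
rewrite -phi_form_of h ?form_of_homog //; apply/(ptsP _ (form_of_homog u)) => x hx _.
rewrite -(phi_veronese x (form_of_homog u)) phi_form_of; apply: cocoord_mem.
by apply: memv_span; exact: map_f.
Qed.

Lemma in_span_of_pointsP s P : in_span_of_points s P <->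
  exists xs, [/\ size xs = s, all (fun x => x != 0) xs & perp (phi P) d (pts xs)].
Proof.
split=> [[x nz h]|[xs [<- nz h]]].
  by exists x; split; [exact: size_tuple | | exact/span_veroneseP].
by exists (in_tuple xs) => //=; exact/span_veroneseP.
Qed.

(** The span of a union is the sum of the spans. [P1] is phi P composed with a projection of (I_A)_d
    + (I_B)_d that fixes (I_B)_d and moves elements of (I_A)_d within the intersection. *)
Lemma perp_union_split P A B : perp (phi P) d (union A B) ->
  exists P1 P2, [/\ P = P1 + P2, perp (phi P1) d A & perp (phi P2) d B].
Proof.
move=> h; pose U1 := deg_part A d; pose U2 := deg_part B d.
pose pi : dhomog m.+1 K d -> dhomog m.+1 K d := addv_pi2 U1 U2.
have hX i : 'X_[vm i] \is [in K[m.+1], d.-homog].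
  by rewrite dhomogX; exact/eqP/veronese_mnm_deg.
pose P1 : 'rV[K]_N.+1 := \row_i phi P (pi (DHomog (hX i))).
have P1E (f : dhomog m.+1 K d) : phi P1 f = phi P (pi f).
  have {2}-> : f = \sum_i f@_(vm i) *: DHomog (hX i).
    apply: val_inj; rewrite [LHS](homog_veronese (valP f)) raddf_sum.
    by apply: eq_bigr => i _.
  rewrite /pi linear_sum (raddf_sum (@mpoly_of_dhomog _ _ _)) phi_sum.
  by apply: eq_bigr => i _; rewrite linearZ /= phiZ mxE mulrC.
exists P1, (P - P1); split; first by rewrite addrC subrK.
  move=> f hf_ Af; rewrite -[f]/(DHomog hf_ : R) P1E; set f' := DHomog hf_.
  have fU : f' \in U1 by exact/deg_partP.
  have e : pi f' = f' - addv_pi1 U1 U2 f'.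
    rewrite -{2}(addv_pi1_pi2 (U := U1) (V := U2) (w := f')) 1?addrC ?addKr //.
    by rewrite -[f']addr0; apply: memv_add => //; exact: mem0v.
  apply: h; first exact: valP.
  split; last by apply/(deg_partP (subscheme_submod B)); exact: memv_pi2.
  apply/(deg_partP (subscheme_submod A)); rewrite e; apply: rpredB => //; exact: memv_pi1.
move=> f hf_ Bf; rewrite phi_addl -scaleN1r phi_scalel mulN1r -[f]/(DHomog hf_ : R) P1E.
rewrite /pi addv_pi2_id ?subrr //; exact/deg_partP.
Qed.

End Functional.

(** * Forms on a line *)

Section Frame.
Variables (K : closedFieldType) (m : nat).
Local Notation R := {mpoly K[m.+1]}.
Local Notation V := 'rV[K]_m.+1.
Implicit Types (f g h : R) (x y : V).

(** Restriction to the chart c -> p + c q of a line, whose point at infinity is q. *)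
Definition restr (p q : V) f : {poly K} :=
  mmap (@polyC K) (fun i => (p 0 i)%:P + q 0 i *: 'X) f.

(** The dual forms [a] and [b] serve to extend a polynomial on the line to a form on the whole
    space, see [lift_form]. *)
Record frame (L : {vspace V}) (p q a b : V) : Prop := Frame {
  frame_ap : dot a p = 1; frame_aq : dot a q = 0;
  frame_bp : dot b p = 0; frame_bq : dot b q = 1;
  frameP : forall x, x \in L <-> exists s t, x = s *: p + t *: q }.

Lemma frame_exists (L : {vspace V}) q : \dim L = 2%N -> q \in L -> q != 0 ->
  exists p a b, frame L p q a b.
Proof.
move=> dL qL q0.
have /subvPn[p pL pq] : ~~ (L <= <[q]>)%VS.
  by apply/negP => /dimvS; rewrite dL dim_vline q0.
have p0 : p != 0 by apply: contraNneq pq => ->; exact: mem0v.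
have qp : q \notin <[p]>%VS by apply: contra pq; exact: line_sym.
have dual x y : x \notin <[y]>%VS -> exists u, dot u x = 1 /\ dot u y = 0.
  move=> /cocoord_notin[i hi]; exists ((dot (cocoord <[y]> i) x)^-1 *: cocoord <[y]> i).
  by split; rewrite dotZl ?mulVf // (cocoord_mem _ (memv_line y)) mulr0.
have [a [ap aq]] := dual _ _ pq; have [b [bq bp]] := dual _ _ qp.
exists p, a, b; split=> // x.
have -> : L = (<[p]> + <[q]>)%VS.
  apply/eqP; rewrite eq_sym eqEdim subv_add -!memvE pL qL dL.
  suff : (\dim <[q]> < \dim (<[p]> + <[q]>))%N by rewrite dim_vline q0.
  by rewrite (ltn_leqif (dimv_leqif_sup (addvSr _ _))) subv_add subvv andbT -memvE.
split=> [/memv_addP[_ /vlineP[s ->] [_ /vlineP[t ->] ->]]|[s [t ->]]].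
  by exists s, t.
by apply: memv_add; apply: memvZ; exact: memv_line.
Qed.

Variables (p q a b : V) (L : {vspace V}).
Hypothesis fr : frame L p q a b.
Local Notation T := (restr p q).

Fact restr_mult : multiplicative T.
Proof. exact: mmap_is_multiplicative. Qed.

Lemma restrD f g : T (f + g) = T f + T g. Proof. exact: mmapD. Qed.

Lemma restrB f g : T (f - g) = T f - T g. Proof. exact: mmapB. Qed.

Lemma restrM f g : T (f * g) = T f * T g. Proof. by have [] := restr_mult. Qed.

Lemma restr1 : T 1 = 1. Proof. by have [] := restr_mult. Qed.

Lemma restrZ c f : T (c *: f) = c *: T f. Proof. by rewrite /restr mmapZ mul_polyC. Qed.

Lemma restr_sum (I : Type) (r : seq I) (F : I -> R) :
  T (\sum_(i <- r) F i) = \sum_(i <- r) T (F i).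
Proof.
by elim: r => [|i r IH]; rewrite ?big_nil ?big_cons ?restrD ?IH //; exact: mmap0.
Qed.

Lemma restrXn f k : T (f ^+ k) = T f ^+ k.
Proof. by elim: k => [|k IH]; rewrite ?restr1 // !exprS restrM IH. Qed.

Lemma restrU i : T 'X_i = (p 0 i)%:P + q 0 i *: 'X.
Proof. by rewrite /restr mmapX mmap1U. Qed.

Lemma restr_horner f c : (T f).[c] = f.@[(p + c *: q) 0].
Proof.
rewrite /restr /mmap horner_sum mevalE; apply: eq_bigr => mu _.
rewrite hornerM hornerC; congr (_ * _); rewrite /mmap1 horner_prod; apply: eq_bigr => i _.
by rewrite horner_exp !hornerE !mxE mulrC.
Qed.

Lemma restr_homog t f : f \is t.-homog -> (size (T f) <= t.+1)%N /\ (T f)`_t = f.@[q 0].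
Proof.
elim: t f => [|t IH] f hf_.
  have -> : f = (f@_0)%:MP.
    apply/mpolyP => mu; rewrite mcoeffC; case: eqVneq => [->|ne]; first by rewrite mulr1.
    by rewrite mulr0 (dhomog_nemf_coeff hf_) //= mdeg_eq0.
  by rewrite /restr mmapC mevalC coefC eqxx size_polyC; case: eqP.
have [g [hg ->]] := homogS_sum hf_; rewrite restr_sum; split.
  apply: (leq_trans (size_sum _ _ _)); apply/bigmax_leqP => i _.
  rewrite restrM restrU; apply: leq_trans (size_polyMleq _ _) _.
  have := proj1 (IH _ (hg i)).
  have : (size ((p 0 i)%:P + q 0 i *: 'X)%R <= 2)%N.
    apply: leq_trans (size_polyD _ _) _; rewrite geq_max size_polyC.
    by rewrite (leq_trans (size_scale_leq _ _)) ?size_polyX //; case: eqP.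
  lia.
rewrite coef_sum raddf_sum; apply: eq_bigr => i _ /=; have [s c] := IH _ (hg i).
rewrite restrM restrU mulrDl coefD mul_polyC coefZ nth_default // mulr0 add0r.
by rewrite -scalerAl coefZ coefXM /= c mevalM mevalXU.
Qed.

Lemma restr_ker t f : f \is t.-homog -> linear_subspace L f <-> T f = 0.
Proof.
move=> hf_; rewrite (zclosure_homogP _ hf_); split=> [h|e x _ /(frameP fr)[s [c ->]]].
  apply: poly_fun0 => c; rewrite restr_horner; apply: h.
    apply/eqP => e0; have := dotDr a p (c *: q).
    rewrite e0 dotZr (frame_aq fr) (frame_ap fr) mulr0 addr0 /dot.
    rewrite big1 => [|i _]; last by rewrite mxE mulr0.
    by move/eqP; rewrite eq_sym oner_eq0.
  by apply/(frameP fr); exists 1, c; rewrite scale1r.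
(* The point with s = 0 is at infinity; there the value of f is read from the coefficient of degree
   t of its restriction. *)
have [->|s0] := eqVneq s 0; last first.
  have -> : s *: p + c *: q = s *: (p + (s^-1 * c) *: q).
    by rewrite scalerDr scalerA mulVKf.
  by rewrite (eval_scale _ _ hf_) -restr_horner e horner0 mulr0.
rewrite scale0r add0r (eval_scale _ _ hf_).
by have [_ <-] := restr_homog hf_; rewrite e coef0 mulr0.
Qed.

Lemma restr_lform u : T (lform u) = (dot u p)%:P + dot u q *: 'X.
Proof.
rewrite restr_sum; under eq_bigr => i _ do rewrite restrZ restrU scalerDr.
rewrite big_split /= /dot rmorph_sum scaler_suml; congr (_ + _); apply: eq_bigr => i _.
  by rewrite rmorphM /= mul_polyC.
by rewrite scalerA.
Qed.

Definition lift_form t (g : {poly K}) : R :=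
  \sum_(i < t.+1) g`_i *: (lform a ^+ (t - i) * lform b ^+ i).

Lemma lift_form_homog t (g : {poly K}) : lift_form t g \is t.-homog.
Proof.
apply: rpred_sum => i _; apply: rpredZ; have it : (i <= t)%N by rewrite -ltnS.
have := dhomogM (dhomogMn (t - i) (lform_homog a)) (dhomogMn i (lform_homog b)).
by rewrite !mul1n subnK.
Qed.

Lemma restr_lift_form t (g : {poly K}) : (size g <= t.+1)%N -> T (lift_form t g) = g.
Proof.
move=> sg; rewrite restr_sum; under eq_bigr => i _ do
  rewrite restrZ restrM !restrXn !restr_lform (frame_ap fr) (frame_aq fr)
     (frame_bp fr) (frame_bq fr) scale0r addr0 add0r
     scale1r expr1n mul1r.
by rewrite -poly_def -/(Poly _); apply/polyP => i; rewrite coef_poly;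
  case: ltnP => // h; rewrite nth_default // (leq_trans sg).
Qed.

Lemma lift_formD t (g h : {poly K}) : lift_form t (g + h) = lift_form t g + lift_form t h.
Proof. by rewrite -big_split; apply: eq_bigr => i _; rewrite coefD scalerDl. Qed.

Lemma lift_formZ t c (g : {poly K}) : lift_form t (c *: g) = c *: lift_form t g.
Proof. by rewrite scaler_sumr; apply: eq_bigr => i _; rewrite coefZ scalerA. Qed.

Lemma lift_form_restr t f : f \is t.-homog -> linear_subspace L (f - lift_form t (T f)).
Proof.
move=> hf_; have hl := lift_form_homog t (T f).
apply/(restr_ker (rpredB hf_ hl)).
by rewrite restrB restr_lift_form ?subrr //; case: (restr_homog hf_).
Qed.

Lemma hf_line t : hf (linear_subspace L) t = t.+1.
Proof.
pose E0 f : 'rV[K]_t.+1 := \row_i (T f)`_i.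
have E_lin : linear E0.
  by move=> c f g; apply/rowP => i; rewrite !mxE restrD restrZ coefD coefZ.
pose E1 := GRing.isLinear.Build _ _ _ _ E0 E_lin.
pose E2 : {linear R -> 'rV[K]_t.+1} := HB.pack E0 E1.
apply/eqP; rewrite eqn_leq; apply/andP; split.
  apply: (@hf_ker_le _ _ _ t (linear_subspace L) E2 (subscheme_submod _)) => f hf_ /rowP e.
  apply/(restr_ker hf_)/polyP => i; rewrite coef0.
  have [hi|hi] := ltnP i t.+1; first by have := e (Ordinal hi); rewrite !mxE.
  by rewrite nth_default // (leq_trans (proj1 (restr_homog hf_))).
apply: (@hf_surj_ge _ _ _ t (linear_subspace L) E2 (subscheme_submod _)).
  by move=> f hf_ /(restr_ker hf_) e; apply/rowP => i; rewrite !mxE e coef0.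
move=> v; exists (lift_form t (rVpoly v)); first exact: lift_form_homog.
by apply/rowP => i; rewrite mxE restr_lift_form ?size_poly // coef_rVpoly_ord.
Qed.

End Frame.

(** * Smoothing of schemes on a line *)

Section Smoothing.
Variables (K : closedFieldType) (m d : nat).
Hypothesis charK : [pchar K] =i pred0.
Local Notation R := {mpoly K[m.+1]}.
Local Notation V := 'rV[K]_m.+1.
Local Notation N := (veronese_dim m d).
Local Notation vm := (@veronese_mnm m d).
Implicit Types (A B C W Y : subscheme K m) (f : R) (x y : V).
Implicit Types (L : {vspace V}) (xs ys ts : seq V) (P : 'rV[K]_N.+1).

Section OnFrame.
Variables (L : {vspace V}) (p q a b : V).
Hypothesis fr : frame L p q a b.

(** phi P seen on the line. When phi P kills the ideal of L the choice of the lift does not matter,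
    by [psi_restr]. *)
Definition psi P (g : {poly K}) : K := phi P (lift_form a b d g).

Lemma psiD P g h : psi P (g + h) = psi P g + psi P h.
Proof. by rewrite /psi lift_formD phiD. Qed.

Lemma psiZ P c g : psi P (c *: g) = c * psi P g.
Proof. by rewrite /psi lift_formZ phiZ. Qed.

Definition psi_coef P (j : nat) : K := phi P (lform a ^+ (d - j) * lform b ^+ j).

Lemma psiE P g : psi P g = \sum_(j < d.+1) g`_j * psi_coef P j.
Proof. by rewrite /psi phi_sum; apply: eq_bigr => j _; rewrite phiZ. Qed.

Lemma psi_restr P f : perp (phi P) d (linear_subspace L) -> f \is d.-homog ->
  psi P (restr p q f) = phi P f.
Proof.
move=> pL hf_.
have : phi P (f - lift_form a b d (restr p q f)) = 0.
  by apply: pL; [rewrite rpredB // lift_form_homog | exact: (lift_form_restr fr)].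
by rewrite phiB => /eqP; rewrite subr_eq0 => /eqP.
Qed.

Lemma vmX_homog i : 'X_[vm i] \is [in K[m.+1], d.-homog].
Proof. by rewrite dhomogX; exact/eqP/veronese_mnm_deg. Qed.

Lemma restr_veronese f : f \is d.-homog ->
  restr p q f = \sum_i f@_(vm i) *: restr p q 'X_[vm i].
Proof.
move=> hf_; rewrite {1}(homog_veronese hf_) restr_sum; apply: eq_bigr => i _.
exact: restrZ.
Qed.

Lemma frame_point_neq0 c : p + c *: q != 0.
Proof.
apply/eqP => e; have := dotDr a p (c *: q).
rewrite e dotZr (frame_aq fr) (frame_ap fr) mulr0 addr0 /dot big1 => [|i _].
  by move/eqP; rewrite eq_sym oner_eq0.
by rewrite mxE mulr0.
Qed.

Lemma perp_roots P (r : seq K) : uniq r -> perp (phi P) d (linear_subspace L) ->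
  (forall g, (size (g * \prod_(z <- r) ('X - z%:P))%R <= d.+1)%N ->
    psi P (g * \prod_(z <- r) ('X - z%:P)) = 0) ->
  perp (phi P) d (pts [seq p + z *: q | z <- r]).
Proof.
move=> ur pL hH f hf_ /(ptsP _ hf_) f0; rewrite -psi_restr //.
have [||g eg] := @uniq_roots_prod_XsubC K (restr p q f) r.
- apply/allP => z zr; rewrite rootE restr_horner f0 ?frame_point_neq0 //; exact: map_f.
- by rewrite uniq_rootsE.
by rewrite eg; apply: hH; rewrite -eg; case: (restr_homog p q hf_).
Qed.

Section Perturbation.
Variable (r : seq K).
Local Notation w := (size r).

(* The points r_i + i eps are distinct for almost all eps, even where the r_i coincide. *)
Definition moving_root (i : nat) : {poly K} := (r`_i)%:P + i%:R *: 'X.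
Definition moving_poly : {poly {poly K}} := \prod_(i < w) ('X - (moving_root i)%:P).
Definition moved_roots (c : K) : seq K := [seq (moving_root i).[c] | i <- iota 0 w].
Definition moving_rem (g : {poly K}) : {poly {poly K}} :=
  Pdiv.Ring.rmodp (map_poly polyC g) moving_poly.

Lemma moving_root_horner c i : (moving_root i).[c] = r`_i + i%:R * c.
Proof. by rewrite !hornerE. Qed.

Lemma size_moving_rem g : (size (moving_rem g) <= w)%N.
Proof.
rewrite -ltnS (leq_trans (Pdiv.Ring.ltn_rmodpN0 _ _)) //.
  by rewrite monic_neq0 // monic_prod_XsubC.
by rewrite size_prod_XsubC /index_enum -enumT size_enum_ord.
Qed.

Lemma moving_poly_at c :
  map_poly (horner_eval c) moving_poly = \prod_(z <- moved_roots c) ('X - z%:P).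
Proof.
rewrite rmorph_prod /moved_roots big_map -val_enum_ord big_map big_enum /=.
by apply: eq_bigr => i _; rewrite map_polyXsubC.
Qed.

Lemma moving_rem_at c g : exists h,
  g = h * \prod_(z <- moved_roots c) ('X - z%:P) + map_poly (horner_eval c) (moving_rem g).
Proof.
have mon : moving_poly \is monic by exact: monic_prod_XsubC.
have := Pdiv.RingMonic.rdivp_eq mon (map_poly polyC g).
move=> /(congr1 (map_poly (horner_eval c))); rewrite rmorphD rmorphM /= moving_poly_at.
have -> : map_poly (horner_eval c) (map_poly polyC g) = g.
  by apply/polyP => i; rewrite !coef_map /= /horner_eval hornerC.
by move=> e; exists (map_poly (horner_eval c)
  (Pdiv.Ring.rdivp (map_poly polyC g) moving_poly)).
Qed.

Variable P : 'rV[K]_N.+1.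
Hypothesis pL : perp (phi P) d (linear_subspace L).
Hypothesis pr : forall g, (size (g * \prod_(z <- r) ('X - z%:P))%R <= d.+1)%N ->
    psi P (g * \prod_(z <- r) ('X - z%:P)) = 0.
Hypothesis wd : (w <= d.+1)%N.

(* The functional g |-> psi P (g mod moving_poly): it is P at eps = 0, and at a general eps it
   is spanned by the evaluations at the moved roots. *)
Definition moving_point (i : 'I_N.+1) : {poly K} :=
  \sum_(j < d.+1) (psi_coef P j) *: (moving_rem (restr p q 'X_[vm i]))`_j.

Lemma moving_point_at c i : (moving_point i).[c] =
  psi P (map_poly (horner_eval c) (moving_rem (restr p q 'X_[vm i]))).
Proof.
rewrite psiE horner_sum; apply: eq_bigr => j _.
by rewrite hornerZ coef_map mulrC.
Qed.

Lemma moved_roots0 : moved_roots 0 = r.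
Proof.
apply: (@eq_from_nth _ 0) => [|i]; first by rewrite size_map size_iota.
rewrite size_map size_iota => hi; rewrite (nth_map 0%N) ?size_iota // nth_iota //.
by rewrite moving_root_horner mulr0 addr0.
Qed.

Lemma size_map_rem c g : (size (map_poly (horner_eval c) (moving_rem g)) <= w)%N.
Proof. exact: leq_trans (size_poly _ _) (size_moving_rem g). Qed.

Lemma moving_point0 i : (moving_point i).[0] = P 0 i.
Proof.
rewrite moving_point_at -phiX -(psi_restr pL (vmX_homog i)).
set g := restr _ _ _; have [h e] := moving_rem_at 0 g.
rewrite moved_roots0 in e; rewrite [in RHS]e psiD pr ?add0r //.
have -> : h * \prod_(z <- r) ('X - z%:P) = g - map_poly (horner_eval 0) (moving_rem g).
  by apply/eqP; rewrite eq_sym subr_eq; apply/eqP.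
rewrite (leq_trans (size_polyD _ _)) // geq_max size_polyN.
rewrite (leq_trans (size_map_rem 0 g)) // andbT.
by case: (restr_homog p q (vmX_homog i)).
Qed.

(** For f vanishing at the moved points, the sum of f_i times the remainders [rho i] has size at
    most w and w distinct roots, so it is zero. *)
Lemma moving_point_perp c : uniq (moved_roots c) ->
  perp (phi (\row_i (moving_point i).[c])) d
       (pts [seq p + z *: q | z <- moved_roots c]).
Proof.
move=> ur f hf_ /(ptsP _ hf_) f0.
pose rho i := map_poly (horner_eval c) (moving_rem (restr p q 'X_[vm i])).
have -> : phi (\row_i (moving_point i).[c]) f = psi P (\sum_i f@_(vm i) *: rho i).
  rewrite psiE /phi; under [RHS]eq_bigr => j _ do rewrite coef_sum mulr_suml.
  rewrite exchange_big; apply: eq_bigr => i _ /=.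
  rewrite mxE moving_point_at psiE mulr_suml; apply: eq_bigr => j _.
  by rewrite coefZ /rho; ring.
suff -> : \sum_i f@_(vm i) *: rho i = 0 by rewrite -(scale0r 0) psiZ mul0r.
apply: (@roots_geq_poly_eq0 _ _ (moved_roots c)) => //; last first.
  rewrite size_map size_iota (leq_trans (size_sum _ _ _)) //; apply/bigmax_leqP => i _.
  by rewrite (leq_trans (size_scale_leq _ _)) // size_map_rem.
apply/allP => z hz; rewrite rootE horner_sum.
have fz : (restr p q f).[z] = 0.
  by rewrite restr_horner f0 ?frame_point_neq0 //; exact: map_f.
rewrite -[X in _ == X]fz (restr_veronese hf_) horner_sum; apply/eqP/eq_bigr => i _.
have [h e] := moving_rem_at c (restr p q 'X_[vm i]).
rewrite !hornerZ [in RHS]e hornerD hornerM.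
have -> : (\prod_(z <- moved_roots c) ('X - z%:P)).[z] = 0.
  by apply/eqP; rewrite -/(root _ _) root_prod_XsubC.
by rewrite mulr0 add0r.
Qed.

Lemma moved_roots_uniq : exists2 D : {poly K}, D != 0 &
  forall c, D.[c] != 0 -> uniq (moved_roots c).
Proof.
(* In the difference of two moving roots the coefficient of the variable is i - j, nonzero in
   characteristic 0. *)
exists (\prod_(i < w) \prod_(j < w | i != j) (moving_root i - moving_root j)).
  apply/prodf_neq0 => i _; apply/prodf_neq0 => j ij.
  apply: contra ij => /eqP/(congr1 (fun g : {poly K} => g`_1)).
  rewrite !coefE /= !mulr1 !add0r => /eqP; rewrite subr_eq0 => e.
  wlog le : i j e / (i <= j)%N.
    by move=> h; case/orP: (leq_total i j) => le; [|rewrite eq_sym; rewrite eq_sym in e]; exact: h.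
  move: e; rewrite -(subnK le) natrD -subr_eq0 opprD addrCA subrr addr0 oppr_eq0.
  by move/pcharf0P: charK => ->; rewrite subn_eq0 => ge; rewrite -(inj_eq val_inj) eqn_leq le.
move=> c; rewrite horner_prod => /prodf_neq0 h.
rewrite map_inj_in_uniq ?iota_uniq // => i j; rewrite !mem_iota !add0n => /= hi hj e.
apply/eqP; apply: contraT => ij.
have := h (Ordinal hi) isT; rewrite horner_prod => /prodf_neq0/(_ (Ordinal hj)).
by rewrite -(inj_eq val_inj) /= => /(_ ij); rewrite hornerD hornerN e subrr eqxx.
Qed.

(** A form in the ideal of the secant variety vanishes on the curve [E] for almost all parameters,
    hence for all, in particular at 0, where the curve passes through P + P2. The points [ts] do not
    move. *)
Lemma smoothing_roots P2 ts : all (fun x => x != 0) ts -> perp (phi P2) d (pts ts) ->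
  P + P2 != 0 -> point_on (secant_variety K m d (w + size ts)) (P + P2).
Proof.
move=> nz pT /rV0Pn[i0 hi0].
have [D D0 hD] := moved_roots_uniq.
pose E i : {poly K} := moving_point i + (P2 0 i)%:P.
have E0 i : (E i).[0] = (P + P2) 0 i by rewrite hornerD hornerC moving_point0 mxE.
have Ei0 : E i0 != 0 by apply: contraNneq hi0 => e; rewrite -E0 e horner0.
have key (Q : {mpoly K[N.+1]}) e : secant_variety K m d (w + size ts) Q ->
    (pihomog mdeg e Q).@[(P + P2) 0] = 0.
  move=> hQ; pose U : {poly K} := mmap (@polyC K) E (pihomog mdeg e Q).
  have UE c : U.[c] = (pihomog mdeg e Q).@[fun i => (E i).[c]].
    rewrite /U /mmap horner_sum mevalE; apply: eq_bigr => mu _.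
    rewrite hornerM hornerC; congr (_ * _); rewrite /mmap1 horner_prod.
    by apply: eq_bigr => i _; rewrite horner_exp.
  suff U0 : U = 0.
    by have := UE 0; rewrite U0 horner0 => ->; apply: meval_eq => i; rewrite E0.
  (* The factors [D] and [E i0] mask the parameters where moved roots collide or where the point
     might be the zero vector. *)
  apply/eqP; have : U * (D * E i0) == 0.
    apply/eqP/poly_fun0 => c; rewrite !hornerM.
    have [->|Dc] := eqVneq D.[c] 0; first by rewrite mul0r mulr0.
    have [->|Ec] := eqVneq (E i0).[c] 0; first by rewrite !mulr0.
    suff -> : U.[c] = 0 by rewrite mul0r.
    pose x : 'rV[K]_N.+1 := \row_i (moving_point i).[c] + P2.
    have xE i : x 0 i = (E i).[c] by rewrite !mxE hornerD hornerC.
    rewrite UE -(hQ e x).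
    - by apply: meval_eq => i; rewrite xE.
    - by apply/eqP => /rowP/(_ i0); rewrite xE mxE => /eqP; rewrite (negPf Ec).
    apply/in_span_of_pointsP; exists ([seq p + z *: q | z <- moved_roots c] ++ ts); split.
    - by rewrite size_cat !size_map size_iota.
    - by rewrite all_cat nz andbT; apply/allP => _ /mapP[z _ ->]; exact: frame_point_neq0.
    move=> f hf_ /(ptsP _ hf_) f0; rewrite phi_addl moving_point_perp ?hD // ?pT ?addr0 //.
      by apply/(ptsP _ hf_) => y hy; apply: f0; rewrite mem_cat hy orbT.
    by apply/(ptsP _ hf_) => y hy; apply: f0; rewrite mem_cat hy.
  by rewrite !mulf_eq0 (negPf D0) (negPf Ei0) !orbF.
move=> Q hQ; rewrite (mpoly_sum_homog (leqnn (msize Q))) raddf_sum big1 //= => i _.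
exact: key.
Qed.

End Perturbation.

Lemma smoothing_poly P P2 ts (F : {poly K}) w : size F = w.+1 -> (w <= d.+1)%N ->
  perp (phi P) d (linear_subspace L) ->
  (forall g, (size (g * F)%R <= d.+1)%N -> psi P (g * F) = 0) ->
  all (fun x => x != 0) ts -> perp (phi P2) d (pts ts) -> P + P2 != 0 ->
  point_on (secant_variety K m d (w + size ts)) (P + P2).
Proof.
move=> sF wd pL hF nz pT nP; have [r eF] := closed_field_poly_normal F.
have F0 : F != 0 by rewrite -size_poly_gt0 sF.
have l0 : lead_coef F != 0 by rewrite lead_coef_eq0.
have sr : size r = w.
  by apply/eqP; rewrite -eqSS -sF eF size_scale // size_prod_XsubC.
rewrite -sr; apply: smoothing_roots => //; last by rewrite sr.
have e : \prod_(z <- r) ('X - z%:P) = (lead_coef F)^-1 *: F.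
  by rewrite {2}eF scalerA mulVf // scale1r.
move=> g; rewrite e -scalerAr scalerAl; exact: hF.
Qed.

End OnFrame.

(** The point at infinity is chosen outside the zeros of F, so that no root is lost and the
    restriction has degree exactly w. *)
Lemma frame_of_form L F w : \dim L = 2%N -> F \is w.-homog -> ~ linear_subspace L F ->
  exists p q a b, [/\ frame L p q a b, size (restr p q F) = w.+1 &
    forall P, perp (phi P) d (linear_subspace L) ->
    (forall k g, (w + k = d)%N -> g \is k.-homog -> phi P (F * g) = 0) ->
    forall g, (size (g * restr p q F)%R <= d.+1)%N -> psi a b P (g * restr p q F) = 0].
Proof.
move=> dL hF nLF.
have [q [q0 qL Fq]] : exists q, [/\ q != 0, q \in L & F.@[q 0] != 0].
  apply: NNPP => h; apply: nLF; apply/(zclosure_homogP _ hF) => x x0 xL.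
  by apply: NNPP => /eqP Fx; apply: h; exists x.
have [p [a [b fr]]] := frame_exists dL qL q0.
have [sF cF] := restr_homog p q hF.
have sF' : size (restr p q F) = w.+1.
  apply/eqP; rewrite eqn_leq sF ltnNge; apply: contra Fq => h.
  by rewrite -cF nth_default.
exists p, q, a, b; split=> // P pL hP g sg.
have [->|g0] := eqVneq g 0; first by rewrite mul0r -(scale0r 0) psiZ mul0r.
have F0 : restr p q F != 0 by rewrite -size_poly_gt0 sF'.
move: sg; rewrite size_mul // sF' addnS /= => sg.
have g1 : (0 < size g)%N by rewrite size_poly_gt0.
have wd' : (w <= d)%N by rewrite -ltnS (leq_trans _ sg) // -add1n leq_add2r.
have wkd := subnKC wd'.
have hg := lift_form_homog a b (d - w) g.
have sg' : (size g <= (d - w).+1)%N by rewrite -(leq_add2l w) addnS wkd addnC.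
have hFg := dhomogM hF hg; rewrite wkd in hFg.
have e : g * restr p q F = restr p q (F * lift_form a b (d - w) g).
  by rewrite restrM (restr_lift_form fr) // mulrC.
by rewrite e (psi_restr fr) // (hP (d - w)%N).
Qed.

Lemma smoothing_form L P P2 ts F w : \dim L = 2%N -> F \is w.-homog -> (w <= d.+1)%N ->
  ~ linear_subspace L F -> perp (phi P) d (linear_subspace L) ->
  (forall k g, (w + k = d)%N -> g \is k.-homog -> phi P (F * g) = 0) ->
  all (fun x => x != 0) ts -> perp (phi P2) d (pts ts) -> P + P2 != 0 ->
  point_on (secant_variety K m d (w + size ts)) (P + P2).
Proof.
move=> dL hF wd nLF pL hP nz pT nP.
have [p [q [a [b [fr sF h]]]]] := frame_of_form dL hF nLF.
exact: (smoothing_poly fr sF wd pL (h P pL hP)).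
Qed.

Lemma smoothing_scheme L A P ts : \dim L = 2%N -> fin A -> subscheme_le A (linear_subspace L) ->
  (dg A <= d.+1)%N -> all (fun x => x != 0) ts -> perp (phi P) d (union A (pts ts)) -> P != 0 ->
  point_on (secant_variety K m d (dg A + size ts)) P.
Proof.
move=> dL fA leA hA nz pU nP; have [P1 [P2 [eP p1 p2]]] := perp_union_split pU.
have [q0 qL] : vpick L != 0 /\ vpick L \in L by rewrite vpick0 memv_pick -dimv_eq0 dL.
have [p [a [b fr]]] := frame_exists dL qL q0.
(* In degree dg A the line imposes dg A + 1 conditions and A at most dg A. *)
have [|F [hF AF nLF]] := @hf_lt_witness _ _ (linear_subspace L) A (dg A).
  by rewrite (hf_line fr) ltnS hf_le_dg.
rewrite eP in nP *; apply: (smoothing_form dL hF) => //.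
  by move=> f hf_ Lf; apply: p1 => //; exact: leA.
move=> k g e hg; apply: p1; last exact: ideal_mulr.
by have := dhomogM hF hg; rewrite e.
Qed.

End Smoothing.

(** * Apolarity and the rank of binary forms *)

Lemma linear_system (K : fieldType) k l (F : 'I_k -> 'I_l -> K) : (l < k)%N ->
  exists2 v : 'rV[K]_k, v != 0 & forall j, \sum_i v 0 i * F i j = 0.
Proof.
move=> lk; pose M : 'M[K]_(k, l) := \matrix_(i, j) F i j.
exists (nz_row (kermx M)).
  rewrite nz_row_eq0 -mxrank_eq0 mxrank_ker subn_eq0 -ltnNge.
  exact: leq_ltn_trans (rank_leq_col M) lk.
move=> j; have e : (nz_row (kermx M) *m M) 0 j = 0.
  by rewrite (sub_kermxP (nz_row_sub _)) mxE.
by rewrite -[RHS]e mxE; apply: eq_bigr => i _; rewrite mxE.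
Qed.

(* A double root of F + c G is a zero of the Wronskian of F and G, and determines c. *)
Lemma pencil_separable (K : closedFieldType) (charK : [pchar K] =i pred0) (F G : {poly K}) :
  coprimep F G -> (1 < size F)%N -> (size G < size F)%N ->
  exists c, let H := F + c *: G in size H = size F /\
    exists2 r : seq K, uniq r & H = lead_coef H *: \prod_(z <- r) ('X - z%:P).
Proof.
move=> cop F1 GF.
have F0 : F != 0 by rewrite -size_poly_gt0 (ltn_trans _ F1).
pose W := F^`() * G - F * G^`().
(* Otherwise F would divide F' by coprimality, while F' is nonzero of smaller degree in
   characteristic 0. *)
have W0 : W != 0.
  apply/eqP => /eqP; rewrite subr_eq0 => /eqP e.
  have : F %| F^`() by rewrite -(Gauss_dvdpl _ cop) e dvdp_mulr.
  have F'0 : F^`() != 0.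
    apply: contraTneq F1 => e0; rewrite -leqNgt; apply/leq_sizeP => j hj.
    case: j hj => // j _; have := congr1 (fun p : {poly K} => p`_j) e0.
    rewrite coef0 coef_deriv => /eqP; rewrite -mulr_natr mulf_eq0.
    by move/pcharf0P: charK => ->; rewrite orbF => /eqP.
  by move=> /(dvdp_leq F'0); rewrite leqNgt lt_size_deriv.
have [ws eW] := closed_field_poly_normal W.
(* No factor is the zero polynomial in c because F and G have no common root. *)
have [|c hc] := @poly_nonroot K (\prod_(z <- ws) ((F.[z])%:P + G.[z] *: 'X)).
  rewrite prodf_seq_neq0; apply/allP => z _ /=; apply/eqP => e.
  have := congr1 (fun p : {poly K} => p`_0) e; have := congr1 (fun p : {poly K} => p`_1) e.
  rewrite !coefE /= mulr1 mulr0 addr0 add0r => Gz Fz.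
  by have := coprimep_root cop (introT eqP Fz); rewrite Gz eqxx.
exists c => H.
have sH : size H = size F.
  by rewrite size_polyDl // (leq_ltn_trans (size_scale_leq _ _)).
split=> //; have [r eH] := closed_field_poly_normal H; exists r => //.
have H0 : H != 0 by rewrite -size_poly_gt0 sH (ltn_trans _ F1).
rewrite -separable_prod_XsubC -(eqp_separable (p := H)); last first.
  by rewrite {1}eH eqp_scale // lead_coef_eq0.
rewrite separable_poly.unlock.
apply: Pdiv.ClosedField.root_coprimep => z /eqP Hz; apply/negP => /eqP H'z.
have Wz : W.[z] = 0.
  have e1 : F.[z] = - (c * G.[z]).
    by apply/eqP; rewrite -addr_eq0 -hornerZ -hornerD; apply/eqP.
  have e2 : F^`().[z] = - (c * G^`().[z]).
    apply/eqP; rewrite -addr_eq0 -hornerZ -hornerD -derivZ -derivD; exact/eqP.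
  by rewrite /W hornerD hornerN !hornerM e1 e2; ring.
have zws : z \in ws.
  move: (introT eqP Wz); rewrite -/(root W z) eW rootZ ?lead_coef_eq0 //.
  by rewrite root_prod_XsubC.
move: hc; rewrite horner_prod prodf_seq_neq0 => /allP/(_ z zws) /=.
rewrite !hornerE mulrC => /eqP; apply.
by move: Hz; rewrite /H !hornerE.
Qed.

Section RankBound.
Variables (K : closedFieldType) (m d : nat).
Hypothesis charK : [pchar K] =i pred0.
Local Notation R := {mpoly K[m.+1]}.
Local Notation V := 'rV[K]_m.+1.
Local Notation N := (veronese_dim m d).
Implicit Types (A B C W Y : subscheme K m) (x y : V).
Implicit Types (L : {vspace V}) (xs ys ts : seq V) (P : 'rV[K]_N.+1).

Section OnFrame.
Variables (L : {vspace V}) (p q a b : V).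
Hypothesis fr : frame L p q a b.
Local Notation psi := (@psi K m d a b).

Lemma psi0 P : psi P 0 = 0.
Proof. by rewrite -(scale0r 0) psiZ mul0r. Qed.

Lemma psi_mul_coef P (u g : {poly K}) l : (size g <= l)%N ->
  psi P (u * g) = \sum_(j < l) g`_j * psi P (u * 'X^j).
Proof.
move=> sg; have -> : g = \sum_(j < l) g`_j *: 'X^j.
  rewrite -poly_def; apply/polyP => i; rewrite coef_poly.
  by case: ltnP => // h; rewrite nth_default // (leq_trans sg).
rewrite mulr_sumr; under [RHS]eq_bigr => j _ do rewrite -poly_def.
have H (I : Type) (s : seq I) (F : I -> {poly K}) :
    psi P (\sum_(i <- s) F i) = \sum_(i <- s) psi P (F i).
  by elim: s => [|i s IH]; rewrite ?big_nil ?psi0 // !big_cons psiD IH.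
rewrite H; apply: eq_bigr => j _; rewrite -scalerAr psiZ coef_poly.
by rewrite ltn_ord.
Qed.

(** There are k unknown coefficients, and orthogonality to the multiples by 1, ..., X^(l-1) imposes
    only l conditions. *)
Lemma ann_poly P k l : (l < k)%N -> exists u : {poly K}, [/\ u != 0, (size u <= k)%N &
  forall g : {poly K}, (size g <= l)%N -> psi P (u * g) = 0].
Proof.
move=> lk; have [v v0 hv] := linear_system
  (fun (i : 'I_k) (j : 'I_l) => psi P ('X^j * 'X^i)) lk.
exists (rVpoly v); split; last first.
- move=> g sg; rewrite (psi_mul_coef P _ sg) big1 // => j _.
  rewrite [rVpoly v * _]mulrC (@psi_mul_coef P 'X^j (rVpoly v) k) ?size_poly //.
  suff -> : \sum_(i < k) (rVpoly v)`_i * psi P ('X^j * 'X^i) = 0 by rewrite mulr0.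
  by rewrite -[RHS](hv j); apply: eq_bigr => i _; rewrite coef_rVpoly_ord.
- exact: size_poly.
by apply: contraNneq v0 => e; rewrite -[v]rVpolyK e linear0.
Qed.

Variables (P : 'rV[K]_N.+1) (z : nat) (F : {poly K}).
Hypotheses (pL : perp (phi P) d (linear_subspace L)) (sF : size F = z.+1).
Hypothesis hF : forall g, (size (g * F)%R <= d.+1)%N -> psi P (g * F) = 0.
Hypothesis min_z : forall (q : {poly K}) k, size q = k.+1 -> (0 < k < z)%N ->
  ~ forall g, (size (g * q)%R <= d.+1)%N -> psi P (g * q) = 0.
Hypotheses (z1 : (0 < z)%N) (zd : (2 * z <= d + 2)%N).

(* Sylvester's algorithm: G is apolar as a form of degree d + 2 - z (as a polynomial it has degree
   less than z) and prime to F, so a general combination of G and a multiple of F of that degree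
   has simple roots. *)
Lemma binary_rank : exists2 r : seq K, size r = (d + 2 - z)%N &
  perp (phi P) d (pts [seq p + c *: q | c <- r]).
Proof.
have F0 : F != 0 by rewrite -size_poly_gt0 sF.
have [G [G0 sG hG]] : exists G : {poly K}, [/\ G != 0, (size G <= z)%N &
    forall g : {poly K}, (size g <= z.-1)%N -> psi P (G * g) = 0].
  by apply: ann_poly; rewrite prednK.
have cop : coprimep F G.
  (* If h = gcd(F, G) had positive degree, Bezout for F/h and G/h would write each admissible g h as
     A F + G B with B of size at most z - 1. Then psi P kills both terms, so h contradicts
     [min_z]. *)
  rewrite /coprimep; apply: contraT => nc.
  set h := gcdp F G; have hF' : h %| F := dvdp_gcdl _ _.
  have hG' : h %| G := dvdp_gcdr _ _.
  have h0 : h != 0 by rewrite gcdp_eq0 negb_and F0.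
  have h1 : (0 < size h)%N by rewrite size_poly_gt0.
  have hz : (size h <= z)%N by rewrite (leq_trans (dvdp_leq G0 hG')).
  pose F1 := F %/ h; pose G1 := G %/ h.
  have eF : F = F1 * h by rewrite divpK.
  have eG : G = G1 * h by rewrite divpK.
  have F10 : F1 != 0 by apply: contraNneq F0 => e; rewrite eF e mul0r.
  have sF1 : (size F1 + size h = z.+2)%N.
    have e : size (F1 * h) = z.+1 by rewrite -eF.
    move: e; rewrite size_mul //; case: (size F1) (size_poly_gt0 F1) => [|k _].
      by rewrite F10.
    by rewrite addSn /= => ->.
  have cop1 : coprimep F1 G1 by rewrite coprimep_div_gcd // F0.
  have [[U V] /= eUV] := Bezout_eq1_coprimepP _ _ cop1.
  have k2 : (1 < size h)%N by move: nc h1; rewrite -/h; case: (size h) => [|[|]].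
  have [||g] := @min_z h (size h).-1; [by rewrite prednK | by move: k2 hz; lia |].
  move=> sg; pose B := (g * V) %% F1; pose A := g * U + ((g * V) %/ F1) * G1.
  have eg : g = A * F1 + B * G1.
    rewrite -{1}[g]mulr1 -eUV mulrDr !mulrA {1}(divp_eq (g * V) F1) -/B /A.
    by rewrite !mulrDl addrA; congr (_ + _ + _); rewrite mulrAC.
  have sB : (size B < size F1)%N by rewrite ltn_modpN0.
  have sBz : (size B <= z.-1)%N by move: sB sF1 k2; lia.
  have e : g * h = A * F + G * B.
    transitivity ((A * F1 + B * G1) * h); first by rewrite -eg.
    by rewrite mulrDl -!mulrA -eF -eG [B * G]mulrC.
  rewrite e psiD hG // addr0; apply: hF.
  have -> : A * F = g * h - G * B by rewrite e addrK.
  rewrite (leq_trans (size_polyD _ _)) // geq_max sg size_polyN.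
  have ar i j : (i <= z)%N -> (j <= z.-1)%N -> ((i + j).-1 <= d.+1)%N.
    by clear -zd z1; lia.
  exact: leq_trans (size_polyMleq _ _) (ar _ _ sG sBz).
(* A power of X - gam pads F to degree d + 2 - z and stays prime to G. *)
have [gam Ggam] := poly_nonroot G0.
pose a' := ('X - gam%:P) ^+ (d + 2 - z - z).
have sa : size a' = (d + 2 - z - z).+1%N by rewrite size_exp_XsubC.
have sF' : size (F * a') = (d + 2 - z).+1%N.
  rewrite size_mul ?sF ?sa //; last by rewrite -size_poly_gt0 sa.
  by clear -zd; lia.
have [|||H [sH [r ur eH]]] := @pencil_separable K charK (F * a') G.
- rewrite coprimepMl cop coprimep_expl // coprimep_sym.
  by rewrite coprimep_XsubC rootE.
- by rewrite sF'; clear -zd z1; lia.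
- have ar i : (i <= z)%N -> (i < (d + 2 - z).+1)%N by clear -zd z1; lia.
  rewrite sF'; exact: ar.
set HH := _ + _ in sH eH.
have sr : size r = (d + 2 - z)%N.
  have : size HH = (size r).+1.
    rewrite eH size_scale ?size_prod_XsubC // lead_coef_eq0 -size_poly_gt0 sH.
    by rewrite sF'.
  by rewrite sH sF' => -[].
exists r => //; apply: (perp_roots fr) => // g sg.
have l0 : lead_coef HH != 0 by rewrite lead_coef_eq0 -size_poly_gt0 sH sF'.
have e : \prod_(x <- r) ('X - x%:P) = (lead_coef HH)^-1 *: HH.
  by rewrite {2}eH scalerA mulVf // scale1r.
have [->|g0] := eqVneq g 0; first by rewrite mul0r psi0.
have sgH : (size g + (d + 2 - z) <= d.+1)%N.
  move: sg; rewrite size_mul ?size_prod_XsubC ?sr ?addnS //.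
  by rewrite -size_poly_gt0 size_prod_XsubC.
have g1 : (0 < size g)%N by rewrite size_poly_gt0.
(* The size of g is at most z - 1, so g G is killed by the choice of G, and the other term is a
   multiple of F of size at most d + 1. *)
rewrite e -scalerAr psiZ /HH mulrDr psiD -scalerAr psiZ [g * G]mulrC hG ?mulr0 ?addr0; last first.
  have ar i : (i + (d + 2 - z) <= d.+1)%N -> (i <= z.-1)%N by clear -zd z1; lia.
  exact: ar.
rewrite [F * _]mulrC mulrA hF ?mulr0 // -mulrA [a' * F]mulrC.
have ar i : (i + (d + 2 - z) <= d.+1)%N -> ((i + (d + 2 - z).+1).-1 <= d.+1)%N.
  by clear; lia.
by apply: leq_trans (size_polyMleq _ _) _; rewrite sF'; exact: ar.
Qed.

End OnFrame.

(** The border rank hypothesis makes the degree of [A] least among apolar polynomials of positive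
    degree on the line, by smoothing. This provides [min_z] and 2z <= d + 2 for Sylvester's
    algorithm, applied to the part [P1] of P on the line. *)
Lemma rank_bound L A P ts : \dim L = 2%N -> fin A -> subscheme_le A (linear_subspace L) ->
  all (fun x => x != 0) ts -> perp (phi P) d (union A (pts ts)) -> P != 0 ->
  (0 < dg A <= d)%N -> (2 <= d)%N ->
  (forall s, point_on (secant_variety K m d s) P -> (dg A + size ts <= s)%N) ->
  (2 * dg A <= d + 2)%N /\ exists ys, [/\ all (fun x => x != 0) ys,
     size ys = (d + 2 - dg A + size ts)%N & perp (phi P) d (pts ys)].
Proof.
move=> dL fA leA nz pU nP /andP[z0 zd] d2 hb; set z := dg A in z0 zd hb *.
have [P1 [P2 [eP p1 p2]]] := perp_union_split pU.
have pL : perp (phi P1) d (linear_subspace L).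
  by move=> f hf_ Lf; apply: p1 => //; exact: leA.
rewrite eP in hb nP *.
have [q0 qL] : vpick L != 0 /\ vpick L \in L by rewrite vpick0 memv_pick -dimv_eq0 dL.
have [p [a [b fr]]] := frame_exists dL qL q0.
have [F [hF AF nLF]] : exists F, [/\ F \is z.-homog, A F & ~ linear_subspace L F].
  by apply: hf_lt_witness; rewrite (hf_line fr) ltnS hf_le_dg.
have z2 : (2 * z <= d + 2)%N.
  (* Every binary form of degree d has an apolar form of degree w: w + 1 coefficients against d - w
     + 1 < w + 1 conditions. Smoothing it bounds the border rank, whence z <= w. *)
  pose w := (d./2).+1.
  have [wd dw] : (w <= d)%N /\ (d - w < w)%N by rewrite /w; clear -d2; lia.
  have [u [u0 su hu]] := @ann_poly a b P1 w.+1 (d - w).+1 dw.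
  have eu := restr_lift_form fr su.
  suff : (z <= w)%N by rewrite /w; clear; lia.
  rewrite -(leq_add2r (size ts)); apply: hb.
  apply: (smoothing_form charK dL (lift_form_homog a b w u)) => //; first exact: leqW.
    by move=> /(restr_ker fr (lift_form_homog a b w u)) e; rewrite -eu e eqxx in u0.
  move=> k g wk hg; rewrite -(psi_restr fr) //; last first.
    by have := dhomogM (lift_form_homog a b w u) hg; rewrite wk.
  rewrite restrM eu hu //; have [sg _] := restr_homog p (vpick L) hg.
  by rewrite (leq_trans sg) // -wk addKn.
split=> //; have [p' [q' [a' [b' [fr' sF hFr]]]]] := frame_of_form d dL hF nLF.
have [||r sr pr] := binary_rank fr' pL sF _ _ z0 z2.
- apply: hFr => // k g e hg; apply: p1; last exact: ideal_mulr.
  by have := dhomogM hF hg; rewrite e.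
- move=> f k sf /andP[k0 kz] h.
  have : (z + size ts <= k + size ts)%N.
    apply: hb; apply: (smoothing_poly charK fr' sf) => //.
    by rewrite (leq_trans (ltnW kz)) // leqW.
  by rewrite leq_add2r leqNgt kz.
exists ([seq p' + c *: q' | c <- r] ++ ts); split.
- rewrite all_cat nz andbT; apply/allP => _ /mapP[c _ ->]; exact: (frame_point_neq0 fr').
- by rewrite size_cat size_map sr.
move=> f hf_ /(ptsP _ hf_) f0; rewrite phi_addl pr // ?p2 ?addr0 //.
  by apply/(ptsP _ hf_) => y hy; apply: f0; rewrite mem_cat hy orbT.
by apply/(ptsP _ hf_) => y hy; apply: f0; rewrite mem_cat hy.
Qed.

End RankBound.

(** * The theorem on schemes of P^m *)

Section Core.
Variables (K : closedFieldType) (m : nat).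
Local Notation R := {mpoly K[m.+1]}.
Local Notation V := 'rV[K]_m.+1.
Implicit Types (A B C W Y Z : subscheme K m) (f g h p q : R) (u x y : V).
Implicit Types (L : {vspace V}) (xs ys ts : seq V).

Lemma lform_avoid_lin L xs : (forall x, x \in xs -> x \notin L) ->
  exists u, (forall y, y \in L -> dot u y = 0) /\ forall x, x \in xs -> dot u x != 0.
Proof.
elim: xs => [|x xs IH] h.
  by exists 0; split=> // y _; rewrite /dot big1 // => i _; rewrite mxE mul0r.
have [u [uL hu]] := IH (fun z hz => h z (mem_behead (s := x :: xs) hz)).
have [i hw] := cocoord_notin (h x (mem_head _ _)); set w := cocoord L i in hw.
have [|c hc] := @poly_nonroot K (((dot u x)%:P + dot w x *: 'X) *
   \prod_(z <- xs) ((dot u z)%:P + dot w z *: 'X)).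
  rewrite mulf_neq0 //.
    apply: contraNneq hw => /(congr1 (fun p : {poly K} => p`_1)).
    by rewrite !coefE mulr1 add0r => ->.
  rewrite prodf_seq_neq0; apply/allP => z hz /=.
  apply: contraNneq (hu z hz) => /(congr1 (fun p : {poly K} => p`_0)).
  by rewrite !coefE mulr0 addr0 => ->.
exists (u + c *: w); split=> [y yL|z].
  by rewrite dotDl dotZl uL // cocoord_mem // mulr0 addr0.
rewrite dotDl dotZl mulrC.
move: hc; rewrite hornerM horner_prod mulf_eq0 negb_or prodf_seq_neq0.
move=> /andP[h1 /allP h2]; rewrite inE => /orP[/eqP ->|/h2 /=].
  by move: h1; rewrite !hornerE.
by rewrite !hornerE.
Qed.

Lemma pts_cons x xs t f : f \is t.-homog -> x != 0 ->
  pts (x :: xs) f <-> f.@[x 0] = 0 /\ pts xs f.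
Proof.
move=> hf_ x0; rewrite !(ptsP _ hf_); split=> [h|[fx h] y].
  by split=> [|y hy]; apply: h; rewrite ?mem_head // inE hy orbT.
by rewrite inE => /orP[/eqP ->|]; [|exact: h].
Qed.

Lemma pts_dependent t xs : (forall x, x \in xs -> x != 0) -> hf (pts xs) t = size xs \/
  exists ys, [/\ {subset ys <= xs}, (size ys < size xs)%N & le_in_degree t (pts ys) (pts xs)].
Proof.
elim: xs => [|x xs IH] nz.
  by left; apply/eqP; rewrite -leqn0; exact: hf_pts_le.
have x0 := nz x (mem_head _ _).
have [e|[ys [sub sz le]]] := IH (fun z hz => nz z (mem_behead (s := x :: xs) hz)); last first.
  right; exists (x :: ys); split=> //.
    by move=> z; rewrite !inE => /orP[->|/sub ->] //; rewrite orbT.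
  move=> f hf_ /(pts_cons _ hf_ x0)[fx /(le f hf_) h].
  exact/(pts_cons _ hf_ x0).
have [h|h] := excluded_middle_informative (le_in_degree t (pts xs) (pts (x :: xs))).
  by right; exists xs; split=> // z hz; rewrite inE hz orbT.
left; apply/eqP; rewrite eqn_leq hf_pts_le /= ltnNge; apply/negP => le; apply: h.
apply: (hf_le_eq (J := pts (x :: xs)) (J' := pts xs)) => //; last by rewrite e.
by move=> f hf_ /(pts_cons _ hf_ x0)[].
Qed.

Lemma pts_disjoint xs B : (forall x, x \in xs -> x != 0 -> ~ subscheme_le (pt x) B) ->
  inter (pts xs) B 1.
Proof.
move=> h; apply: empty_if_no_point; first exact/fin_interl/fin_pts.
move=> x x0 lex.
have [|y yxs xy] := @pt_in_pts _ _ x xs x0.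
  by move=> q /(@interl _ _ _ B); exact: lex.
have y0 : y != 0.
  by apply: contraNneq x0 => e; move: xy; rewrite e => /vlineP[c ->]; rewrite scaler0.
apply: (h y yxs y0) => q /(@interr _ _ (pts xs)) /lex.
exact: (iffRL (pt_le_pt x y0) (line_sym x0 xy)).
Qed.

Lemma dg_union_disjoint A B : fin A -> fin B -> inter A B 1 ->
  dg (union A B) = (dg A + dg B)%N.
Proof.
move=> fA fB h; rewrite -dg_inter_sum //.
by rewrite (iffRL (dg0P (fin_interl B fA)) h) addn0.
Qed.

Lemma union_meet A B T : union (union A T) (union B T) = union (union A B) T.
Proof. by apply: subscheme_ext => p; split=> [[[? ?] [? ?]]|[[? ?] ?]]. Qed.

Section OnPoint.
Variable d : nat.
Hypothesis charK : [pchar K] =i pred0.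
Local Notation N := (veronese_dim m d).
Variables (P : 'rV[K]_N.+1) (b r : nat).
Hypotheses (P0 : P != 0) (d2 : (2 <= d)%N).
Hypothesis hb : forall s, point_on (secant_variety K m d s) P -> (b <= s)%N.
Hypothesis hr : forall ys, all (fun x => x != 0) ys -> perp (phi P) d (pts ys) ->
  (r <= size ys)%N.
Hypotheses (lt_br : (b < r)%N) (sum_br : (b + r <= 2 * d + 1)%N).

Definition rank_set xs := [/\ gen_pos xs, size xs = r & perp (phi P) d (pts xs)].
Definition border_scheme W := [/\ fin W, perp (phi P) d W & (dg W <= b)%N].

Lemma rank_set_all xs : rank_set xs -> all (fun x => x != 0) xs.
Proof. by move=> [[_ nz _] _ _]; apply/allP. Qed.

Lemma rank_set_minimal xs : rank_set xs -> minimal (phi P) d (pts xs).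
Proof.
move=> rx; have [gp sz pS] := rx; apply: pts_minimal => // ys sub pY.
rewrite sz; apply: hr => //; apply/allP => y /(mem_subseq sub) hy.
exact: (allP (rank_set_all rx)).
Qed.

Lemma rank_set_indep xs : rank_set xs -> indep (pts xs) d.
Proof.
move=> rx; have [gp sz pS] := rx; rewrite /indep dg_pts //.
have [|//|[ys [sub lt le]]] := @pts_dependent d xs; first by case: gp.
have : (r <= size ys)%N.
  apply: hr => [|f hf_ /(le f hf_)]; last exact: pS.
  by apply/allP => y /sub hy; exact: (allP (rank_set_all rx)).
by move: lt; rewrite sz ltnNge => /negP.
Qed.

Definition off L xs := [seq x <- xs | x \notin L].
Definition on L xs := [seq x <- xs | x \in L].

Lemma size_on_off L xs : (size (on L xs) + size (off L xs) = size xs)%N.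
Proof. by rewrite !size_filter count_predC. Qed.

Lemma off_disjoint L xs : inter (pts (off L xs)) (linear_subspace L) 1.
Proof. by apply: pts_disjoint_lin => x; rewrite mem_filter => /andP[]. Qed.

Lemma gen_pos_filter (Q : pred V) xs : gen_pos xs -> gen_pos (filter Q xs).
Proof.
move=> [us nz gp]; split; first exact: filter_uniq.
  by move=> x; rewrite mem_filter => /andP[_ /nz].
by move=> x y; rewrite !mem_filter => /andP[_ hx] /andP[_ hy]; exact: gp.
Qed.

Section Residual.
Variables (A : subscheme K m) (L : {vspace V}) (xs : seq V).
Hypotheses (nz : forall x, x \in xs -> x != 0) (L0 : L != 0%VS).
Hypothesis hA : forall h, h \is 1.-homog -> linear_subspace L h ->
  forall p, A (h * p) <-> pts xs (h * p).

(** At a point of [xs] off L some linear form vanishing on L is nonzero, and dividing by its value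
    there gives f = 0. *)
Lemma off_of_residual f :
  (forall h, h \is 1.-homog -> linear_subspace L h -> A (h * f)) -> pts (off L xs) f.
Proof.
move=> h; apply/ideal_comp => e; have hf_ := pihomogP mdeg e f.
apply/(ptsP _ hf_) => x; rewrite mem_filter => /andP[/cocoord_notin[i hi] hx] x0.
set u := cocoord L i in hi; have hu := lform_homog u.
have uL : linear_subspace L (lform u) by apply: lin_lform => y; exact: cocoord_mem.
have := ideal_homog (1 + e) (iffLR (hA hu uL f) (h _ hu uL)).
rewrite (pihomog_mull _ _ hu) => /(ptsP _ (dhomogM hu hf_))/(_ x hx x0)/eqP.
by rewrite mevalM lform_eval mulf_eq0 (negPf hi) => /eqP.
Qed.

(** Together with [off_of_residual] this characterizes the points off L by the products with the
    linear forms of L alone, and it is the product condition required by [split_along]. *)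
Lemma residual_of_off f g : pts (off L xs) f -> linear_subspace L g -> A (g * f).
Proof.
move=> Tf Lg; rewrite (mpoly_sum_homog (leqnn (msize f))) mulr_sumr.
apply: ideal_sum => i _; have hf_ := pihomogP mdeg i f.
rewrite mulrC; apply: (lin_gen1 (colon_ideal hf_ (subscheme_ideal A)) L0 _ Lg) => h hh Lh.
rewrite /colon_pred mulrC; apply/hA => //; apply/(ptsP _ (dhomogM hh hf_)) => x hx x0.
rewrite mevalM; have [xL|xL] := boolP (x \in L).
  by move/(zclosure_homogP _ hh): Lh => ->; rewrite ?mul0r.
have /(ptsP _ hf_) -> := ideal_homog i Tf; rewrite ?mulr0 //.
by rewrite mem_filter xL.
Qed.

Lemma off_le : subscheme_le (pts (off L xs)) A.
Proof. by move=> p Ap; apply: off_of_residual => h _ _; exact: ideal_mul. Qed.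

Lemma residual_split : A = union (inter A (linear_subspace L)) (pts (off L xs)).
Proof.
apply: split_along; [exact: off_le | exact: residual_of_off | exact: off_disjoint].
Qed.

End Residual.

Definition rich_line W xs L := \dim L = 2%N /\
  (d + 2 <= dg (inter (union W (pts xs)) (linear_subspace L)))%N.

Lemma dimL0 L : \dim L = 2%N -> L != 0%VS.
Proof. by move=> dL; rewrite -dimv_eq0 dL. Qed.

Lemma dg_union_le A B : fin A -> fin B -> (dg (union A B) <= dg A + dg B)%N.
Proof. by move=> fA fB; rewrite -dg_inter_sum // leq_addr. Qed.

Lemma border_indep W : border_scheme W -> indep W d.
Proof. by move=> [fW _ dW]; apply: indepS => //; move: dW lt_br sum_br; lia. Qed.

Lemma rich_residual W xs L : border_scheme W -> minimal (phi P) d W -> rank_set xs ->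
  rich_line W xs L ->
  forall h, h \is 1.-homog -> linear_subspace L h -> forall p, W (h * p) <-> pts xs (h * p).
Proof.
move=> bW mW rx [dL rich]; have [fW pW dW] := bW; have [gp sz pS] := rx.
have iW := border_indep bW; have iS := rank_set_indep rx.
have mS := rank_set_minimal rx.
have dU : (dg (union W (pts xs)) <= 2 * d + 1)%N.
  apply: leq_trans (dg_union_le fW (fin_pts xs)) _.
  by rewrite (dg_pts gp) sz; move: dW sum_br; lia.
have [d' ed] : exists d', d = d'.+1 by exists d.-1; rewrite prednK // ltnW.
move: (@phiD _ _ _ P) rich dU iW iS mW mS pW pS; move: (phi P) => ph.
rewrite ed => phD rich dU iW iS mW mS pW pS.
exact: (@line_residual _ _ ph d' W (pts xs) L phD fW (fin_pts xs)).
Qed.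

Lemma rich_split W xs L : border_scheme W -> minimal (phi P) d W -> rank_set xs ->
  rich_line W xs L ->
  W = union (inter W (linear_subspace L)) (pts (off L xs)).
Proof.
move=> bW mW rx rL; apply: residual_split; last exact: rich_residual.
by apply: dimL0; case: rL.
Qed.

Lemma pts_split xs L : \dim L = 2%N ->
  pts xs = union (inter (pts xs) (linear_subspace L)) (pts (off L xs)).
Proof. by move=> dL; apply: residual_split => //; exact: dimL0. Qed.

Lemma inter_pts_lin xs L : \dim L = 2%N ->
  inter (pts xs) (linear_subspace L) = pts (on L xs).
Proof.
move=> dL; apply: subscheme_ext => p; split.
  apply: inter_min; apply: le_homog => t f hf_.
    by move=> /(ptsP _ hf_) h; apply/(ptsP _ hf_) => x; rewrite mem_filter => /andP[_ /h].
  move=> /(zclosure_homogP _ hf_) h; apply/(ptsP _ hf_) => x.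
  by rewrite mem_filter => /andP[xL _] x0; exact: h.
have e : pts xs = union (pts (on L xs)) (pts (off L xs)).
  apply: subscheme_ext => q; split; [|move=> [q1 q2]; apply/ideal_comp => e].
    move=> h; split; move: q h; apply: le_homog => t f hf_ /(ptsP _ hf_) h;
      by apply/(ptsP _ hf_) => x; rewrite mem_filter => /andP[_ /h].
  have hq := pihomogP mdeg e q; apply/(ptsP _ hq) => x hx x0.
  have [xL|xL] := boolP (x \in L).
    by have /(ptsP _ hq) -> := ideal_homog e q1; rewrite // mem_filter xL.
  by have /(ptsP _ hq) -> := ideal_homog e q2; rewrite // mem_filter xL.
rewrite e inter_union_disjoint //; last exact: off_disjoint.
apply: le_homog => t f hf_ /(zclosure_homogP _ hf_) h; apply/(ptsP _ hf_) => x.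
by rewrite mem_filter => /andP[xL _] x0; exact: h.
Qed.

Lemma rich_exists W xs : border_scheme W -> minimal (phi P) d W -> rank_set xs ->
  exists L, rich_line W xs L.
Proof.
move=> bW mW rx; have [fW pW dW] := bW; have [gp sz pS] := rx.
have fU := fin_union fW (fin_pts xs).
have [||L dL hL] := @line_of_dependence _ _ d (union W (pts xs)) fU.
- apply: leq_trans (dg_union_le fW (fin_pts xs)) _.
  by rewrite (dg_pts gp) sz; move: dW sum_br; lia.
- rewrite ltn_neqAle hf_le_dg // andbT; apply/eqP => iU.
  have e : W = pts xs.
    apply: (minimal_unique (@phiD _ _ _ P) fW (fin_pts xs) iU) => //.
    exact: rank_set_minimal.
  by move: dW; rewrite e (dg_pts gp) sz leqNgt lt_br.
by exists L.
Qed.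

Lemma minimal_sub W : fin W -> perp (phi P) d W ->
  exists W', [/\ subscheme_le W' W, perp (phi P) d W' & minimal (phi P) d W'].
Proof.
move=> fW pW.
have [|k [W' [le pW' <-]] hk] := @nat_min (fun k =>
    exists W', [/\ subscheme_le W' W, perp (phi P) d W' & dg W' = k]).
  by exists (dg W), W; split.
exists W'; split=> // X leX pX; apply/esym/dg_eq => //; first exact: fin_sub fW.
by apply: hk; exists X; split=> // p /le; exact: leX.
Qed.

(** The splitting is available only for a minimal scheme, so it is applied to a minimal W' inside W.
    Smoothing its part on L gives b <= dg W' <= dg W <= b, hence W' = W. *)
Lemma border_min W xs : border_scheme W -> rank_set xs -> dg W = b /\ minimal (phi P) d W.
Proof.
move=> [fW pW dW] rx; have [W' [le pW' mW']] := minimal_sub fW pW.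
have fW' := fin_sub le fW; have dle := dg_le le fW.
have bW' : border_scheme W' by split=> //; exact: leq_trans dW.
have [L rL] := rich_exists bW' mW' rx; have [dL _] := rL.
have e := rich_split bW' mW' rx rL.
set A := inter W' _ in e; have fA : fin A := fin_interl _ fW'.
have sT : dg (pts (off L xs)) = size (off L xs).
  by apply/dg_pts/gen_pos_filter; case: rx.
have dis : inter A (pts (off L xs)) 1.
  have : inter (pts (off L xs)) (linear_subspace L) 1 := off_disjoint L xs.
  apply: inter_min; first exact: inter_ler.
  by move=> q Lq; apply/interl/interr.
have dW'E : dg W' = (dg A + size (off L xs))%N.
  by rewrite e dg_union_disjoint ?sT //; exact: fin_pts.
have hbW : (b <= dg W')%N.
  rewrite dW'E; apply: hb; apply: (smoothing_scheme charK dL fA) => //.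
  - exact: inter_ler.
  - by move: dW'E dle dW lt_br sum_br; lia.
  - by apply/allP => x; rewrite mem_filter => /andP[_ hx]; exact: (allP (rank_set_all rx)).
  - by rewrite -e.
have dWb : dg W = b by move: hbW dle dW; lia.
have eW : W = W' by apply: dg_eq => //; rewrite dWb.
by rewrite eW in dWb *.
Qed.

(** The degrees of [A] and of the points on L add up to those of their union, at least d + 2, and of
    their intersection; the rank bound caps the sum at d + 2. So the intersection is empty. *)
Lemma rich_numbers W xs L (A := inter W (linear_subspace L)) :
  border_scheme W -> rank_set xs -> rich_line W xs L ->
  [/\ (dg A + size (off L xs) = b)%N, (size (on L xs) + size (off L xs) = r)%N,
      (dg A + size (on L xs) = d + 2)%N & inter A (pts (on L xs)) 1].
Proof.
move=> bW rx rL; have [dWb mW] := border_min bW rx.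
have [fW pW dW] := bW; have [gp sz pS] := rx; have [dL rich] := rL.
have e := rich_split bW mW rx rL; rewrite -/A in e.
have fA : fin A := fin_interl _ fW.
have leA : subscheme_le A (linear_subspace L) by exact: inter_ler.
have sT : dg (pts (off L xs)) = size (off L xs) by exact/dg_pts/gen_pos_filter.
have sS : dg (pts (on L xs)) = size (on L xs) by exact/dg_pts/gen_pos_filter.
have dis : inter A (pts (off L xs)) 1.
  have : inter (pts (off L xs)) (linear_subspace L) 1 := off_disjoint L xs.
  by apply: inter_min; [exact: inter_ler | move=> q Lq; apply/interl/leA].
have dWE : (dg A + size (off L xs) = b)%N.
  by rewrite -dWb e dg_union_disjoint ?sT //; exact: fin_pts.
have nzT : all (fun x => x != 0) (off L xs).
  by apply/allP => x; rewrite mem_filter => /andP[_ hx]; exact: (allP (rank_set_all rx)).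
have pU : perp (phi P) d (union A (pts (off L xs))) by rewrite -e.
(* Otherwise the points off L, fewer than r, would already span P. *)
have A0 : (0 < dg A)%N.
  rewrite lt0n; apply/eqP => A0; have A1 := iffLR (dg0P fA) A0.
  have : (r <= size (off L xs))%N.
    apply: hr => // f hf_ Tf; apply: pU => //; split=> //.
    by rewrite -[f]mulr1; exact: ideal_mul.
  by move: dWE A0 lt_br; lia.
have Ad : (dg A <= d)%N by move: dWE lt_br sum_br; lia.
have [||z2 [ys [nzY sY pY]]] := rank_bound charK dL fA leA nzT pU P0 _ d2.
- by rewrite A0.
- by move=> s /hb; rewrite dWE.
have hs := size_on_off L xs; rewrite sz in hs.
have := hr nzY pY; rewrite sY => hrY.
have eU : inter (union W (pts xs)) (linear_subspace L) = union A (pts (on L xs)).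
  rewrite {1}e {1}(pts_split xs dL) union_meet inter_union_disjoint //.
  - by rewrite inter_pts_lin.
  - by move=> q Lq; split; [exact: leA | exact: interr].
  - exact: off_disjoint.
have := dg_inter_sum fA (fin_pts (on L xs)); rewrite -eU sS => dI.
have ar (D I z s o : nat) : (D + I)%N = (z + s)%N -> (d + 2 <= D)%N ->
    (r <= d + 2 - z + o)%N -> (s + o)%N = r -> (2 * z <= d + 2)%N -> (z <= d)%N ->
    I = 0%N /\ (z + s = d + 2)%N by clear; lia.
have [I0 e3] := ar _ _ _ _ _ dI rich hrY hs z2 Ad.
by split=> //; exact: (iffLR (dg0P (fin_interl _ fA))).
Qed.

Lemma lines_meet L L' x y : \dim L = 2%N -> \dim L' = 2%N -> L != L' ->
  x \in L -> x \in L' -> y \in L -> y \in L' -> y != 0 -> x \in <[y]>%VS.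
Proof.
move=> dL dL' ne xL xL' yL yL' y0.
have dI : (\dim (L :&: L') <= 1)%N.
  rewrite leqNgt; apply: contra ne => dI.
  have e1 : (L :&: L')%VS = L by apply/eqP; rewrite eqEdim capvSl dL.
  have e2 : (L :&: L')%VS = L' by apply/eqP; rewrite eqEdim capvSr dL'.
  by apply/eqP; exact: etrans (esym e1) e2.
have -> : <[y]>%VS = (L :&: L')%VS.
  by apply/eqP; rewrite eqEdim -memvE memv_cap yL yL' dim_vline y0.
by rewrite memv_cap xL.
Qed.

(** Both lines carry s points, since b + r = d + 2 + 2o determines o. Two distinct lines share at
    most one point of [xs], so s <= o + 1; but 2s > d + 2 by b < r, and 2o <= d - 1. *)
Lemma rich_unique W W' xs L L' : border_scheme W -> border_scheme W' -> rank_set xs ->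
  rich_line W xs L -> rich_line W' xs L' -> L = L'.
Proof.
move=> bW bW' rx rL rL'; apply/eqP; apply: contraT => ne.
have [e1 e2 e3 _] := rich_numbers bW rx rL.
have [e1' e2' e3' _] := rich_numbers bW' rx rL'.
have [dL _] := rL; have [dL' _] := rL'; have [[us nz gp] sz _] := rx.
have le : (size (on L' xs) <= (size (off L xs)).+1)%N.
  have ar (i j k l : nat) : (i + j)%N = k -> (j <= l)%N -> (i <= 1)%N -> (k <= l.+1)%N.
    by clear; lia.
  apply: ar (size_on_off L (on L' xs)) _ _.
    rewrite /off /on -filter_predI !size_filter; apply: sub_count => x /=.
    by case/andP.
  case E : (on L (on L' xs)) => [|x [|y s]] //.
  have h z : z \in [:: x, y & s] -> [/\ z \in L, z \in L' & z \in xs].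
    by rewrite -E !mem_filter => /and3P[].
  have [xL xL' hx] := h x (mem_head _ _).
  have [|yL yL' hy] := h y; first by rewrite !inE eqxx orbT.
  have exy := gp x y hx hy (lines_meet dL dL' ne xL xL' yL yL' (nz y hy)).
  have : uniq (on L (on L' xs)) by rewrite !filter_uniq.
  by rewrite E exy /= mem_head.
by move: e1 e2 e3 e1' e2' e3' lt_br sum_br le; clear; lia.
Qed.

(** A hyperplane through L that avoids [ts] separates the two parts: degree at most d + 1 on a line
    is independent in degree d, and at most d points are independent in degree d - 1. *)
Lemma line_union_indep A L ts : \dim L = 2%N -> fin A -> subscheme_le A (linear_subspace L) ->
  gen_pos ts -> (forall x, x \in ts -> x \notin L) -> (dg A <= d.+1)%N -> (size ts <= d)%N ->
  indep (union A (pts ts)) d.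
Proof.
move=> dL fA leA gp off_ hA hT; set Y := union A (pts ts).
have fY : fin Y := fin_union fA (fin_pts ts).
have [u [uL hu]] := lform_avoid_lin off_; have hh := lform_homog u.
have Lu : linear_subspace L (lform u) := lin_lform uL.
have [d' ed] : exists d', d = d'.+1 by exists d.-1; rewrite prednK // ltnW.
apply/eqP; rewrite /indep eqn_leq hf_le_dg //=.
apply: leq_trans (dg_union_le fA (fin_pts ts)) _; rewrite (dg_pts gp).
have := hf_trace Y hh d'; rewrite add1n -ed; apply: leq_trans; apply: leq_add.
  rewrite -(hf_dg fA hA); apply: hf_le => // f _.
  apply: trace_min; first by move=> q [].
  exact: leA.
rewrite -(@hf_pts _ _ ts d' gp) -?ed //; apply: hf_le => // f hf_ [_ Tf].
apply/(ptsP _ hf_) => x hx x0; move/(ptsP _ (dhomogM hh hf_)): Tf => /(_ x hx x0)/eqP.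
by rewrite mevalM lform_eval mulf_eq0 (negPf (hu x hx)) => /eqP.
Qed.

(** Both schemes have the same line and the same points off it, and their parts on it have degree at
    most (d + 1)/2. So their union imposes independent conditions, and [minimal_unique] applies. *)
Lemma border_unique W W' xs : border_scheme W -> border_scheme W' -> rank_set xs -> W = W'.
Proof.
move=> bW bW' rx; have [dWb mW] := border_min bW rx; have [dWb' mW'] := border_min bW' rx.
have [L rL] := rich_exists bW mW rx; have [L' rL'] := rich_exists bW' mW' rx.
have eL := rich_unique bW bW' rx rL rL'; subst L'; have [dL _] := rL.
have [e1 e2 e3 _] := rich_numbers bW rx rL.
have [e1' e2' e3' _] := rich_numbers bW' rx rL'.
have [fW pW _] := bW; have [fW' pW' _] := bW'; have [gp _ _] := rx.
apply: (minimal_unique (@phiD _ _ _ P) fW fW' _ pW pW' mW mW').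
rewrite {1}(rich_split bW mW rx rL) {1}(rich_split bW' mW' rx rL') union_meet.
have fA := fin_interl (linear_subspace L) fW; have fA' := fin_interl (linear_subspace L) fW'.
apply: (line_union_indep dL) => //.
- exact: fin_union.
- by move=> q Lq; split; exact: interr.
- exact: gen_pos_filter.
- by move=> x; rewrite mem_filter => /andP[].
- apply: leq_trans (dg_union_le fA fA') _.
  by move: e1 e2 e3 e1' e2' e3' lt_br sum_br; clear; lia.
have hbd : (b <= d)%N by move: lt_br sum_br; clear; lia.
by apply: leq_trans hbd; rewrite -e1 leq_addl.
Qed.

(** The support of such a W would span P, so it would have at least r points, more than the degree b
    allows. *)
Lemma border_not_pts W ws : border_scheme W -> W = pts ws -> False.
Proof.
move=> [fW pW dW] e; have [vs [gp hv cover]] := finite_support fW.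
have : (r <= size vs)%N.
  apply: hr; first by case: gp => _ nz _; apply/allP.
  move=> f hf_ /(ptsP _ hf_) f0; apply: pW => //; rewrite e; apply/(ptsP _ hf_) => w hw w0.
  have [|v hv' /vlineP[c ->]] := cover w w0.
    rewrite e; apply: le_homog => t g hg /(ptsP _ hg) h; apply/(ptP w0 hg); exact: h.
  rewrite (eval_scale _ _ hf_) f0 ?mulr0 //; by case: gp => _ nz _; exact: nz.
have : (size vs <= dg W)%N.
  rewrite -(dg_pts gp); apply: dg_le => //.
  apply: le_homog => t g hg Wg; apply/(ptsP _ hg) => v hv' v0.
  exact/(ptP v0 hg)/(hv v hv').
by move: dW lt_br; lia.
Qed.

(** The union of two distinct lines imposes at least 3 linear conditions, so the sum of their ideals
    leaves at most 2 + 2 - 3 = 1, which also bounds hf A 1. *)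
Lemma lines_trace A L L' : \dim L = 2%N -> \dim L' = 2%N -> L != L' -> fin A ->
  subscheme_le A (linear_subspace L) -> subscheme_le A (linear_subspace L') -> (dg A <= 1)%N.
Proof.
move=> dL dL' ne fA hL hL'.
have hcap : (3 <= hf (union (linear_subspace L) (linear_subspace L')) 1)%N.
  rewrite ltnNge; apply: contra ne => le.
  have h1 : le_in_degree 1 (linear_subspace L) (union (linear_subspace L) (linear_subspace L')).
    apply: hf_le_eq => //; last by rewrite hf_lin1 dL.
    by move=> f _ [].
  suff : (L' <= L)%VS by move=> s; rewrite eq_sym eqEdim s dL dL'.
  apply/subvP => x xL'; apply: contraT => /cocoord_notin[i /negP[]].
  have [_ hx] := h1 _ (lform_homog (cocoord L i)) (lin_lform (@cocoord_mem _ _ L i)).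
  by apply/eqP; exact: (lin_lformE hx).
have sL := subscheme_submod (linear_subspace L).
have sL' := subscheme_submod (linear_subspace L').
have := hf_add_cap 1 sL sL'.
rewrite -[hf (cap_pred _ _) 1]/(hf (union (linear_subspace L) (linear_subspace L')) 1).
rewrite !hf_lin1 dL dL'.
have : (hf A 1 <= hf (add_pred (linear_subspace L) (linear_subspace L')) 1)%N.
  apply: (hf_le (add_submod sL sL') (subscheme_submod A)).
  by move=> f _ [p [q [hp hq ->]]]; apply: ideal_add; [exact: hL | exact: hL'].
have := hf_ge 1 fA; move: hcap; rewrite /minn; case: ifP; lia.
Qed.

Lemma dg1_pt A : fin A -> dg A = 1%N -> exists2 x, x != 0 & A = pt x.
Proof.
move=> fA d1; have [N0 hN] := fA.
have [|k [f [x [hf_ [x0 ex]]]]] := assoc_point hN; first by move/(dg0P fA); rewrite d1.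
exists x => //; apply: dg_eq => //; last by rewrite d1 dg_pt.
by move=> q Aq; rewrite -ex; exact: colon_le.
Qed.

(* If L and L' differed, W would be reduced: its residuals with respect to both lines are reduced,
   and W meets the intersection of the lines in at most a reduced point. *)
Lemma rich_determined W xs xs' L L' : border_scheme W -> rank_set xs -> rank_set xs' ->
  rich_line W xs L -> rich_line W xs' L' -> L = L' /\ pts (off L xs) = pts (off L' xs').
Proof.
move=> bW rx rx' rL rL'.
have [dWb mW] := border_min bW rx; have [fW pW _] := bW.
have [dL _] := rL; have [dL' _] := rL'.
have hW := rich_residual bW mW rx rL; have hW' := rich_residual bW mW rx' rL'.
have [eL|ne] := eqVneq L L'.
  split=> //; apply: subscheme_ext => p; split=> hp.
    apply: (off_of_residual hW') => h hh Lh; apply: (residual_of_off (dimL0 dL) hW) => //.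
    by rewrite eL.
  apply: (off_of_residual hW) => h hh Lh; apply: (residual_of_off (dimL0 dL') hW') => //.
  by rewrite -eL.
exfalso; pose B := inter (linear_subspace L) (linear_subspace L').
pose ws := off L xs ++ off L' xs'.
have nzx := allP (rank_set_all rx); have nzx' := allP (rank_set_all rx').
have eT : pts ws = union (pts (off L xs)) (pts (off L' xs')).
  apply: subscheme_ext => q; split; [|move=> [q1 q2]; apply/ideal_comp => e].
    move=> h; split; move: q h; apply: le_homog => t f hf_ /(ptsP _ hf_) h;
      by apply/(ptsP _ hf_) => x hx x0; apply: h; rewrite // mem_cat hx ?orbT.
  have hq := pihomogP mdeg e q; apply/(ptsP _ hq) => x; rewrite mem_cat => /orP[hx|hx] x0.
    by have /(ptsP _ hq) -> := ideal_homog e q1.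
  by have /(ptsP _ hq) -> := ideal_homog e q2.
(* For f vanishing at all points off either line, f times the ideal of L and f times the ideal of L'
   both lie in the ideal of W, hence f times the ideal of B does. *)
have eW : W = union (inter W B) (pts ws).
  apply: split_along.
  - by move=> q Wq; rewrite eT; split; [exact: (off_le hW) | exact: (off_le hW')].
  - move=> f g; rewrite eT => -[Tf Tf'] [k hk]; apply: (@sat_mono _ _ W k) => mu hmu.
    have [|a [c [La Lc e]]] := hk mu; first by rewrite hmu.
    rewrite mulrA e mulrDl; apply: ideal_add.
      exact: (residual_of_off (dimL0 dL) hW).
    exact: (residual_of_off (dimL0 dL') hW').
  apply: pts_disjoint => x; rewrite mem_cat !mem_filter => hx x0 le.
  case/orP: hx => /andP[/negP nL _]; apply: nL; apply/pt_le_lin => // q Lq; apply: le.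
    exact: interl.
  exact: interr.
have fE := fin_interl B fW.
have : (dg (inter W B) <= 1)%N.
  apply: (lines_trace dL dL' ne fE) => q Lq; apply: interr; [exact: interl | exact: interr].
rewrite leq_eqVlt ltnS leqn0 => /orP[/eqP d1|/eqP d0].
  have [o o0 eo] := dg1_pt fE d1.
  apply: (border_not_pts (ws := o :: ws) bW); rewrite eW eo.
  apply: subscheme_ext => q; split=> [[q1 q2]|hq].
    apply/ideal_comp => e; have hq := pihomogP mdeg e q; apply/(pts_cons _ hq o0); split.
      exact/(ptP o0 hq)/ideal_homog.
    exact: ideal_homog.
  split; apply/ideal_comp => e; have hqe := pihomogP mdeg e q;
    have [qo qw] := iffLR (pts_cons _ hqe o0) (ideal_homog e hq) => //.
  exact/(ptP o0 hqe).
apply: (border_not_pts (ws := ws) bW); rewrite {1}eW.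
apply: subscheme_ext => q; split=> [[]//|hq]; split=> //.
by rewrite -[q]mulr1; apply/ideal_mul/(dg0P fE).
Qed.

(** Identifies the set S2 of the theorem with the points of S off the line, which is the form in
    which the splittings were proved. *)
Lemma diff_off W xs L : border_scheme W -> rank_set xs -> rich_line W xs L ->
  diff (inter (pts xs) W) (inter (pts xs) (linear_subspace L)) = pts (off L xs).
Proof.
move=> bW rx rL; have [dL _] := rL; have [dWb mW] := border_min bW rx.
have hW := rich_residual bW mW rx rL.
apply: subscheme_ext => p; split=> hp.
  apply/ideal_comp => e; have hpe := pihomogP mdeg e p; apply/(ptsP _ hpe) => x hx x0.
  have := hx; rewrite mem_filter => /andP[/cocoord_notin[i hi] _].
  set u := cocoord L i in hi; have hu := lform_homog u.
  have uL : linear_subspace L (lform u) by apply: lin_lform => y; exact: cocoord_mem.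
  have [|k hk] := ideal_homog e hp 1%N _ hu; first exact: interr.
  have hku := dhomogMn k hu.
  have : pts (off L xs) (lform u ^+ k * pihomog mdeg e p).
    apply: inter_min hk; last exact: (off_le hW).
    by move=> q Sq; move: Sq; rewrite {1}(pts_split xs dL) => -[].
  move=> /(ptsP _ (dhomogM hku hpe))/(_ x hx x0)/eqP.
  by rewrite mevalM rmorphXn /= lform_eval mulf_eq0 expf_eq0 (negPf hi) andbF => /eqP.
move=> e q hq Sq; exists 1%N; rewrite expr1; apply: interl.
by rewrite (pts_split xs dL); split; [exact: ideal_mulr | exact: ideal_mul].
Qed.

End OnPoint.

End Core.

(** By saturation f is determined modulo the ideal by the products X_i f. This bounds the Hilbert
    function in degrees not divisible by d, which the Veronese embedding does not see. *)
Lemma hf_succ (K : closedFieldType) (n : nat) (A : subscheme K n) t :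
  (hf A t <= n.+1 * hf A t.+1)%N.
Proof.
pose J j (f : {mpoly K[n.+1]}) := forall i : 'I_n.+1, (i < j)%N -> A ('X_i * f).
have hJ j : homog_ideal (J j).
  apply: homog_idealP.
  - by move=> i _; rewrite mulr0; exact: ideal_zero.
  - by move=> p q hp hq i hi; rewrite mulrDr; apply: ideal_add; [exact: hp | exact: hq].
  - by move=> f p hp i hi; rewrite mulrCA; apply/ideal_mul/hp.
  - move=> e p hp i hi; rewrite -(pihomog_mull _ _ (homog_mpolyU K i)).
    exact/ideal_homog/hp.
have H j : (j <= n.+1)%N -> (hf (J j) t <= j * hf A t.+1)%N.
  elim: j => [|j IH] hj.
    rewrite mul0n leqn0; apply/eqP/(hf0P _ (hi_submod (hJ 0%N))) => f _ i.
    by rewrite ltn0.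
  pose x := Ordinal hj; pose C := colon A (homog_mpolyU K x).
  have hC : (hf C t <= hf A t.+1)%N.
    by have := hf_trace A (homog_mpolyU K x) t; rewrite add1n -/C; lia.
  have sJ := hi_submod (hJ j); have sC := subscheme_submod C.
  have hcap := hf_add_cap t sJ sC.
  have hle : (hf (J j.+1) t <= hf (cap_pred (J j) C) t)%N.
    apply: (hf_le (cap_submod sJ sC) (hi_submod (hJ j.+1))) => f _ [h1 h2] i.
    rewrite ltnS leq_eqVlt => /orP[/eqP e|]; last exact: h1.
    by have -> : i = x by exact: val_inj.
  have := IH (ltnW hj); rewrite mulSn; move: hcap hle hC; lia.
apply: leq_trans (H n.+1 (leqnn _)); apply: (hf_le (hi_submod (hJ _))) => // f _ h.
by apply: ideal_sat => i; exact: h.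
Qed.

Lemma mnm_split (n : nat) k (mu : 'X_{1..n.+1}) : (k <= mdeg mu)%N ->
  exists mu' nu, mdeg mu' = k /\ mu = (mu' + nu)%MM.
Proof.
elim: k => [|k IH] h.
  by exists 0%MM, mu; rewrite mdeg0 add0m.
have [mu' [nu [h1 e]]] := IH (ltnW h).
case E : (mdeg nu) => [|l].
  by move: h; rewrite e mdegD h1 E addn0 ltnn.
have [i [nu' [_ e']]] := X_split E.
exists (mu' + U_(i))%MM, nu'; split; last by rewrite e e' addmA.
by rewrite mdegD h1 mdeg1 addn1.
Qed.

Lemma homog0P (K : fieldType) (n : nat) (f : {mpoly K[n.+1]}) :
  f \is 0.-homog -> f = (f@_0)%:MP.
Proof.
move=> hf_; apply/mpolyP => mu; rewrite mcoeffC; case: eqVneq => [->|ne].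
  by rewrite mulr1.
by rewrite mulr0 (dhomog_nemf_coeff hf_) //= mdeg_eq0.
Qed.

(** * The Veronese embedding on subschemes *)

Section Transfer.
Variables (K : closedFieldType) (m d : nat).
Hypothesis d0 : (0 < d)%N.
Local Notation N := (veronese_dim m d).
Local Notation vm := (@veronese_mnm m d).
Local Notation R := {mpoly K[m.+1]}.
Local Notation S := {mpoly K[N.+1]}.
Implicit Types (A B W : subscheme K m) (Z : subscheme K N) (f g : R) (p q : S).

Definition vmap q : R := q \mPo [tuple 'X_[vm i] | i < N.+1].

Lemma vmapD p q : vmap (p + q) = vmap p + vmap q.
Proof. exact: comp_mpolyD. Qed.

Lemma vmapB p q : vmap (p - q) = vmap p - vmap q.
Proof. exact: comp_mpolyB. Qed.

Lemma vmapZ c p : vmap (c *: p) = c *: vmap p.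
Proof. exact: comp_mpolyZ. Qed.

Lemma vmapM p q : vmap (p * q) = vmap p * vmap q.
Proof. exact: rmorphM. Qed.

Lemma vmap1 : vmap 1 = 1. Proof. exact: comp_mpoly1. Qed.

Lemma vmap0 : vmap 0 = 0. Proof. exact: comp_mpoly0. Qed.

Lemma vmapU i : vmap 'X_i = 'X_[vm i].
Proof. by rewrite /vmap comp_mpolyXU -tnth_nth tnth_mktuple. Qed.

Lemma vmapXn p k : vmap (p ^+ k) = vmap p ^+ k.
Proof. by elim: k => [|k IH]; rewrite ?vmap1 // !exprS vmapM IH. Qed.

Lemma vmap_sum (I : Type) (r : seq I) (F : I -> S) :
  vmap (\sum_(i <- r) F i) = \sum_(i <- r) vmap (F i).
Proof. by elim: r => [|i r IH]; rewrite ?big_nil ?big_cons ?vmap0 ?vmapD ?IH. Qed.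

Lemma vmap_eval q (x : 'rV[K]_m.+1) : (vmap q).@[x 0] = q.@[(veronese d x) 0].
Proof.
rewrite /vmap comp_mpoly_meval; apply: meval_eq => i.
by rewrite tnth_mktuple mxE.
Qed.

Lemma vmap_homog t q : q \is t.-homog -> vmap q \is (d * t).-homog.
Proof.
elim: t q => [|t IH] q hq.
  rewrite (homog0P hq) /vmap comp_mpolyC muln0.
  by rewrite -[_%:MP]mulr1 mul_mpolyC; apply: rpredZ; exact: dhomog1.
have [g [hg ->]] := homogS_sum hq; rewrite vmap_sum; apply: rpred_sum => i _.
by rewrite vmapM vmapU mulnS; apply: dhomogM (IH _ (hg i)); exact: vmX_homog.
Qed.

Lemma vmap_pihomog t q : vmap (pihomog mdeg t q) = pihomog mdeg (d * t) (vmap q).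
Proof.
set k := maxn (msize q) t.+1.
have hk : (msize q <= k)%N by exact: leq_maxl.
rewrite [in RHS](mpoly_sum_homog hk) vmap_sum linear_sum /=.
have ht : (t < k)%N by exact: leq_maxr.
rewrite (bigD1 (Ordinal ht)) //= (pihomog_dE (vmap_homog (pihomogP mdeg t q))).
rewrite big1 ?addr0 // => j jt.
by apply: pihomog_ne0 (vmap_homog (pihomogP _ _ _)); rewrite eqn_pmul2l.
Qed.

Lemma vmap_pihomog0 e q : ~~ (d %| e)%N -> pihomog mdeg e (vmap q) = 0.
Proof.
move=> he; rewrite (mpoly_sum_homog (leqnn (msize q))) vmap_sum linear_sum big1 //= => j _.
apply: pihomog_ne0 (vmap_homog (pihomogP _ _ _)).
by apply: contraNneq he => <-; exact: dvdn_mulr.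
Qed.

Lemma vmap_surj t g : g \is (d * t).-homog -> exists2 q, q \is t.-homog & vmap q = g.
Proof.
move=> hg; have hs := dhomog_mf hg; rewrite (mpolyE g).
have H mu : mdeg mu = (d * t)%N -> exists2 q, q \is t.-homog & vmap q = 'X_[mu].
  elim: t {g hg hs} mu => [|t IH] mu.
    rewrite muln0 => /eqP; rewrite mdeg_eq0 => /eqP ->; exists 1; first exact: dhomog1.
    by rewrite vmap1 mpolyX0.
  rewrite mulnS => hmu.
  have [|mu' [nu [h1 e]]] := @mnm_split m d mu; first by rewrite hmu leq_addr.
  have [i ei] := veronese_mnm_surj h1.
  have [|q hq eq] := IH nu.
    by apply/eqP; rewrite -(eqn_add2l d) -{1}h1 -mdegD -e hmu.
  exists ('X_i * q).
    by have := dhomogM (homog_mpolyU K i) hq; rewrite add1n.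
  by rewrite vmapM vmapU eq e mpolyXD ei.
have : forall mu, mu \in msupp g -> mdeg mu = (d * t)%N by exact: hs.
pose c (mu : 'X_{1..m.+1}) := g@_mu.
rewrite -[\sum_(i <- _) _]/(\sum_(i <- msupp g) c i *: 'X_[i]).
elim: (msupp g) => [|mu s IH] h.
  by exists 0; rewrite ?big_nil ?vmap0 //; exact: rpred0.
have [q hq eq] := IH (fun nu hnu => h nu (mem_behead (s := mu :: s) hnu)).
have [q' hq' eq'] := H mu (h mu (mem_head _ _)).
exists (c mu *: q' + q); first by rewrite rpredD ?rpredZ.
by rewrite big_cons vmapD vmapZ eq eq'.
Qed.

Fact push_ideal W : homog_ideal (fun q => W (vmap q)).
Proof.
apply: homog_idealP.
- by rewrite vmap0; exact: ideal_zero.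
- by move=> p q; rewrite vmapD; exact: ideal_add.
- by move=> p q; rewrite vmapM; exact: ideal_mul.
- by move=> e q; rewrite vmap_pihomog; exact: ideal_homog.
Qed.

Fact push_sat W p : (forall i, W (vmap ('X_i * p))) -> W (vmap p).
Proof.
move=> h; apply: (@sat_mono _ _ W d) => mu hmu.
have [i <-] := veronese_mnm_surj hmu; by rewrite -vmapU -vmapM.
Qed.

(* The image under the Veronese embedding: its ideal is the preimage of the ideal of W. *)
Definition push W : subscheme K N := ideal_scheme (push_ideal W) (@push_sat W).

Lemma pushE W q : push W q = W (vmap q).
Proof. by []. Qed.

(** Only degrees divisible by d occur in the image of [vmap], so each component of f is tested after
    multiplication by the forms that bring it into such a degree. *)
Definition pull_pred Z f := forall e k g, (d %| e + k)%N -> g \is k.-homog ->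
  exists2 q, Z q & vmap q = g * pihomog mdeg e f.

Fact pull_ideal Z : homog_ideal (pull_pred Z).
Proof.
apply: homog_idealP.
- by move=> e k g _ _; exists 0; rewrite ?vmap0 ?linear0 ?mulr0 //; exact: ideal_zero.
- move=> f f' hf_ hf' e k g dv hg.
  have [q Zq eq] := hf_ e k g dv hg; have [q' Zq' eq'] := hf' e k g dv hg.
  by exists (q + q'); [exact: ideal_add | rewrite vmapD eq eq' pihomogD mulrDr].
- move=> f' f hf_ e k g dv hg.
  have -> : pihomog mdeg e (f' * f) = \sum_(j < msize f')
      (if (j <= e)%N then pihomog mdeg j f' * pihomog mdeg (e - j) f else 0).
    rewrite {1}(mpoly_sum_homog (leqnn (msize f'))) mulr_suml linear_sum /=.
    by apply: eq_bigr => j _; exact: (pihomogM _ _ (pihomogP _ _ _)).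
  rewrite mulr_sumr; elim/big_ind: _.
  + by exists 0; rewrite ?vmap0 //; exact: ideal_zero.
  + move=> x y [q Zq <-] [q' Zq' <-]; exists (q + q'); [exact: ideal_add | exact: vmapD].
  move=> j _; case: ifP => je; last first.
    by exists 0; rewrite ?vmap0 ?mulr0 //; exact: ideal_zero.
  rewrite mulrA; apply: (hf_ (e - j)%N (k + j)%N); last exact: dhomogM (pihomogP _ _ _).
  by rewrite [(k + j)%N]addnC addnA subnK.
move=> e f hf_ e' k g dv hg; have [ee|ne] := eqVneq e e'.
  rewrite -ee pihomog_id ee; exact: hf_ dv hg.
rewrite (pihomog_ne0 ne (pihomogP _ _ _)) mulr0.
by exists 0; rewrite ?vmap0 //; exact: ideal_zero.
Qed.

Section Pull.
Variable Z : subscheme K N.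
Hypothesis ZX : subscheme_le Z (veronese_variety K m d).

Lemma vmap_ker q : vmap q = 0 -> Z q.
Proof.
move=> e; apply: ZX => t y _ [x [_ _ ->]].
by rewrite -vmap_eval vmap_pihomog e linear0 meval0.
Qed.

Lemma vmap_eq q q' : vmap q = vmap q' -> Z q -> Z q'.
Proof.
move=> e Zq; rewrite -[q'](subrK q); apply: ideal_add => //.
by apply: vmap_ker; rewrite vmapB e subrr.
Qed.

Fact pull_sat f : (forall i, pull_pred Z ('X_i * f)) -> pull_pred Z f.
Proof.
move=> h e k g dv hg.
have hgf : g * pihomog mdeg e f \is (d * ((e + k) %/ d)).-homog.
  by rewrite mulnC divnK // addnC; apply: dhomogM => //; exact: pihomogP.
have [q hq eq] := vmap_surj hgf; exists q => //.
apply: ideal_sat => j; case E : (mdeg (vm j)) => [|l].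
  by have := d0; rewrite -[X in (0 < X)%N](veronese_mnm_deg j) E.
have [i [nu [hnu ej]]] := X_split E.
have hX : g * 'X_[nu] \is (k + l).-homog.
  by apply: dhomogM => //; rewrite dhomogX; exact/eqP.
have [|q' Zq' eq'] := h i (1 + e)%N (k + l)%N _ _ hX.
  have -> : (1 + e + (k + l) = (e + k) + l.+1)%N by lia.
  by rewrite dvdn_addr // -E veronese_mnm_deg.
apply: vmap_eq Zq'; rewrite eq' vmapM vmapU eq ej mpolyXD.
rewrite (pihomog_mull _ _ (homog_mpolyU K i)) mulrC [g * _]mulrC mulrACA.
by congr (_ * _); exact: mulrC.
Qed.

Definition pull : subscheme K m := ideal_scheme (pull_ideal Z) (@pull_sat).

Lemma push_pull : Z = push pull.
Proof.
apply: subscheme_ext => q; rewrite pushE; split.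
  move=> Zq e k g dv hg; have [de|nde] := boolP (d %| e)%N; last first.
    by rewrite vmap_pihomog0 // mulr0; exists 0; rewrite ?vmap0 //; exact: ideal_zero.
  have dk : (d %| k)%N by rewrite -(dvdn_addr _ de).
  have hg' : g \is (d * (k %/ d)).-homog by rewrite mulnC divnK.
  have [g' hg2 eg] := vmap_surj hg'.
  exists (g' * pihomog mdeg (e %/ d) q); first exact/ideal_mul/ideal_homog.
  by rewrite vmapM eg vmap_pihomog mulnC divnK.
move=> h; apply/ideal_comp => t.
have [|q' Zq' eq'] := h (d * t)%N 0%N 1 _ (dhomog1 _ _); first by rewrite addn0 dvdn_mulr.
by apply: vmap_eq Zq'; rewrite eq' mul1r vmap_pihomog.
Qed.

End Pull.

Lemma veronese_neq0 (x : 'rV[K]_m.+1) : x != 0 -> veronese d x != 0.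
Proof.
move=> /rV0Pn[i xi].
have [|j ej] := @veronese_mnm_surj m d (U_(i) *+ d)%MM; first by rewrite mdegMn mdeg1 mul1n.
apply/rV0Pn; exists j; rewrite mxE ej -mpolyXn rmorphXn /= mevalXU expf_neq0 //.
Qed.

Lemma veronese_image_push (T : 'rV[K]_m.+1 -> Prop) :
  veronese_image d T = push (zariski_closure T).
Proof.
apply: subscheme_ext => q; rewrite pushE; split=> [h e x x0 Tx|h t y _ [x [x0 Tx ->]]].
  have [de|nde] := boolP (d %| e)%N; last by rewrite vmap_pihomog0 // meval0.
  rewrite -(divnK de) mulnC -vmap_pihomog vmap_eval.
  by apply: h; [exact: veronese_neq0 | exists x].
by rewrite -vmap_eval vmap_pihomog; exact: h.
Qed.

Lemma push_mono A B : subscheme_le A B -> subscheme_le (push A) (push B).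
Proof. by move=> h q; rewrite !pushE; exact: h. Qed.

Lemma push_le A : subscheme_le (push A) (veronese_variety K m d).
Proof.
rewrite /veronese_variety veronese_image_push; apply: push_mono => g hg.
have -> : g = 0; last exact: ideal_zero.
have zero_ideal : homog_ideal (fun p : R => p = 0).
  apply: homog_idealP => //.
  + by move=> p q -> ->; rewrite addr0.
  + by move=> f p ->; rewrite mulr0.
  + by move=> e p ->; rewrite linear0.
apply: (lin_gen (L := fullv) zero_ideal).
- by rewrite -dimv_eq0 dim_rowv.
- move=> u hu; have -> : u = 0.
    apply/eqP; apply: contraT => /lform_nz[x]; rewrite dotC hu ?eqxx //; exact: memvf.
  by rewrite /lform big1 // => i _; rewrite mxE scale0r.
by move=> e x x0 _; exact: hg.
Qed.

Lemma push_inj A B : subscheme_le (push A) (push B) -> subscheme_le A B.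
Proof.
move=> h; apply: le_homog => t f hf_ Bf.
apply: (@sat_homog _ _ A (d * t - t)) => g hg.
have tt : (t <= d * t)%N by rewrite leq_pmull.
have hgf : g * f \is (d * t).-homog by rewrite -(subnK tt); exact: dhomogM.
have [q hq eq] := vmap_surj hgf; rewrite -eq -pushE; apply: h.
by rewrite pushE eq; exact: ideal_mul.
Qed.

Lemma hf_push W t : hf (push W) t = hf W (d * t)%N.
Proof.
pose E0 (q : dhomog N.+1 K t) : dhomog m.+1 K (d * t)%N := DHomog (vmap_homog (valP q)).
have E_lin : linear E0.
  by move=> a u v; apply: val_inj; rewrite /= vmapD vmapZ.
pose E1 := GRing.isLinear.Build _ _ _ _ E0 E_lin.
pose E2 : {linear dhomog N.+1 K t -> dhomog m.+1 K (d * t)%N} := HB.pack E0 E1.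
pose E := linfun E2.
have EE (q : dhomog N.+1 K t) : (E q : R) = vmap q by rewrite lfunE.
have eP : deg_part (push W) t = (E @^-1: deg_part W (d * t)%N)%VS.
  apply/vspaceP => q; rewrite -memv_preim.
  apply/idP/idP => [/(deg_partP (subscheme_submod _)) h|/(deg_partP (subscheme_submod _)) h].
    by apply/(deg_partP (subscheme_submod _)); rewrite EE.
  by apply/(deg_partP (subscheme_submod _)); rewrite EE in h.
have full : limg E = fullv.
  apply/vspaceP => g; rewrite memvf; have [q hq eq] := vmap_surj (valP g).
  apply/memv_imgP; exists (DHomog hq); rewrite ?memvf //.
  by apply: val_inj; rewrite -[RHS]/(E _ : R) EE.
have := @dim_sum_img _ _ _ E (deg_part W (d * t)%N) fullv (subvf _).
rewrite full addvf -eP.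
have := hf_dim (push W) t; have := hf_dim W (d * t)%N.
rewrite /reverse_coercion => h1 h2 h3.
have ar (x y z u v w : nat) : (x + y = z)%N -> (u + v = w)%N -> (z + v = y + w)%N -> u = x.
  by clear; lia.
exact: ar h1 h2 h3.
Qed.

Lemma fin_push W : fin W -> fin (push W).
Proof.
move=> [B [t0 ht]]; exists B, t0 => t h; rewrite hf_push; apply: ht.
by apply: leq_trans h _; rewrite leq_pmull.
Qed.

(** From a degree e one climbs to the next multiple of d in at most d steps, each costing at most a
    factor m + 1 by [hf_succ]. *)
Lemma fin_of_push W : fin (push W) -> fin W.
Proof.
move=> [B [t0 ht]]; exists (m.+1 ^ d * B)%N, (d * t0)%N => e he.
have H k : (hf W e <= m.+1 ^ k * hf W (e + k))%N.
  elim: k => [|k IH]; first by rewrite expn0 mul1n addn0.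
  apply: leq_trans IH _; rewrite expnS [(m.+1 * _)%N]mulnC -mulnA leq_mul2l addnS.
  by rewrite hf_succ orbT.
pose k := (d * (e %/ d).+1 - e)%N.
have ek : (e + k = d * (e %/ d).+1)%N.
  by rewrite subnKC // ltnW // mulnC ltn_ceil.
have kd : (k <= d)%N.
  rewrite /k mulnS mulnC {2}(divn_eq e d) leq_subLR; lia.
apply: leq_trans (H k) _; rewrite ek -hf_push; apply: leq_mul.
  by rewrite leq_pexp2l.
by apply: ht; rewrite leqW // leq_divRL // mulnC.
Qed.

Lemma dg_push W : fin W -> dg (push W) = dg W.
Proof.
move=> fW; have fP := fin_push fW.
pose t := (dg W + dg (push W))%N.
have e1 : hf (push W) t = dg (push W) by apply: hf_dg => //; rewrite /t leqW // leq_addl.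
rewrite -e1 hf_push hf_dg // leqW // (leq_trans (leq_addr (dg (push W)) _)) //.
by rewrite leq_pmull.
Qed.

Lemma degree_push W e : degree (push W) e <-> fin W /\ dg W = e.
Proof.
split=> [h|[fW <-]]; last by rewrite -(dg_push fW); exact/dgP/fin_push.
have fW := fin_of_push (degree_fin h).
by split=> //; rewrite -(dg_push fW); exact: degree_dg.
Qed.

Lemma push_union A B : union (push A) (push B) = push (union A B).
Proof. exact: subscheme_ext. Qed.

(** For the harder inclusion, a decomposition a + c on P^m is cut down to one degree divisible by d;
    only a has to be lifted, the other summand being the difference. *)
Lemma push_inter A B : inter (push A) (push B) = push (inter A B).
Proof.
apply: subscheme_ext => q; split.
  by apply: inter_min; apply: push_mono; [exact: inter_lel | exact: inter_ler].
move: q; apply: le_homog => t q hq [k hk]; exists k => nu hnu.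
have hX : 'X_[nu] \is [in K[N.+1], (mdeg nu).-homog] by exact: homog_mpolyX.
have hI := add_ideal (subscheme_ideal A) (subscheme_ideal B).
have : add_pred A B (vmap 'X_[nu] * vmap q).
  apply: (homog_ind_gen hI (vmap_homog hX)) => mu hmu; apply: hk.
  by rewrite hmu (leq_trans hnu) // leq_pmull.
rewrite -vmapM => -[a [c [Aa Bc e]]].
have hXq := dhomogM hX hq; set s := (mdeg nu + t)%N in hXq.
have [qa hqa ea] := vmap_surj (pihomogP mdeg (d * s)%N a).
exists qa, ('X_[nu] * q - qa); rewrite !pushE; split.
- by rewrite ea; exact: ideal_homog.
- rewrite vmapB ea -(pihomog_dE (vmap_homog hXq)) e pihomogD addrC addKr.
  exact: ideal_homog.
by rewrite addrC subrK.
Qed.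

Lemma push_diff A B : diff (push A) (push B) = push (diff A B).
Proof.
apply: subscheme_ext => q; rewrite pushE; split=> h e g hg Bg.
  (* The power g^d has degree divisible by d and so lifts through [vmap]. *)
  have hgd : g ^+ d \is (d * e).-homog by rewrite mulnC; exact: dhomogMn.
  have [q' hq' eq'] := vmap_surj hgd.
  have [|k hk] := h e q' hq'.
    by rewrite pushE eq' -(prednK d0) exprS; exact: ideal_mulr.
  by exists (d * k)%N; rewrite exprM -eq' -vmapXn -vmapM.
have [|k hk] := h (d * e)%N (vmap g) (vmap_homog hg); first exact: Bg.
by exists k; rewrite pushE vmapM vmapXn.
Qed.

Lemma push_empty A : push A 1 <-> A 1.
Proof. by rewrite pushE vmap1. Qed.

(** Forms of degree d on P^m are linear forms on P^N, so the smallest linear subspace containing the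
    image is cut out by the forms of degree d in the ideal of [W]. *)
Lemma in_span_perp W P : P != 0 -> in_span (push W) P -> perp (phi P) d W.
Proof.
move=> P0 hP f hf_ Wf; pose u : 'rV[K]_N.+1 := \row_i f@_(vm i).
have eu : vmap (lform u) = f.
  rewrite /lform vmap_sum [RHS](homog_veronese hf_); apply: eq_bigr => i _.
  by rewrite vmapZ vmapU mxE.
have [L [dL hL]] := lin_of_forms (push W).
have PL : P \in L.
  apply: hP; have [L0|L0] := eqVneq L 0%VS.
    have h0 : hf (push W) 1 = 0%N by rewrite -dL L0 dimv0.
    have W1 : push W 1.
      apply: ideal_sat => i; rewrite mulr1.
      exact: (iffLR (hf0P 1 (subscheme_submod _)) h0 _ (homog_mpolyU K i)).
    by move=> p _; rewrite -[p]mulr1; exact: ideal_mul.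
  by move=> p; apply: lin_gen1 => // h hh /(hL h hh).
have Lu : linear_subspace L (lform u) by apply/(hL _ (lform_homog u)); rewrite pushE eu.
have := lin_lformE Lu PL; rewrite dotC => e; rewrite -[RHS]e.
by apply: eq_bigr => i _; rewrite mxE.
Qed.

Lemma veronese_variety_pull Z : subscheme_le Z (veronese_variety K m d) ->
  exists W, Z = push W.
Proof. by move=> h; exists (pull h); exact: push_pull. Qed.

Lemma rnc_push C : rational_normal_curve C <->
  exists2 L : {vspace 'rV[K]_m.+1}, \dim L = 2%N & C = push (linear_subspace L).
Proof.
split=> [[L dL /subscheme_ext ->]|[L dL ->]]; exists L => //.
  exact: veronese_image_push.
by rewrite veronese_image_push.
Qed.

(** Each point of Z pulls back to a scheme of degree 1, hence to a point of P^m. The r points so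
    obtained form a subscheme of [W] of the same degree, so they are all of it. *)
Lemma points_of_rank_scheme (Z : subscheme K N) r :
  subscheme_le Z (veronese_variety K m d) -> degree Z r -> card_points Z r ->
  exists xs : seq 'rV[K]_m.+1, [/\ gen_pos xs, size xs = r & Z = push (pts xs)].
Proof.
move=> ZX dZ [X [X0 Xinj hX]].
have [W eZ] := veronese_variety_pull ZX; rewrite eZ in dZ hX *.
have [fW dW] := iffLR (degree_push W r) dZ.
have /fin_all_exists[x hx] : forall i, exists x : 'rV[K]_m.+1, x != 0 /\ pt (X i) = push (pt x).
  move=> i; have leX : subscheme_le (pt (X i)) (push W).
    by apply/(point_onP _ (X0 i))/hX => //; exists i, 1; rewrite scale1r.
  have [|Y eY] := @veronese_variety_pull (pt (X i)).
    by move=> p hp; apply/leX/push_le.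
  have fX : fin (pt (X i)) by rewrite pt_pts; exact: fin_pts.
  have fY : fin Y by apply: fin_of_push; rewrite -eY.
  have [|x x0 ex] := dg1_pt fY; first by rewrite -(dg_push fY) -eY dg_pt.
  by exists x; rewrite -ex.
pose xs := [seq x i | i <- enum 'I_r].
have inj i j : x i \in <[x j]>%VS -> i = j.
  move=> xij; have [xi0 ei] := hx i; have [xj0 ej] := hx j.
  have : subscheme_le (pt (X i)) (pt (X j)).
    by rewrite ei ej; apply: push_mono; exact: (iffRL (pt_le_pt (x j) xi0)).
  by move=> /(pt_le_pt (X j) (X0 i))/vlineP[c e]; apply/esym/(Xinj j i c).
have gp : gen_pos xs.
  split.
  - by rewrite map_inj_uniq ?enum_uniq // => i j e; apply: inj; rewrite e memv_line.
  - by move=> _ /mapP[i _ ->]; case: (hx i).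
  by move=> _ _ /mapP[i _ ->] /mapP[j _ ->] /inj ->.
have sx : size xs = r by rewrite size_map size_enum_ord.
exists xs; split=> //; congr push; apply: dg_eq => //; last by rewrite dg_pts // sx dW.
apply: le_homog => t f hf_ Wf; apply/(ptsP _ hf_) => _ /mapP[i _ ->] xi0.
apply/(ptP xi0 hf_); move: f Wf {hf_}; apply: push_inj; case: (hx i) => _ <-.
by apply/(point_onP _ (X0 i))/hX => //; exists i, 1; rewrite scale1r.
Qed.

End Transfer.

(** * The theorem on the Veronese variety *)

Lemma is_min_uniq (Q : nat -> Prop) s t : is_min Q s -> is_min Q t -> s = t.
Proof. by move=> [Qs ms] [Qt mt]; apply/eqP; rewrite eqn_leq ms // mt. Qed.

Lemma interC (K : fieldType) n (A B : subscheme K n) : inter A B = inter B A.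
Proof.
apply: subscheme_ext => p; split=> -[k hk]; exists k => mu /hk[a [b [? ? ->]]];
  by exists b, a; rewrite addrC.
Qed.

Lemma unionC (K : fieldType) n (A B : subscheme K n) : union A B = union B A.
Proof. by apply: subscheme_ext => p; split=> -[]. Qed.

Theorem theorem1 (K : closedFieldType) (charK : [pchar K] =i pred0)
  (m d : nat) (m_ge1 : (1 <= m)%N) (d_ge2 : (2 <= d)%N)
  (P : 'rV[K]_(veronese_dim m d).+1) (P_neq0 : P != 0)
  (b r : nat) (sbrP : symmetric_border_rank P b) (srP : symmetric_rank P r)
  (lt_sbr_sr : (b < r)%N) (sum_le : (b + r <= 2 * d + 1)%N)
  (S : subscheme K (veronese_dim m d)) (hS : realizes_symmetric_rank P S)
  (Z : subscheme K (veronese_dim m d)) (hZ : nonreduced_border_scheme P Z) :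
  exists C : subscheme K (veronese_dim m d),
    let S1 := inter S C in
    let Z1 := inter Z C in
    let S2 := diff (inter S Z) S1 in
    (* C is the unique rational normal curve with deg (C /\ (S \/ Z)) >= d + 2 *)
    [/\ rational_normal_curve C,
        degree_ge (inter C (union S Z)) (d + 2)
      & forall C' : subscheme K (veronese_dim m d),
          rational_normal_curve C' ->
          degree_ge (inter C' (union S Z)) (d + 2) -> subscheme_eq C' C] /\
    (* the decompositions of S and Z *)
    is_disjoint_union S S1 S2 /\ is_disjoint_union Z Z1 S2 /\
    (* C, S2 and Z depend only on P *)
    (forall S' Z' C' : subscheme K (veronese_dim m d),
       realizes_symmetric_rank P S' ->
       nonreduced_border_scheme P Z' ->
       rational_normal_curve C' ->
       degree_ge (inter C' (union S' Z')) (d + 2) ->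
       [/\ subscheme_eq C' C,
           subscheme_eq (diff (inter S' Z') (inter S' C')) S2
         & subscheme_eq Z' Z]) /\
    degree Z b /\
    (exists z1 s1, [/\ degree Z1 z1, degree S1 s1 & (z1 + s1 = d + 2)%N]) /\
    is_empty (inter Z1 S1) /\
    (* Z is the only zero-dimensional W in X with deg W <= sbr(P), P in <W> *)
    (forall W : subscheme K (veronese_dim m d),
       zero_dimensional W ->
       subscheme_le W (veronese_variety K m d) ->
       degree_le W b -> in_span W P -> subscheme_eq W Z).
Proof.
have d0 : (0 < d)%N by apply: leq_trans d_ge2.
have hb s : point_on (secant_variety K m d s) P -> (b <= s)%N by exact: sbrP.2.
have hr (ys : seq 'rV[K]_m.+1) : all (fun x => x != 0) ys ->
    perp (phi P) d (pts ys) -> (r <= size ys)%N.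
  by move=> ys0 hys; apply: srP.2; apply/in_span_of_pointsP; exists ys.
have rankE T : realizes_symmetric_rank P T ->
    exists2 xs, rank_set P r xs & T = push d0 (pts xs).
  move=> [_ _ TX PT [r' [sr' dT cT]]]; rewrite (is_min_uniq sr' srP) in dT cT.
  have [xs [gp sx eT]] := points_of_rank_scheme d0 TX dT cT.
  by exists xs => //; split=> //; apply: (@in_span_perp _ _ _ d0); rewrite -?eT.
have borderE W : subscheme_le W (veronese_variety K m d) -> degree_le W b ->
    in_span W P -> exists2 W0, border_scheme P b W0 & W = push d0 W0.
  move=> WX [e dW le_e] PW; have [W0 eW] := veronese_variety_pull d0 WX.
  rewrite eW in dW PW *; have [fW dgW] := iffLR (degree_push _ _ _) dW.
  by exists W0 => //; split; rewrite ?dgW //; exact: (in_span_perp P_neq0 PW).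
have nonredE W : nonreduced_border_scheme P W ->
    exists2 W0, border_scheme P b W0 & W = push d0 W0.
  move=> [_ _ WX PW [b' sb' dW]]; rewrite (is_min_uniq sb' sbrP) in dW.
  exact: borderE.
have richE W0 xs L : border_scheme P b W0 -> \dim L = 2%N ->
    degree_ge (inter (push d0 (linear_subspace L))
                 (union (push d0 (pts xs)) (push d0 W0))) (d + 2) <->
    rich_line d W0 xs L.
  move=> [fW _ _] dL; rewrite push_union push_inter interC unionC; split.
    by move=> [e /degree_push[_ <-] le_e].
  move=> [_ le_d]; exists (dg (inter (union W0 (pts xs)) (linear_subspace L))) => //.
  by apply/degree_push; split=> //; apply/fin_interl/fin_union => //; exact: fin_pts.
have [xs hxs ->] := rankE S hS; have [W hW ->] := nonredE Z hZ.
have [dW mW] := border_min charK P_neq0 d_ge2 hb hr lt_sbr_sr sum_le hW hxs.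
have [L hL] := rich_exists P_neq0 d_ge2 hr lt_sbr_sr sum_le hW mW hxs.
have dL := hL.1; exists (push d0 (linear_subspace L)).
have [_ _ sum_dg disj] :=
  rich_numbers charK P_neq0 d_ge2 hb hr lt_sbr_sr sum_le hW hxs hL.
have eW := rich_split P_neq0 d_ge2 hr lt_sbr_sr sum_le hW mW hxs hL.
have border_eq W' : border_scheme P b W' -> W' = W.
  by move=> hW'; exact:
    (border_unique charK P_neq0 d_ge2 hb hr lt_sbr_sr sum_le hW' hW hxs).
have off_eq := diff_off charK P_neq0 d_ge2 hb hr lt_sbr_sr sum_le hW.
have [fW _ _] := hW; have [gp _ _] := hxs.
rewrite /= !push_inter push_diff (off_eq _ _ hxs hL).
split; [split|split; [|split; [|split; [|split; [|split; [|split]]]]]].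
- by apply/rnc_push; exists L.
- exact/richE.
- move=> C' /(rnc_push d0)[L' dL' ->] /(richE _ _ _ hW dL') hL'.
  by rewrite (rich_unique charK P_neq0 d_ge2 hb hr lt_sbr_sr sum_le hW hW hxs hL' hL).
- rewrite /is_disjoint_union push_union -pts_split //; split=> //.
  rewrite push_inter; apply/push_empty.
  by apply: inter_min (off_disjoint L xs) => p hp; [apply: interr | apply/interl/interr].
- rewrite /is_disjoint_union push_union -eW; split=> //.
  rewrite push_inter; apply/push_empty.
  by apply: inter_min (off_disjoint L xs) => p hp; [apply: interr | apply/interl/interr].
(* Z' is Z by uniqueness whereas S' may differ from S, so the two lines are compared through the
   common Z. *)
- move=> S' Z' C' /rankE[xs' hxs' ->] /nonredE[W' /border_eq-> ->].
  move=> /(rnc_push d0)[L' dL' ->] /(richE _ _ _ hW dL') hL'.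
  have [eL e_off] :=
    rich_determined charK P_neq0 d_ge2 hb hr lt_sbr_sr sum_le hW hxs' hxs hL' hL.
  by rewrite !push_inter push_diff (off_eq _ _ hxs' hL') e_off eL.
- by apply/degree_push.
- exists (dg (inter W (linear_subspace L))), (size (on L xs)); split.
  + by apply/degree_push; split=> //; exact: fin_interl.
  + apply/degree_push; rewrite inter_pts_lin //; split; first exact: fin_pts.
    by rewrite dg_pts //; exact: gen_pos_filter.
  + exact: sum_dg.
- by apply/push_empty; rewrite inter_pts_lin.
move=> W' _ W'X dW' PW'; have [W0 hW0 ->] := borderE W' W'X dW' PW'.
by rewrite (border_eq _ hW0).
Qed.
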